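(* Let $t\in[T]$ and suppose the GDP-trained network $f_t$ satisfies $\mathbf u(t)=f_t(S)-\mathbf y=\mathbf v(t)+\mathbf e(t)$ with $\mathbf v(t)\in\mathcal V_t$ and $\mathbf e(t)\in\mathcal E_{t,\tau}$. Let $n\ge C\log(2/\delta)d^{2k_0}$ for a sufficiently large constant $C$, $\delta\in(0,1/2)$, $\eta\in(0,1)$ and $\tau\le\sqrt{d^{k_0}/n}$. Then with probability at least $1-2\delta-\exp(-\Theta(r_0))$ over $S$ and $\mathbf w$, $$\mathbb E_{P_n}[(f_t-f^* )^2]\le\Theta\Big(\frac{\gamma_0^2}{\eta t}\Big)+\gamma_0^2\log(2/\delta)\cdot\Theta\Big(\frac{d^{k_0}}{n}\Big).$$
   Context: Setup. $\mathcal X=S^{d-1}$, uniform measure $P=\mu$; $k_0\ge1$ constant, $d$ at least a large constant. Features $S=\{\vec x_i\}_{i=1}^n$ i.i.d. from $P$, distinct; $\mathbb E_{P_n}[g]=\frac1n\sum_ig(\vec x_i)$; $f(S)=(f(\vec x_1),\dots,f(\vec x_n))^\top$. $\mathbf y=f^*(S)+\mathbf w$, $\mathbf w$ i.i.d. mean-zero sub-Gaussian entries with variance proxy $\sigma_0^2$. Kernel $K=K^{(0)}+K^{(1)}$, $K^{(0)}(u,v)=\frac{\pi-\arccos(u^\top v)}{2\pi}$, $K^{(1)}(u,v)=u^\top vK^{(0)}(u,v)$. $\mathcal H_\ell$ = degree-$\ell$ spherical harmonics on $S^{d-1}$ (dim $N(d,\ell)$, orthonormal basis $Y_{\ell j}$),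 eigenspace of the integral operator $T_K$ with eigenvalue $\mu_\ell$; $m_\ell=\sum_{\ell'\le\ell}N(d,\ell')$, $r_0=m_{k_0}$. Target $f^*=\sum_{\ell\le k_0,j}a_{\ell j}Y_{\ell j}$ with $\sum a_{\ell j}^2/\mu_\ell\le\gamma_0^2$, $\gamma_0$ constant. $\mathbf K_n=[K(\vec x_i,\vec x_j)/n]=\mathbf U\Sigma\mathbf U^\top$, eigenvalues $\hat\lambda_1\ge\dots\ge\hat\lambda_n>0$; $\mathbf P^{(r_0)}=\mathbf U\Sigma^{(r_0)}\mathbf U^\top$ with $\Sigma^{(r_0)}$ diagonal, first $r_0$ entries $1$, rest $0$. For $\tau>0$: $\mathcal V_t=\{-(I_n-\eta\mathbf K_n\mathbf P^{(r_0)})^tf^*(S)\}$ and $\mathcal E_{t,\tau}=\{\mathbf e_1+\mathbf e_2:\mathbf e_1=-(I_n-\eta\mathbf K_n\mathbf P^{(r_0)})^t\mathbf w,\ \|\mathbf e_2\|_2\le\sqrt n\tau\}$. $f_t$ is a function on $\mathcal X$ (the network after $t$ steps of GDP). Constants in $\Theta$ are independent of $n,d,t,\delta$. *)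

(* Defs.v *)
From HB Require Import structures.
From mathcomp Require Import all_boot all_order all_algebra.
From mathcomp Require Import all_classical all_reals all_analysis.
Set Implicit Arguments. Unset Strict Implicit. Unset Printing Implicit Defensive.
Import Order.TTheory GRing.Theory Num.Theory.
Import numFieldNormedType.Exports.
Local Open Scope classical_set_scope.
Local Open Scope ring_scope.

Section Defs.
Variable R : realType.

Definition dotp d (u v : 'rV[R]_d) : R := \sum_(k < d) u 0 k * v 0 k.
Definition on_sphere d (x : 'rV[R]_d) : Prop := dotp x x = 1.

Definition K0 d (u v : 'rV[R]_d) : R := (pi - acos (dotp u v)) / (2 * pi).
Definition Kker d (u v : 'rV[R]_d) : R := K0 u v + dotp u v * K0 u v.

Definition homog_poly d l (c : {ffun 'I_d -> 'I_l.+1} -> R) (x : 'rV[R]_d) : R :=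
  \sum_(a : {ffun 'I_d -> 'I_l.+1} | (\sum_(k < d) (a k : nat) == l)%N)
     c a * \prod_(k < d) x 0 k ^+ a k.

Definition unitv d (k : 'I_d) : 'rV[R]_d := delta_mx 0 k.

Definition laplacian d (p : 'rV[R]_d -> R) (x : 'rV[R]_d) : R :=
  \sum_(k < d) 'D_(unitv k) ('D_(unitv k) p) x.

Definition sph_harmonic d l (Y : 'rV[R]_d -> R) : Prop :=
  exists c : {ffun 'I_d -> 'I_l.+1} -> R,
    (forall x, laplacian (homog_poly c) x = 0) /\
    (forall x, on_sphere x -> Y x = homog_poly c x).

(** N(d,l) = dim H_l, and r0 = m_{k0} = sum_{l <= k0} N(d,l). *)
Definition Ndim (d l : nat) : nat :=
  match l with
  | 0 => 1
  | 1 => d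
  | l'.+2 => 'C(d + l'.+1, l'.+2) - 'C(d + l' - 1, l')
  end.
Definition r0 (d k0 : nat) : nat := \sum_(l < k0.+1) Ndim d l.

Section Prob.
Context (dO : measure_display) (Om : measurableType dO) (P : probability Om R).

(** Z is a random vector uniformly distributed on S^{d-1}: its coordinates are
    measurable, it takes values on the sphere, and its law (determined by its
    joint CDF) is invariant under every orthogonal transformation; this is the
    (unique) rotation-invariant probability on the sphere. *)
Definition uniform_sphere_rv d (Z : Om -> 'rV[R]_d) : Prop :=
  (forall k, measurable_fun setT (fun om => Z om 0 k)) /\
  (forall om, on_sphere (Z om)) /\
  (forall Q : 'M[R]_d, Q *m Q^T = 1%:M -> forall a : 'rV[R]_d,
     P [set om | forall k, (Z om *m Q) 0 k <= a 0 k] =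
     P [set om | forall k, Z om 0 k <= a 0 k]).

Definition noise_model n (w : 'I_n -> Om -> R) (s0 : R) : Prop :=
  (forall i, measurable_fun setT (w i)) /\
  (forall i, P.-integrable setT (EFin \o w i)) /\
  (forall i, (\int[P]_om (w i om)%:E = 0)%E) /\
  (forall i (lam : R), (\int[P]_om (expR (lam * w i om))%:E
                         <= (expR (lam ^+ 2 * s0 ^+ 2 / 2))%:E)%E) /\
  (forall i j (b : R), P [set om | w i om <= b] = P [set om | w j om <= b]).

Definition indep_sample n d (X : 'I_n -> Om -> 'rV[R]_d) (w : 'I_n -> Om -> R) : Prop :=
  forall (a : 'I_n -> 'rV[R]_d) (b : 'I_n -> R),
    P [set om | (forall i k, X i om 0 k <= a i 0 k) /\ (forall i, w i om <= b i)] =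
    (\prod_(i < n) P [set om | (forall k, X i om 0 k <= a i 0 k)%R] *
     \prod_(i < n) P [set om | (w i om <= b i)%R])%E.

(** Target condition, expressed with a uniform random vector Z (integrals
    against Z are integrals against the uniform measure on the sphere):
    f* = sum_{l <= k0} f_l with f_l in H_l, mu_l the eigenvalue of T_K on f_l,
    and sum_l ||f_l||^2_{L^2} / mu_l <= gamma0^2. *)
Definition target_cond d (Z : Om -> 'rV[R]_d) (k0 : nat) (gamma0 : R)
    (fstar : 'rV[R]_d -> R) : Prop :=
  exists (fl : nat -> 'rV[R]_d -> R) (mu : nat -> R),
    (forall l, (l <= k0)%N ->
       [/\ sph_harmonic l (fl l), 0 < mu l &
           forall x, on_sphere x ->
             (\int[P]_om (Kker x (Z om) * fl l (Z om))%:E = (mu l * fl l x)%:E)%E]) /\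
    (forall x, on_sphere x -> fstar x = \sum_(l < k0.+1) fl l x) /\
    (\sum_(l < k0.+1) \int[P]_om (fl l (Z om) ^+ 2 / mu l)%:E <= (gamma0 ^+ 2)%:E)%E.

End Prob.

Definition gram n d (S : 'I_n -> 'rV[R]_d) : 'M[R]_n :=
  \matrix_(i, j) (Kker (S i) (S j) / n%:R).

Definition sorted_eigdec n (A U : 'M[R]_n) (lam : 'I_n -> R) : Prop :=
  [/\ U *m U^T = 1%:M,
      (forall i j : 'I_n, (i <= j)%N -> lam j <= lam i) &
      A = U *m diag_mx (\row_i lam i) *m U^T].

Definition topproj n (r : nat) (U : 'M[R]_n) : 'M[R]_n :=
  U *m diag_mx (\row_(i < n) (if (i < r)%N then 1 else 0 : R)) *m U^T.

Definition vnorm n (v : 'cV[R]_n) : R := Num.sqrt (\sum_(i < n) v i 0 ^+ 2).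

Definition evalS n d (f : 'rV[R]_d -> R) (S : 'I_n -> 'rV[R]_d) : 'cV[R]_n :=
  \col_i f (S i).

End Defs.

(* Main.v *)
Require Import Defs.
From HB Require Import structures.
From mathcomp Require Import all_boot all_order all_algebra.
From mathcomp Require Import all_classical all_reals all_analysis.
From mathcomp Require Import measurable_realfun ring lra zify.
Set Implicit Arguments. Unset Strict Implicit. Unset Printing Implicit Defensive.
Import Order.TTheory GRing.Theory Num.Theory.
Import numFieldNormedType.Exports.
Local Open Scope classical_set_scope.
Local Open Scope ring_scope.

(** Expand the kernel as K(x, y) = sum_k c_k (x . y)^k with all c_k > 0 (arcsine
    series).  Moments of the uniform distribution satisfy an integration by parts
    rule (differentiate invariance under Givens rotations), which controls the L^2
    norm of a homogeneous polynomial by the norm of its coefficient tensor: from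
    below by (2 d)^-k, and from above by d^(j-1-k) if the j-fold trace of the tensor
    vanishes.  An exponential bound for the squared norm of sums of independent
    vectors transfers this to the sample with error O(sqrt (log (2/delta) / n)).
    By Courant-Fischer on the span of the monomials of degree k0 and k0 - 1, of
    dimension r0, the top r0 eigenvalues of K_n are of order at least d^-k0 and the
    others at most half the mu_l.  A component f_l of the target is an approximate eigenvector of K_n, so
    its part outside the top r0 eigenvectors is small, while on the top part gradient
    descent contracts.  The noise on the top r0 eigenvectors is bounded by the filter
    1 - (1 - K_n)^N with N of order d^k0, whose squared singular values sum to at
    most N; a Gaussian-mixing bound on the moment generating function of the
    quadratic form concludes. *)

(** * Independence *)

(** Everything about a target component is drawn from two facts: it is a polynomial of degree l on
    the sphere, and it solves the integral equation. The eigenvectors [U] are arbitrary functions of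
    the outcome, so the projection onto the top ones cannot enter a probability estimate. The filter
    is a polynomial in K_n, hence a measurable function of the features alone and independent of the
    noise; its bound by N comes from tr K_n = 1. The rate d^k0 / n, instead of d^(2 k0) / n, comes
    from measuring the residual mu f - K_n f in the norm dual to the quadratic form of K_n and not
    in the Euclidean one: this saves a factor mu. The sample size of order d^(2 k0) log (2/delta)
    pushes the deviation of the empirical moments below d^-k0, the scale of the top eigenvalues. The
    spectrum involves finitely many moments, but the residuals involve all degrees. Weighting degree
    k by the kernel coefficient keeps the whole feature vector bounded, so one tail bound serves
    every degree at once, without a union bound. *)

Lemma sigma_sub_measurable d (T : measurableType d) (G : set (set T)) :
  G `<=` measurable -> <<s G >> `<=` measurable.
Proof. by move=> mG; apply: smallest_sub => //; exact: sigma_algebra_measurable. Qed.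

Section Independence.
Context (R : realType) (dO : measure_display) (Om : measurableType dO)
  (P : probability Om R).

(** Both sides are finite measures of [A]: the law of [X] restricted to [D], and [P D] times the law
    of [X]. They agree on a generating pi-system, hence everywhere. *)
Lemma indep_sigma d1 (T1 : measurableType d1) (G : set (set T1))
    (X : {mfun Om >-> T1}) (D : set Om) :
  measurable D -> measurable = <<s G >> -> setI_closed G -> G setT ->
  (forall A, G A -> P (X @^-1` A `&` D) = (P (X @^-1` A) * P D)%E) ->
  forall A, measurable A -> P (X @^-1` A `&` D) = (P (X @^-1` A) * P D)%E.
Proof.
move=> mD mG IG TG h A mA.
have p0 : 0 <= fine (P D) by exact: fine_ge0.
pose c : {nonneg R} := NngNum p0.
have mX : measurable_fun setT X by exact: measurable_funP.
pose m1_ : {measure set T1 -> \bar R} := pushforward (mrestr P mD) X.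
pose m1 := m1_ mX.
pose m2 : {measure set T1 -> \bar R} := mscale c (distribution P X).
suff: m1 A = m2 A.
  rewrite /m1 /m1_ /m2 /= /pushforward /mrestr /mscale /= fineK ?fin_num_measure//.
  by rewrite /distribution /pushforward muleC.
apply: (@measure_unique _ _ _ G (fun=> setT)) => //.
- by apply/seteqP; split => // x _; exists 0%N.
- move=> B GB; rewrite /m1 /m1_ /m2 /= /pushforward /mrestr /mscale /=.
  by rewrite fineK ?fin_num_measure// /distribution /pushforward muleC h.
- move=> _; rewrite /m1 /m1_ /= /pushforward /mrestr preimage_setT setTI.
  by rewrite ltey_eq fin_num_measure.
Qed.

(** Independence passes from the pi-systems to the sigma-algebras one coordinate at a time; the
    joint law is then the product law, and Tonelli gives the iterated integral. *)
Lemma indep_integral d1 d2 (T1 : measurableType d1) (T2 : measurableType d2)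
    (G1 : set (set T1)) (G2 : set (set T2))
    (X1 : {mfun Om >-> T1}) (X2 : {mfun Om >-> T2}) (f : T1 * T2 -> \bar R) :
  measurable = <<s G1 >> -> setI_closed G1 -> G1 setT ->
  measurable = <<s G2 >> -> setI_closed G2 -> G2 setT ->
  (forall A B, G1 A -> G2 B ->
    P (X1 @^-1` A `&` X2 @^-1` B) = (P (X1 @^-1` A) * P (X2 @^-1` B))%E) ->
  measurable_fun [set: (T1 * T2)%type] f -> (forall z, (0 <= f z)%E) ->
  (\int[P]_om f (X1 om, X2 om) = \int[P]_om \int[P]_om' f (X1 om, X2 om'))%E.
Proof.
move=> mG1 IG1 TG1 mG2 IG2 TG2 h mf f0.
have mX1 B : measurable B -> measurable (X1 @^-1` B).
  by move=> mB; rewrite -[X in measurable X]setTI; exact: measurable_funP.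
have mX2 B : measurable B -> measurable (X2 @^-1` B).
  by move=> mB; rewrite -[X in measurable X]setTI; exact: measurable_funP.
have sG2 B : G2 B -> measurable B by rewrite mG2; exact: sub_sigma_algebra.
have h1 A B : measurable A -> G2 B ->
    P (X1 @^-1` A `&` X2 @^-1` B) = (P (X1 @^-1` A) * P (X2 @^-1` B))%E.
  move=> mA GB; apply: (@indep_sigma _ _ G1) => //; first exact/mX2/sG2.
  by move=> A' GA'; exact: h.
have h2 A B : measurable A -> measurable B ->
    P (X1 @^-1` A `&` X2 @^-1` B) = (P (X1 @^-1` A) * P (X2 @^-1` B))%E.
  move=> mA mB; rewrite setIC muleC.
  apply: (@indep_sigma _ _ G2) => //; first exact/mX1.
  by move=> B' GB'; rewrite setIC muleC; exact: h1.
have mp : measurable_fun setT (fun om => (X1 om, X2 om)).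
  by apply: measurable_fun_pair; exact: measurable_funP.
pose XX : {mfun Om >-> (T1 * T2)%type} :=
  HB.pack (fun om => (X1 om, X2 om)) (isMeasurableFun.Build _ _ _ _ _ mp).
rewrite -[LHS](@ge0_integral_distribution _ _ _ _ _ P XX)//.
have -> : (\int[distribution P XX]_y f y =
   \int[(distribution P X1 \x distribution P X2)%E]_y f y)%E.
  apply: eq_measure_integral => A mA _; apply/esym.
  by apply: product_measure_unique => // A1 B1 mA1 mB1; exact: h2.
rewrite fubini_tonelli1// /fubini_F ge0_integral_distribution//; last 2 first.
- exact: measurable_fun_fubini_tonelli_F.
- by move=> x; apply: integral_ge0.
apply: eq_integral => om _ /=.
rewrite ge0_integral_distribution//.
exact: measurableT_comp.
Qed.

End Independence.

(** * Spectral bounds for projected gradient descent *)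

Section LinearAlgebra.
Variable R : realType.

Definition sqn n (v : 'cV[R]_n) : R := \sum_i v i 0 ^+ 2.
Definition dotv n (u v : 'cV[R]_n) : R := (u^T *m v) 0 0.
Definition quad n (A : 'M[R]_n) (v : 'cV[R]_n) : R := dotv v (A *m v).

Lemma dotvE n (u v : 'cV[R]_n) : dotv u v = \sum_i u i 0 * v i 0.
Proof. by rewrite /dotv mxE; apply: eq_bigr => i _; rewrite mxE. Qed.

Lemma sqnE n (v : 'cV[R]_n) : sqn v = dotv v v.
Proof. by rewrite dotvE; apply: eq_bigr => i _; rewrite expr2. Qed.

Lemma sqn_ge0 n (v : 'cV[R]_n) : 0 <= sqn v.
Proof. by apply: sumr_ge0 => i _; rewrite sqr_ge0. Qed.

Lemma sqn_gt0 n (v : 'cV[R]_n) : v != 0 -> 0 < sqn v.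
Proof.
move=> v0; rewrite lt_def sqn_ge0 andbT; apply: contra v0.
rewrite psumr_eq0 => [/allP h|i _]; last by rewrite sqr_ge0.
apply/eqP/colP => i; rewrite mxE; apply/eqP.
by have := h i (mem_index_enum i); rewrite sqrf_eq0.
Qed.

Lemma sqn_add3 n (x y z : 'cV[R]_n) :
  sqn (x + y + z) <= 3 * (sqn x + sqn y + sqn z).
Proof.
rewrite /sqn -!big_split mulr_sumr; apply: ler_sum => i _ /=; rewrite !mxE.
have := sqr_ge0 (x i 0 - y i 0); have := sqr_ge0 (y i 0 - z i 0).
have := sqr_ge0 (x i 0 - z i 0); nra.
Qed.

Lemma exists_left_kernel m p (D : 'M[R]_(p, m)) : (m < p)%N ->
  exists2 c : 'rV[R]_p, c != 0 & c *m D = 0.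
Proof.
move=> mp; have : kermx D != 0.
  rewrite -mxrank_eq0 mxrank_ker -lt0n subn_gt0.
  by apply: leq_ltn_trans mp; exact: rank_leq_col.
by move=> /rowV0Pn[c /sub_kermxP cD c0]; exists c.
Qed.

Section Eigen.
Variables (n : nat) (U : 'M[R]_n).
Hypothesis hU : U *m U^T = 1%:M.

(** Functional calculus in the eigenbasis [U]. The function is taken on indices instead of
    eigenvalues, so that the projection onto the first [r] eigenvectors is an instance. *)
Definition spec_mx (f : 'I_n -> R) : 'M[R]_n := U *m diag_mx (\row_i f i) *m U^T.
Definition coef (v : 'cV[R]_n) (i : 'I_n) : R := (U^T *m v) i 0.

Lemma orth_tr : U^T *m U = 1%:M.
Proof. exact: mulmx1C. Qed.

Lemma coefD u v i : coef (u + v) i = coef u i + coef v i.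
Proof. by rewrite /coef mulmxDr mxE. Qed.

Lemma coefN u i : coef (- u) i = - coef u i.
Proof. by rewrite /coef mulmxN mxE. Qed.

Lemma coefZ a u i : coef (a *: u) i = a * coef u i.
Proof. by rewrite /coef -scalemxAr mxE. Qed.

Lemma coef_spec f v i : coef (spec_mx f *m v) i = f i * coef v i.
Proof.
rewrite /coef /spec_mx !mulmxA orth_tr mul1mx -mulmxA mul_diag_mx mxE.
by rewrite mxE.
Qed.

Lemma coef_col z i : coef (U *m z) i = z i 0.
Proof. by rewrite /coef mulmxA orth_tr mul1mx. Qed.

Lemma dotv_coef u v : dotv u v = \sum_i coef u i * coef v i.
Proof.
by rewrite -[RHS]dotvE /dotv trmx_mul trmxK mulmxA -(mulmxA _ U) hU mulmx1.
Qed.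

Lemma sqn_coef v : sqn v = \sum_i coef v i ^+ 2.
Proof. by rewrite sqnE dotv_coef; apply: eq_bigr => i _; rewrite expr2. Qed.

Lemma quad_coef f v : quad (spec_mx f) v = \sum_i f i * coef v i ^+ 2.
Proof.
rewrite /quad dotv_coef; apply: eq_bigr => i _.
by rewrite coef_spec; ring.
Qed.

Lemma spec_mxM f g : spec_mx f *m spec_mx g = spec_mx (fun i => f i * g i).
Proof.
rewrite /spec_mx !mulmxA -(mulmxA (U *m _) (U^T) U) orth_tr mulmx1.
rewrite -(mulmxA U) mulmx_diag; congr (_ *m diag_mx _ *m _).
by apply/rowP => i; rewrite !mxE.
Qed.

Lemma spec_mx1 : spec_mx (fun=> 1) = 1%:M.
Proof.
rewrite /spec_mx (_ : \row__ 1 = const_mx 1); last first.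
  by apply/rowP => i; rewrite !mxE.
by rewrite diag_const_mx mulmx1.
Qed.

Lemma spec_mx_lin a f b g :
  a *: spec_mx f + b *: spec_mx g = spec_mx (fun i => a * f i + b * g i).
Proof.
have Z c h : c *: spec_mx h = spec_mx (fun i => c * h i).
  rewrite /spec_mx scalemxAl scalemxAr -linearZ /=.
  by congr (_ *m diag_mx _ *m _); apply/rowP => i; rewrite !mxE.
rewrite !Z /spec_mx -mulmxDl -mulmxDr -linearD /=.
by congr (_ *m diag_mx _ *m _); apply/rowP => i; rewrite !mxE.
Qed.

Lemma spec_mx_exp f t : spec_mx f ^+ t = spec_mx (fun i => f i ^+ t).
Proof.
elim: t => [|t IH]; first by rewrite -[LHS]/(1%:M) -spec_mx1.
rewrite exprS IH -[LHS]/(_ *m _) spec_mxM.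
by congr spec_mx; apply/funext => i; rewrite exprS.
Qed.

Lemma spec_mxB1 f : 1%:M - spec_mx f = spec_mx (fun i => 1 - f i).
Proof.
rewrite -spec_mx1 -[X in X - _]scale1r -scaleN1r spec_mx_lin.
by congr spec_mx; apply/funext => i; ring.
Qed.

Variable lam : 'I_n -> R.
Let A := spec_mx lam.
Hypothesis lamS : forall i j : 'I_n, (i <= j)%N -> lam j <= lam i.

(** Half of Courant-Fischer. The rows of [B] span [r > i] dimensions, so a nonzero combination of
    them is orthogonal to the first [i] eigenvectors, where the form is at most [lam i]. *)
Lemma eig_lower r (B : 'M[R]_(r, n)) th :
  (forall c : 'rV_r, c *m B = 0 -> c = 0) ->
  (forall c : 'rV_r, th * sqn (c *m B)^T <= quad A (c *m B)^T) ->
  forall i : 'I_n, (i < r)%N -> th <= lam i.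
Proof.
move=> Bfree hB i ir; rewrite leNgt; apply/negP => lt.
pose wi := widen_ord (ltnW (ltn_ord i)).
pose D : 'M[R]_(r, i) := \matrix_(k, j) (B *m U) k (wi j).
have [c c0 cD] := exists_left_kernel D ir.
pose v := (c *m B)^T.
have v0 : v != 0.
  apply: contra c0 => /eqP v0; apply/eqP/Bfree.
  by rewrite -[LHS]trmxK -/v v0 trmx0.
have cv (j : 'I_n) : (j < i)%N -> coef v j = 0.
  move=> ji; have wj : wi (Ordinal ji) = j by exact/val_inj.
  have /rowP/(_ (Ordinal ji)) := cD; rewrite [LHS]mxE [RHS]mxE => <-.
  rewrite /coef /v -trmx_mul mxE -mulmxA mxE; apply: eq_bigr => k _.
  by rewrite [in RHS]mxE wj.
have := hB c; rewrite -/v /A quad_coef sqn_coef mulr_sumr => h1.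
have h2 : \sum_j lam j * coef v j ^+ 2 <= \sum_j lam i * coef v j ^+ 2.
  apply: ler_sum => j _; have [ij|ji] := leqP i j.
    by rewrite ler_wpM2r ?sqr_ge0 ?lamS.
  by rewrite cv // expr0n !mulr0.
have := sqn_gt0 v0; rewrite sqn_coef => h3.
have := le_trans h1 h2; rewrite -!mulr_sumr ler_pM2r // leNgt.
by rewrite lt.
Qed.

(** The other half: the first [i + 1 > r] eigenvectors have a nonzero combination killed by the [r]
    rows of [B], and on it the form is at least [lam i]. *)
Lemma eig_upper r (B : 'M[R]_(r, n)) th :
  (forall v : 'cV_n, B *m v = 0 -> quad A v <= th * sqn v) ->
  forall i : 'I_n, (r <= i)%N -> lam i <= th.
Proof.
move=> hB i ri; rewrite leNgt; apply/negP => lt.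
pose wi := widen_ord (ltn_ord i).
pose D : 'M[R]_(i.+1, r) := \matrix_(j, k) (B *m U) k (wi j).
have [g g0 gD] := @exists_left_kernel _ _ D ri.
pose z : 'cV[R]_n := \col_j (if insub (val j) is Some k then g 0 k else 0).
have zw k : z (wi k) 0 = g 0 k.
  by rewrite mxE -[val (wi k)]/(val k) valK.
have z_out (j : 'I_n) : (i < j)%N -> z j 0 = 0.
  by move=> ij; rewrite mxE insubF //; apply/negbTE; rewrite -leqNgt.
have z0 : z != 0.
  apply: contra g0 => /eqP z0; apply/eqP/rowP => k.
  by rewrite mxE -zw z0 mxE.
pose v := U *m z.
have Bv : B *m v = 0.
  apply/colP => k; transitivity ((g *m D) 0 k); last by rewrite gD !mxE.
  rewrite mulmxA [LHS]mxE [RHS]mxE.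
  rewrite (bigID (fun j : 'I_n => (j < i.+1)%N)) /= [X in _ + X]big1 ?addr0.
    rewrite (big_ord_narrow (ltn_ord i)); apply: eq_bigr => j _.
    by rewrite -/(wi j) zw [in RHS]mxE mulrC.
  by move=> j; rewrite -leqNgt => ij; rewrite z_out ?mulr0.
have := hB _ Bv; rewrite /A quad_coef sqn_coef mulr_sumr => h1.
have h2 : \sum_j lam i * coef v j ^+ 2 <= \sum_j lam j * coef v j ^+ 2.
  apply: ler_sum => j _; rewrite coef_col; have [ji|ij] := leqP j i.
    by rewrite ler_wpM2r ?sqr_ge0 ?lamS.
  by rewrite z_out // expr0n !mulr0.
have := sqn_gt0 z0; have -> : sqn z = \sum_j coef v j ^+ 2.
  by apply: eq_bigr => j _; rewrite coef_col.
move=> h3; have := le_trans h2 h1.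
by rewrite -!mulr_sumr ler_pM2r // leNgt lt.
Qed.

(** This is [(1 - x)^N <= 1 / (1 + N x)] without a division. It serves the filter, the decay of
    gradient descent and the convergence of the arcsine series. *)
Lemma expr_bernoulli (x : R) N : 0 <= x <= 1 -> (1 - x) ^+ N * (1 + N%:R * x) <= 1.
Proof.
move=> /andP[x0 x1]; elim: N => [|N IH]; first by rewrite expr0; lra.
rewrite exprS; apply: le_trans IH.
set p := (1 - x) ^+ N; have p0 : 0 <= p by rewrite exprn_ge0 // subr_ge0.
have -> : (1 - x) * p * (1 + N.+1%:R * x) = p * ((1 - x) * (1 + N.+1%:R * x)) by ring.
rewrite ler_wpM2l //.
have -> : N.+1%:R = N%:R + 1 :> R by rewrite -natr1.
have N0 : 0 <= N%:R :> R by [].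
nra.
Qed.

Lemma topproj_spec r : topproj r U = spec_mx (fun i => if (i < r)%N then 1 else 0).
Proof. by []. Qed.

Section Tail.
Variable r : nat.

(** In the eigenbasis [D] has coefficients [mu - lam i] times those of [F], and
    [mu - lam i >= mu / 2] from index [r] on. The hypothesis on [D] is in the norm dual to [quad A];
    since [A] is at most [mu / 2] on the tail, it gains a factor [mu] over the Euclidean bound by
    [E]. *)
Lemma eig_tail (F D : 'cV[R]_n) (mu E : R) :
  A *m F = mu *: F - D -> 0 < mu -> 0 <= E ->
  (forall i : 'I_n, (r <= i)%N -> lam i <= mu / 2) ->
  (forall a, dotv a D ^+ 2 <= E * quad A a) ->
  \sum_(i : 'I_n | (r <= i)%N) coef F i ^+ 2 <= 2 * E / mu.
Proof.
move=> AF mu0 E0 hl hD.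
have Di i : coef D i = (mu - lam i) * coef F i.
  have := congr1 (coef ^~ i) AF.
  by rewrite coef_spec coefD coefN coefZ => h; rewrite mulrBl h; ring.
pose S := \sum_(i : 'I_n | (r <= i)%N) coef D i ^+ 2.
have S0 : 0 <= S by apply: sumr_ge0 => i _; rewrite sqr_ge0.
have SE : S <= E * (mu / 2).
  (* Testing [D] against its own tail turns the dual bound into [S^2 <= E (mu / 2) S]. *)
  pose z : 'cV[R]_n := \col_i (if (r <= i)%N then coef D i else 0).
  have := hD (U *m z); rewrite dotv_coef quad_coef.
  have -> : \sum_i coef (U *m z) i * coef D i = S.
    rewrite /S [RHS]big_mkcond /=; apply: eq_bigr => i _.
    by rewrite coef_col mxE; case: ifP => _; rewrite ?mul0r ?expr2.
  have h : \sum_i lam i * coef (U *m z) i ^+ 2 <= mu / 2 * S.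
    rewrite /S mulr_sumr [leRHS]big_mkcond /=; apply: ler_sum => i _.
    rewrite coef_col mxE; case: ifP => ri; last by rewrite expr0n mulr0.
    by rewrite ler_wpM2r ?sqr_ge0 ?hl.
  move=> h2; have : S ^+ 2 <= E * (mu / 2) * S.
    by rewrite -mulrA; apply: le_trans h2 _; rewrite ler_wpM2l.
  move: S0; rewrite le_eqVlt => /orP[/eqP <- _|S0].
    by rewrite mulr_ge0 // divr_ge0 // ltW.
  by rewrite expr2 ler_pM2r.
have h3 : (mu / 2) ^+ 2 * \sum_(i : 'I_n | (r <= i)%N) coef F i ^+ 2 <= S.
  rewrite mulr_sumr; apply: ler_sum => i ri; rewrite Di [leRHS]exprMn.
  have := hl i ri => hi; apply: ler_wpM2r; first exact: sqr_ge0.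
  by rewrite ler_sqr ?nnegrE; lra.
have h4 := le_trans h3 SE.
have m20 : 0 < mu / 2 by lra.
move: h4; rewrite expr2 -mulrA mulrC -subr_ge0 => h4.
have h5 : mu / 2 * (\sum_(i : 'I_n | (r <= i)%N) coef F i ^+ 2) <= E.
  rewrite -(ler_pM2l m20) -subr_ge0; apply: le_trans h4 _; rewrite le_eqVlt.
  by apply/orP; left; apply/eqP; ring.
rewrite ler_pdivlMr //; lra.
Qed.

Hypothesis lam1 : forall i, lam i <= 1.
Variable th : R.
Hypothesis th0 : 0 < th.
Hypothesis lam_top : forall i : 'I_n, (i < r)%N -> th <= lam i.

(** On the first [r] eigenvectors the filter is at least 1/2, since
    [(1 - lam i)^N <= 1 / (1 + N th) <= 1 / 2]; squaring gives the 4. *)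
Lemma top_coef_filter N (w : 'cV[R]_n) : 1 <= N%:R * th ->
  \sum_(i : 'I_n | (i < r)%N) coef w i ^+ 2 <= 4 * sqn ((1%:M - (1%:M - A) ^+ N) *m w).
Proof.
move=> Nth; rewrite /A spec_mxB1 spec_mx_exp spec_mxB1 sqn_coef mulr_sumr.
rewrite [leLHS]big_mkcond /=; apply: ler_sum => i _; rewrite coef_spec.
case: ifP => ir; last by rewrite mulr_ge0 // sqr_ge0.
have hi : th <= lam i <= 1 by rewrite lam_top ?lam1.
have /andP[hi1 hi2] := hi.
have := @expr_bernoulli (lam i) N; set p := (1 - lam i) ^+ N => hb.
have p0 : 0 <= p by rewrite exprn_ge0 // subr_ge0; case/andP: hi.
have N0 : 0 <= N%:R :> R by [].
have p1 : p * 2 <= 1.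
  have x01 : 0 <= lam i <= 1 by rewrite hi2 (le_trans (ltW th0) hi1).
  apply: le_trans (hb x01); rewrite ler_wpM2l //; nra.
rewrite exprMn mulrA -[leLHS]mul1r ler_wpM2r ?sqr_ge0 //; nra.
Qed.

(** From index [r] on the matrix [M] is the identity: the noise term has no component there and the
    target term stays as it is. On the first [r] the noise is multiplied by a factor in [0, 1], and
    the target by [(1 - eta lam)^t], whose square is at most [1 / (2 eta t lam)]. *)
Lemma gd_error_bound (eta Gam Bw Bf Be : R) (t : nat) (f w e : 'cV[R]_n) :
  let M := 1%:M - eta *: (A *m topproj r U) in
  0 < eta < 1 -> (0 < t)%N -> 0 <= Gam ->
  \sum_(i : 'I_n | (i < r)%N) coef w i ^+ 2 <= Bw ->
  (forall a, dotv a f ^+ 2 <= Gam * quad A a) ->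
  \sum_(i : 'I_n | (r <= i)%N) coef f i ^+ 2 <= Bf ->
  sqn e <= Be ->
  sqn ((w - M ^+ t *m w) + (- (M ^+ t *m f)) + e) <=
    3 * (Bw + (Gam / (2 * eta * t%:R) + Bf) + Be).
Proof.
move=> M /andP[eta0 eta1] t0 Gam0 hw hf hb he.
apply: le_trans (sqn_add3 _ _ _) _; rewrite ler_pM2l //.
pose m (i : 'I_n) := if (i < r)%N then 1 - eta * lam i else 1.
have ME : M ^+ t = spec_mx (fun i => m i ^+ t).
  rewrite /M topproj_spec spec_mxM -spec_mx_exp; congr (_ ^+ _).
  rewrite -spec_mx1 -[X in X - _]scale1r -scaleNr spec_mx_lin.
  congr spec_mx; apply/funext => i; rewrite /m.
  by case: ifP => _; ring.
have hlam (i : 'I_n) : (i < r)%N -> 0 < lam i <= 1.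
  by move=> ir; rewrite lam1 (lt_le_trans th0) // lam_top.
have m01 i : 0 <= m i <= 1.
  rewrite /m; case: ifP => [ir|_]; last by rewrite ler01 lexx.
  have /andP[l0 l1] := hlam i ir.
  by apply/andP; split; nra.
have mt01 i : 0 <= m i ^+ t <= 1.
  have /andP[? ?] := m01 i.
  by rewrite exprn_ge0 //= exprn_ile1.
apply: lerD; last exact: he.
apply: lerD.
  apply: le_trans hw; rewrite sqn_coef [leRHS]big_mkcond /=; apply: ler_sum => i _.
  rewrite coefD coefN ME coef_spec; have := mt01 i.
  case: ifP => ir.
    move=> /andP[h1 h2]; rewrite -mulNr -{1}(mul1r (coef w i)) -mulrDl exprMn.
    rewrite -[leRHS]mul1r ler_wpM2r ?sqr_ge0 //; nra.
  by move=> _; rewrite /m ir expr1n mul1r subrr expr0n.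
rewrite sqn_coef (bigID (fun i : 'I_n => (i < r)%N)) /=; apply: lerD; last first.
  apply: le_trans hb; under eq_bigl do rewrite -leqNgt.
  apply: ler_sum => i ri; rewrite coefN sqrrN ME coef_spec /m ltnNge ri /=.
  by rewrite expr1n mul1r.
pose S := \sum_(i : 'I_n | (i < r)%N) coef f i ^+ 2 / lam i.
have S0 : 0 <= S.
  apply: sumr_ge0 => i ir; have /andP[l0 _] := hlam i ir; by rewrite divr_ge0 ?sqr_ge0 // ltW.
(* Testing against the inverse of [A] applied to [f] on the first [r] eigenvectors turns the dual
   bound into a bound on the sum of [coef^2 / lam], the quantity that the decay rate consumes. *)
have SG : S <= Gam.
  pose z : 'cV[R]_n := \col_i (if (i < r)%N then coef f i / lam i else 0).
  have := hf (U *m z); rewrite dotv_coef quad_coef.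
  have -> : \sum_i coef (U *m z) i * coef f i = S.
    rewrite /S [RHS]big_mkcond /=; apply: eq_bigr => i _.
    by rewrite coef_col mxE; case: ifP => _; rewrite ?mul0r //; ring.
  have -> : \sum_i lam i * coef (U *m z) i ^+ 2 = S.
    rewrite /S [RHS]big_mkcond /=; apply: eq_bigr => i _.
    rewrite coef_col mxE; case: ifP => ir; last by rewrite expr0n mulr0.
    have /andP[l0 _] := hlam i ir; have l0' := lt0r_neq0 l0.
    by field.
  move: S0; rewrite le_eqVlt => /orP[/eqP <- //|S0].
  by rewrite expr2 ler_pM2r.
have t0' : 0 < t%:R :> R by rewrite ltr0n.
have c0 : 0 < 2 * eta * t%:R by rewrite !mulr_gt0.
apply: (@le_trans _ _ (S / (2 * eta * t%:R))); last first.
  by rewrite ler_pM2r ?invr_gt0.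
rewrite /S mulr_suml; apply: ler_sum => i ir.
have /andP[l0 l1] := hlam i ir.
rewrite coefN sqrrN ME coef_spec /m ir exprMn mulrC -mulrA.
rewrite ler_wpM2l ?sqr_ge0 // -invfM -exprM.
have x01 : 0 <= eta * lam i <= 1 by apply/andP; split; nra.
have := @expr_bernoulli (eta * lam i) (t * 2) x01.
set p := _ ^+ _ => hp.
have p0 : 0 <= p by rewrite exprn_ge0 // subr_ge0; case/andP: x01.
have el0 : 0 < eta * lam i by rewrite mulr_gt0.
rewrite -[leRHS]mul1r ler_pdivlMr ?mulr_gt0 //.
apply: le_trans hp; rewrite ler_wpM2l // natrM; nra.
Qed.

End Tail.
End Eigen.
End LinearAlgebra.

(** * Homogeneous polynomials as symmetric tensors *)

Section Words.
Variables (R : realType) (d : nat).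
Local Notation word := (seq 'I_d).

(* A tensor of order k is a function on words, of which only the values at words of
   length k matter; [pol k u] is the polynomial with coefficient tensor [u], [tr] the
   trace over the first two slots. *)
Fixpoint words k : seq word :=
  if k is k'.+1 then [seq a :: w | a <- enum 'I_d, w <- words k'] else [:: [::]].

Lemma mem_words k (w : word) : (w \in words k) = (size w == k).
Proof.
elim: k w => [|k IH] [|a w] //=.
  by apply/negbTE/allpairsP => -[[b v] /= [_ _]].
apply/allpairsP/idP => [[[b v] /= [_ hv [_ ->]]]|].
  by rewrite eqSS -IH.
by rewrite eqSS -IH => hw; exists (a, w); split=> //=; rewrite mem_enum.
Qed.

Lemma words_uniq k : uniq (words k).
Proof.
elim: k => [|k IH] //=; apply: allpairs_uniq => //; first exact: enum_uniq.
by move=> [a v] [b w] _ _ /= [-> ->].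
Qed.

Lemma sum_words0 (F : word -> R) : \sum_(w <- words 0) F w = F [::].
Proof. by rewrite big_seq1. Qed.

Lemma sum_wordsS k (F : word -> R) :
  \sum_(w <- words k.+1) F w = \sum_a \sum_(w <- words k) F (a :: w).
Proof. by rewrite big_allpairs_dep big_enum. Qed.

Definition monom (w : word) (x : 'rV[R]_d) : R := \prod_(a <- w) x 0 a.
Definition pol k (u : word -> R) (x : 'rV[R]_d) : R :=
  \sum_(w <- words k) u w * monom w x.
Definition tdot k (u v : word -> R) : R := \sum_(w <- words k) u w * v w.
Definition tnorm k (u : word -> R) : R := \sum_(w <- words k) u w ^+ 2.
Definition tsym (u : word -> R) : Prop := forall v w, perm_eq v w -> u v = u w.
Definition slice (a : 'I_d) (u : word -> R) : word -> R := fun w => u (a :: w).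
Definition tr (u : word -> R) : word -> R := fun w => \sum_a u [:: a, a & w].

Lemma tnorm_ge0 k u : 0 <= tnorm k u.
Proof. by apply: sumr_ge0 => w _; exact: sqr_ge0. Qed.

Lemma tnormE k u : tnorm k u = tdot k u u.
Proof. by apply: eq_bigr => w _; rewrite expr2. Qed.

Lemma tdotC k u v : tdot k u v = tdot k v u.
Proof. by apply: eq_bigr => w _; rewrite mulrC. Qed.

Lemma tnormS k u : tnorm k.+1 u = \sum_a tnorm k (slice a u).
Proof. exact: sum_wordsS. Qed.

Lemma monom_cons a w x : monom (a :: w) x = x 0 a * monom w x.
Proof. by rewrite /monom big_cons. Qed.

Lemma monom_cat v w x : monom (v ++ w) x = monom v x * monom w x.
Proof. by rewrite /monom big_cat. Qed.

Lemma monom_sym x : tsym (monom ^~ x).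
Proof. by move=> v w vw; rewrite /monom (perm_big _ vw). Qed.

Lemma sum_monom2 k (x y : 'rV[R]_d) :
  \sum_(w <- words k) monom w x * monom w y = dotp x y ^+ k.
Proof.
elim: k => [|k IH]; first by rewrite sum_words0 /monom !big_nil mulr1.
rewrite sum_wordsS exprS /dotp mulr_suml; apply: eq_bigr => a _.
rewrite -/(dotp x y) -IH mulr_sumr; apply: eq_bigr => w _.
by rewrite !monom_cons; ring.
Qed.

Lemma tr_sym u : tsym u -> tsym (tr u).
Proof.
move=> su v w vw; apply: eq_bigr => a _; apply: su.
by rewrite !perm_cons.
Qed.

Lemma slice_sym a u : tsym u -> tsym (slice a u).
Proof. by move=> su v w vw; apply: su; rewrite perm_cons. Qed.

Lemma tr_slice a u : tsym u -> tr (slice a u) =1 slice a (tr u).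
Proof.
move=> su w; apply: eq_bigr => b _; apply: su.
by rewrite -[a :: b :: b :: w]/([:: a] ++ [:: b; b] ++ w) perm_catCA.
Qed.

Lemma iter_tr_sym j u : tsym u -> tsym (iter j tr u).
Proof. by move=> su; elim: j => //= j IH; exact: tr_sym. Qed.

Lemma iter_tr_slice j a u : tsym u -> iter j tr (slice a u) =1 slice a (iter j tr u).
Proof.
move=> su; elim: j => //= j IH w.
rewrite -(tr_slice _ (iter_tr_sym j su)) /tr.
by apply: eq_bigr => b _; rewrite IH.
Qed.

Lemma sum_CS (I : eqType) (r : seq I) (F G : I -> R) :
  (\sum_(i <- r) F i * G i) ^+ 2 <=
  (\sum_(i <- r) F i ^+ 2) * (\sum_(i <- r) G i ^+ 2).
Proof.
set a := \sum_(i <- r) F i ^+ 2; set b := \sum_(i <- r) F i * G i.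
set c := \sum_(i <- r) G i ^+ 2.
have key s t : 0 <= s ^+ 2 * a + 2 * s * t * b + t ^+ 2 * c.
  have -> : s ^+ 2 * a + 2 * s * t * b + t ^+ 2 * c =
      \sum_(i <- r) (s * F i + t * G i) ^+ 2.
    rewrite /a /b /c !mulr_sumr -!big_split /=; apply: eq_bigr => i _; ring.
  by apply: sumr_ge0 => i _; exact: sqr_ge0.
have a0 : 0 <= a by apply: sumr_ge0 => i _; exact: sqr_ge0.
move: a0; rewrite le_eqVlt => /orP[/eqP a0|a0].
  have [->|b0] := eqVneq b 0; first by rewrite expr0n -a0 mul0r.
  (* With [a = 0] the form is affine in its first argument; this value makes it [-1]. *)
  have := key (- (c + 1) / (2 * b)) 1; rewrite -a0 mulr0 add0r expr1n mul1r mulr1.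
  have -> : 2 * (- (c + 1) / (2 * b)) * b + c = - 1 by field.
  by rewrite oppr_ge0 ler10.
have := key (- b) a => h; rewrite -(ler_pM2l a0) -subr_ge0.
by apply: le_trans h _; rewrite le_eqVlt; apply/orP; left; apply/eqP; ring.
Qed.

(** Cauchy-Schwarz on the [d] diagonal terms of the trace. *)
Lemma tnorm_tr k u : tnorm k (tr u) <= d%:R * tnorm k.+2 u.
Proof.
rewrite /tnorm sum_wordsS.
apply: (@le_trans _ _ (\sum_(w <- words k) (d%:R * \sum_a u [:: a, a & w] ^+ 2))).
  apply: ler_sum => w _; rewrite /tr.
  have := @sum_CS _ (index_enum 'I_d) (fun=> 1) (fun a => u [:: a, a & w]).
  under eq_bigr do rewrite mul1r.
  by under [X in _ <= X * _]eq_bigr do rewrite expr1n; rewrite sumr_const card_ord.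
rewrite -mulr_sumr ler_wpM2l // exchange_big /=; apply: ler_sum => a _.
rewrite sum_wordsS (bigD1 a) //= lerDl.
by apply: sumr_ge0 => b _; apply: sumr_ge0 => w _; exact: sqr_ge0.
Qed.

(* Constants of [mform_upper] in degrees k and k - 1. *)
Fixpoint ucoef (k : nat) : R * R :=
  if k is k'.+1 then (k'%:R ^+ 2 * (ucoef k').2 + 2 * k'.+1%:R * (ucoef k').1, (ucoef k').1)
  else (1, 1).

Lemma ucoef_ge0 k : (0 <= (ucoef k).1) && (0 <= (ucoef k).2).
Proof.
elim: k => [|k /andP[h1 h2]] /=; first by rewrite ler01.
by rewrite h1 addr_ge0 ?mulr_ge0 ?sqr_ge0.
Qed.

(* [mom] abstracts the moments of the uniform distribution on the sphere; [mom_ibp]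
   is integration by parts. *)
Section Moments.
Variable mom : word -> R.
Hypothesis d_gt0 : (0 < d)%N.
Hypothesis mom_nil : mom [::] = 1.
Hypothesis mom_perm : tsym mom.
Hypothesis mom_ibp : forall a w,
  (d%:R + (size w)%:R - 1) * mom (a :: w) = (count_mem a w)%:R * mom (rem a w).
Hypothesis mom_pos : forall r : seq (word * R),
  0 <= \sum_(p <- r) \sum_(q <- r) p.2 * q.2 * mom (p.1 ++ q.1).

(** When [mom] holds the moments of a random vector [Z], this is the expectation of [pol k u Z]
    times [pol m v Z]. It is used both for the uniform law and for the empirical measure of the
    sample. *)
Definition mform k m (u v : word -> R) : R :=
  \sum_(w <- words k) \sum_(w' <- words m) u w * v w' * mom (w ++ w').

Lemma mformC k m u v : mform k m u v = mform m k v u.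
Proof.
rewrite /mform exchange_big /=; apply: eq_bigr => w _; apply: eq_bigr => w' _.
have -> : mom (w' ++ w) = mom (w ++ w') by apply: mom_perm; rewrite perm_catC.
by rewrite (mulrC (u _)).
Qed.

Lemma eq_mform k m u u' v v' :
  (forall w, size w = k -> u w = u' w) -> (forall w, size w = m -> v w = v' w) ->
  mform k m u v = mform k m u' v'.
Proof.
move=> hu hv; rewrite /mform big_seq [RHS]big_seq; apply: eq_bigr => w.
rewrite mem_words => /eqP sw; rewrite big_seq [RHS]big_seq.
apply: eq_bigr => w'; rewrite mem_words => /eqP sw'.
by rewrite hu // hv.
Qed.

Lemma mform_pos k m s t u v :
  0 <= s ^+ 2 * mform k k u u + 2 * s * t * mform k m u v + t ^+ 2 * mform m m v v.
Proof.
have := mom_pos ([seq (w, s * u w) | w <- words k] ++ [seq (w, t * v w) | w <- words m]).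
rewrite big_cat !big_map /=; under eq_bigr do rewrite big_cat !big_map /=.
under [X in _ + X]eq_bigr do rewrite big_cat !big_map /=.
rewrite !big_split /= => h; apply: le_trans h _; rewrite le_eqVlt; apply/orP; left.
apply/eqP; have E k1 k2 (c1 c2 : R) (u1 u2 : word -> R) :
    \sum_(i <- words k1) \sum_(j <- words k2) c1 * u1 i * (c2 * u2 j) * mom (i ++ j) =
    c1 * c2 * mform k1 k2 u1 u2.
  rewrite mulr_sumr; apply: eq_bigr => i _; rewrite mulr_sumr.
  by apply: eq_bigr => j _; ring.
by rewrite !E (mformC m k); ring.
Qed.

Lemma mform_ge0 k u : 0 <= mform k k u u.
Proof.
have := mform_pos k k 1 0 u u.
by rewrite expr1n expr0n /= !mulr0 !mul0r !mul1r !addr0.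
Qed.

(** By symmetry of [U] and [G] each of the [k] positions from which [a] may be deleted contributes
    the same, so [a] may be assumed to stand first. *)
Lemma sum_count_rem k a (U G : word -> R) : tsym U -> tsym G ->
  \sum_(w <- words k) U w * ((count_mem a w)%:R * G (rem a w)) =
  k%:R * \sum_(w <- words k.-1) U (a :: w) * G w.
Proof.
elim: k U G => [|k IH] U G sU sG; first by rewrite sum_words0 /= !mul0r mulr0.
rewrite sum_wordsS /=.
transitivity (\sum_(w <- words k) U (a :: w) * G w +
  \sum_b \sum_(w <- words k) slice b U w * ((count_mem a w)%:R * slice b G (rem a w))).
  have -> : \sum_(w <- words k) U (a :: w) * G w =
      \sum_(b < d) \sum_(w <- words k) (b == a)%:R * (U (b :: w) * G w).
    rewrite (bigD1 a) //= [X in _ + X]big1 ?addr0.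
      by apply: eq_bigr => w _; rewrite eqxx mul1r.
    by move=> b /negbTE ba; apply: big1 => w _; rewrite ba mul0r.
  rewrite -big_split /=; apply: eq_bigr => b _.
  rewrite -big_split /=; apply: eq_bigr => w _; rewrite /slice natrD.
  have [->|ba] := eqVneq b a.
    rewrite mul1r mulrDl mulrDr mul1r; congr (_ + _).
    have [aw|aw] := boolP (a \in w); last by rewrite (count_memPn aw) !mul0r !mulr0.
    by congr (_ * (_ * _)); apply: sG; exact: perm_to_rem.
  by rewrite !mul0r !add0r.
under [X in _ + X]eq_bigr => b _.
  rewrite (IH _ _ (slice_sym b sU) (slice_sym b sG)).
  over.
rewrite -mulr_sumr -(natr1 k) mulrDl mul1r addrC; congr (_ + _).
case: k IH => [|k] IH; first by rewrite !mul0r.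
congr (_ * _); rewrite sum_wordsS; apply: eq_bigr => b _; apply: eq_bigr => w _.
congr (_ * _); apply: sU.
by rewrite -[[:: b, a & w]]/([:: b] ++ [:: a] ++ w) perm_catCA.
Qed.

(** Integration by parts on the first letter of [u]: deleting its partner from the rest of [u]
    produces the trace of [u], deleting it from the word of [v] contracts [u] with [v] along one
    slot. *)
Lemma mform_ibp k m u v : tsym u -> tsym v ->
  (d%:R + k%:R + m%:R - 1) * mform k.+1 m u v =
  k%:R * mform k.-1 m (tr u) v +
  m%:R * \sum_a mform k m.-1 (slice a u) (slice a v).
Proof.
move=> su sv.
have remcat a (w w' : word) : (count_mem a (w ++ w'))%:R * mom (rem a (w ++ w')) =
    (count_mem a w)%:R * mom (rem a w ++ w') +
    (count_mem a w')%:R * mom (w ++ rem a w') :> R.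
  rewrite count_cat natrD mulrDl; congr (_ + _).
    have [aw|aw] := boolP (a \in w); last by rewrite (count_memPn aw) !mul0r.
    congr (_ * _); apply: mom_perm; rewrite -(perm_cons a).
    have aww : a \in w ++ w' by rewrite mem_cat aw.
    by rewrite -(permPl (perm_to_rem aww)) -cat_cons perm_cat2r perm_to_rem.
  have [aw|aw] := boolP (a \in w'); last by rewrite (count_memPn aw) !mul0r.
  congr (_ * _); apply: mom_perm; rewrite -(perm_cons a).
  have aww : a \in w ++ w' by rewrite mem_cat aw orbT.
  rewrite -(permPl (perm_to_rem aww)) perm_sym -[a :: w ++ _]/([:: a] ++ w ++ _).
  by rewrite perm_catCA perm_cat2l perm_sym perm_to_rem.
transitivity (\sum_a (\sum_(w <- words k) \sum_(w' <- words m)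
      slice a u w * v w' * ((count_mem a w)%:R * mom (rem a w ++ w')) +
    \sum_(w <- words k) \sum_(w' <- words m)
      slice a u w * v w' * ((count_mem a w')%:R * mom (w ++ rem a w')))).
  rewrite /mform sum_wordsS mulr_sumr; apply: eq_bigr => a _.
  rewrite -big_split /= mulr_sumr.
  rewrite big_seq [RHS]big_seq; apply: eq_bigr => w; rewrite mem_words => /eqP sw.
  rewrite mulr_sumr -big_split /=.
  rewrite big_seq [RHS]big_seq; apply: eq_bigr => w'; rewrite mem_words => /eqP sw'.
  have := mom_ibp a (w ++ w'); rewrite remcat size_cat sw sw' natrD addrA => h.
  by rewrite mulrCA h /slice; ring.
rewrite big_split /=; congr (_ + _).
  transitivity (\sum_a \sum_(w' <- words m) v w' *
      (k%:R * \sum_(w <- words k.-1) slice a u (a :: w) * mom (w ++ w'))).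
    apply: eq_bigr => a _; rewrite exchange_big /=; apply: eq_bigr => w' _.
    rewrite -(@sum_count_rem k a (slice a u) (fun w => mom (w ++ w'))).
    - by rewrite mulr_sumr; apply: eq_bigr => w _; ring.
    - exact: slice_sym.
    - by move=> w1 w2 hw; apply: mom_perm; rewrite perm_cat2r.
  rewrite /mform exchange_big /= [in RHS]exchange_big /= mulr_sumr.
  apply: eq_bigr => w' _; rewrite -mulr_sumr -mulr_sumr mulrCA; congr (_ * _).
  rewrite exchange_big /= mulr_sumr; apply: eq_bigr => w _.
  by rewrite /tr /slice !mulr_suml mulr_sumr; apply: eq_bigr => a _; ring.
rewrite mulr_sumr; apply: eq_bigr => a _.
rewrite /mform mulr_sumr; apply: eq_bigr => w _.
under eq_bigr do rewrite -mulrA.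
rewrite -mulr_sumr (@sum_count_rem m a v (fun w' => mom (w ++ w'))) //.
  rewrite mulrCA; congr (_ * _); rewrite mulr_sumr.
  by apply: eq_bigr => w' _; rewrite /slice; ring.
by move=> w1 w2 hw; apply: mom_perm; rewrite perm_cat2l.
Qed.

Let d0 : 0 < d%:R :> R. Proof. by rewrite ltr0n. Qed.
Let d1 : 1 <= d%:R :> R. Proof. by rewrite ler1n. Qed.

(** By [mform_ibp] the form is a nonnegative multiple of the form of [tr u] with itself, plus a sum
    over slices. Slicing commutes with the trace, so the slices are of the same kind one degree
    lower. *)
Lemma mform_tr_ge0 k u : tsym u -> 0 <= mform k.+2 k u (tr u).
Proof.
elim: k u => [|k IH] u su.
  have := mform_ibp 1 0 su (tr_sym su); rewrite /= mul0r !addr0 mul1r addrK.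
  have := mform_ge0 0 (tr u) => h0 h; rewrite -h in h0.
  by move: h0; rewrite pmulr_rge0.
have := mform_ibp k.+2 k.+1 su (tr_sym su) => /= h.
have : 0 <= (d%:R + k.+2%:R + k.+1%:R - 1) * mform k.+3 k.+1 u (tr u).
  rewrite h addr_ge0 ?mulr_ge0 ?mform_ge0 //.
  apply: sumr_ge0 => a _; rewrite (@eq_mform _ _ _ (slice a u) _ (tr (slice a u))) //.
    exact/IH/slice_sym.
  by move=> w _; rewrite tr_slice.
by rewrite pmulr_rge0.
Qed.

(** In [mform_ibp] with [v = u] the trace term is nonnegative by [mform_tr_ge0] and may be dropped;
    the slices go by induction. The factor [d + 2 k] is at most [2 d] by the bound on the degree. *)
Lemma mform_lower k u : (k.*2 <= d)%N -> tsym u ->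
  tnorm k u <= (2 * d%:R) ^+ k * mform k k u u.
Proof.
elim: k u => [|k IH] u kd su.
  by rewrite /tnorm /mform !sum_words0 cats0 mom_nil expr0 mul1r mulr1 expr2.
have h := mform_ibp k k.+1 su su; rewrite /= in h.
have h1 : 0 <= k%:R * mform k.-1 k.+1 (tr u) u.
  case: k {IH kd h} => [|k] /=; first by rewrite mul0r.
  by rewrite mulr_ge0 // mformC; exact: mform_tr_ge0.
rewrite tnormS.
apply: (@le_trans _ _ ((2 * d%:R) ^+ k * \sum_a mform k k (slice a u) (slice a u))).
  rewrite mulr_sumr; apply: ler_sum => a _; apply: IH; last exact: slice_sym.
  by apply: leq_trans kd; rewrite leq_double.
rewrite exprSr -mulrA ler_pM2l ?exprn_gt0 ?mulr_gt0 //.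
set S := \sum_a _ in h *; have S0 : 0 <= S by apply: sumr_ge0 => a _; exact: mform_ge0.
set B := mform k.+1 _ _ _ in h *; have B0 : 0 <= B by exact: mform_ge0.
have kd' : 2 * k.+1%:R <= d%:R :> R by rewrite -natrM ler_nat mul2n.
have k0 : 0 <= k%:R :> R by [].
have e1 : S <= (d%:R + k%:R + k.+1%:R - 1) * B.
  rewrite h; apply: (@le_trans _ _ (k.+1%:R * S)); last by rewrite lerDr.
  by rewrite ler_peMl // ler1n.
apply: le_trans e1 _; rewrite ler_wpM2r //.
by move: kd'; rewrite -natr1; lra.
Qed.

Lemma mform_eq0 k u : (forall w, size w = k -> u w = 0) -> mform k k u u = 0.
Proof.
move=> u0; rewrite (@eq_mform _ _ _ (fun=> 0) _ (fun=> 0)) // /mform.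
by rewrite big1 // => w _; rewrite big1 // => w' _; rewrite !mul0r.
Qed.

(** Let [B], [T] be the forms of [u] and [tr u], and [S] the sum of the forms of the slices.
    Positivity of the form at [k tr u - d u] trades the cross term of [mform_ibp] for [T], which
    gives [d^2 B <= k^2 T + 2 (k + 1) d S] in degree [k + 1]. The trace costs a factor [d] by
    [tnorm_tr] but lowers [j] by one, so the power [d^j] is preserved. *)
Lemma mform_upper k j u : tsym u ->
  (forall w, (size w + j.*2 = k)%N -> iter j tr u w = 0) ->
  d%:R ^+ k.+1 * mform k k u u <= (ucoef k).1 * d%:R ^+ j * tnorm k u.
Proof.
(* The trace lowers the degree by two, so degrees [k] and [k - 1] are carried together. *)
suff: (forall j u, tsym u ->
    (forall w, (size w + j.*2 = k)%N -> iter j tr u w = 0) ->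
    d%:R ^+ k.+1 * mform k k u u <= (ucoef k).1 * d%:R ^+ j * tnorm k u) /\
  (forall j u, tsym u ->
    (forall w, (size w + j.*2 = k.-1)%N -> iter j tr u w = 0) ->
    d%:R ^+ k.-1.+1 * mform k.-1 k.-1 u u <= (ucoef k).2 * d%:R ^+ j * tnorm k.-1 u).
  by case=> h _; exact: h.
elim: k {j u} => [|k [h1 h2]] /=.
  have P0 : forall j u, tsym u ->
    (forall w, (size w + j.*2 = 0)%N -> iter j tr u w = 0) ->
    d%:R ^+ 1 * mform 0 0 u u <= 1 * d%:R ^+ j * tnorm 0 u.
    move=> [|j] u su hu.
      rewrite mform_eq0 ?mulr0 ?mulr_ge0 ?tnorm_ge0 //.
      by move=> w w0; apply: hu; rewrite addn0.
    rewrite /mform /tnorm !sum_words0 cats0 mom_nil mulr1 mul1r -expr2.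
    by rewrite ler_wpM2r ?sqr_ge0 // expr1 exprS ler_peMr ?exprn_ege1 // ltW.
  by split.
have /andP[C10 C20] := ucoef_ge0 k.
move: (ucoef k).1 (ucoef k).2 C10 C20 h1 h2 => C1 C2 C10 C20 h1 h2.
split=> //.
move=> [|j] u su hu.
  rewrite mform_eq0 ?mulr0 ?mulr_ge0 ?tnorm_ge0 ?addr_ge0 ?mulr_ge0 ?sqr_ge0 //.
  by move=> w w0; apply: hu; rewrite addn0.
have h := mform_ibp k k.+1 su su; rewrite /= in h.
set S := \sum_a _ in h; set B := mform k.+1 _ _ _ in h *.
have B0 : 0 <= B by exact: mform_ge0.
have hS : d%:R ^+ k.+1 * S <= C1 * d%:R ^+ j.+1 * tnorm k.+1 u.
  rewrite tnormS /S !mulr_sumr; apply: ler_sum => a _; apply: h1.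
    exact: slice_sym.
  move=> w hw; rewrite iter_tr_slice //; apply: hu.
  by rewrite /= addSn hw.
have hT : k%:R ^+ 2 * (d%:R ^+ k * mform k.-1 k.-1 (tr u) (tr u)) <=
    k%:R ^+ 2 * (C2 * d%:R ^+ j.+1 * tnorm k.+1 u).
  case: k {h1 hS C1 C10 S h B B0} h2 hu => [|k] h2 hu.
    by rewrite expr0n /= !mul0r.
  rewrite ler_wpM2l ?sqr_ge0 //.
  apply: le_trans (h2 j (tr u) (tr_sym su) _) _.
    move=> w hw; rewrite -iterSr; apply: hu.
    by rewrite doubleS !addnS hw.
  rewrite (exprSr _ j) -!mulrA; apply: ler_wpM2l => //.
  apply: ler_wpM2l; first by rewrite exprn_ge0.
  exact: tnorm_tr.
have hm := mform_pos k.-1 k.+1 k%:R (- d%:R) (tr u) u.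
set T := mform k.-1 k.-1 (tr u) (tr u) in hm hT.
rewrite -/B in hm; set X := mform k.-1 k.+1 _ _ in h hm.
have e1 : d%:R ^+ 2 * B <= k%:R ^+ 2 * T + 2 * k.+1%:R * (d%:R * S).
  have e2 : 2 * d%:R * ((d%:R + k%:R + k.+1%:R - 1) * B) =
            2 * k%:R * d%:R * X + 2 * k.+1%:R * (d%:R * S) by rewrite h; ring.
  have e3 : 0 <= d%:R * k%:R * B by rewrite !mulr_ge0 // ltW.
  move: hm e2 e3; rewrite -natr1; lra.
have := ler_wpM2l (exprn_ge0 k (ltW d0)) e1.
move=> e4; rewrite exprS exprS.
have -> : d%:R * (d%:R * d%:R ^+ k) * B = d%:R ^+ k * (d%:R ^+ 2 * B) by ring.
apply: le_trans e4 _; rewrite exprS in hS; move: hS hT.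
set p := d%:R ^+ k; set q := d%:R ^+ j.+1; set t := tnorm _ _ => hS hT.
have k10 : 0 <= 2 * k.+1%:R :> R by rewrite mulr_ge0.
have := ler_wpM2l k10 hS; lra.
Qed.

End Moments.
End Words.
Arguments monom {R d} w x.
Arguments ucoef {R} k.

(** * Symmetrization and trace-free parts *)

Section Symmetrization.
Variables (R : realType) (d : nat).
Local Notation word := (seq 'I_d).

Definition symz (u : word -> R) (w : word) : R :=
  (\sum_(w' <- permutations w) u w') / (size (permutations w))%:R.

Lemma symz_sym u : tsym (symz u).
Proof.
move=> v w /perm_permutations vw.
by rewrite /symz (perm_big _ vw) (perm_size vw).
Qed.

Lemma size_permutations_gt0 (w : word) : (0 < size (permutations w))%N.
Proof. by rewrite -has_predT; apply/hasP; exists w => //; rewrite mem_permutations. Qed.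

Lemma perm_permutations_words k (w : word) : w \in words d k ->
  perm_eq (permutations w) [seq w' <- words d k | perm_eq w' w].
Proof.
rewrite mem_words => /eqP sw; apply: uniq_perm.
- exact: permutations_uniq.
- by rewrite filter_uniq // words_uniq.
- move=> v; rewrite mem_permutations mem_filter mem_words.
  by case: (boolP (perm_eq v w)) => // /perm_size ->; rewrite sw eqxx.
Qed.

(** After exchanging the sums, each word is counted once for every rearrangement, which cancels the
    denominator of the average. *)
Lemma tdot_symz k u v : tsym v -> tdot k (symz u) v = tdot k u v.
Proof.
move=> sv; pose N (w : word) : R := (size (permutations w))%:R.
transitivity (\sum_(w <- words d k) \sum_(w' <- words d k | perm_eq w' w) u w' * v w' / N w').
  rewrite /tdot big_seq [RHS]big_seq; apply: eq_bigr => w hw.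
  rewrite /symz -mulrA mulr_suml (perm_big _ (perm_permutations_words hw)) big_filter.
  apply: eq_bigr => w' hw'; rewrite (sv _ _ hw') /N (perm_size (perm_permutations hw')).
  by ring.
under eq_bigr do rewrite big_mkcond.
rewrite exchange_big /= /tdot big_seq [RHS]big_seq; apply: eq_bigr => w' hw'.
rewrite -big_mkcond /= -big_filter big_const_seq count_predT iter_addr_0 -mulr_natr.
have -> : size [seq w <- words d k | perm_eq w' w] = size (permutations w').
  rewrite (perm_size (perm_permutations_words hw')); congr size.
  by apply: eq_filter => w; rewrite perm_sym.
rewrite -/(N w') mulfVK //.
by rewrite pnatr_eq0 -lt0n size_permutations_gt0.
Qed.

Lemma pol_tdot k u (x : 'rV[R]_d) : pol k u x = tdot k u (monom ^~ x).
Proof. by []. Qed.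

Lemma pol_symz k u (x : 'rV[R]_d) : pol k (symz u) x = pol k u x.
Proof. by rewrite !pol_tdot tdot_symz //; exact: monom_sym. Qed.

(* The tensor delta^(j) (x) e_v: pairing with it takes the j-fold trace and evaluates
   at v; its polynomial is |x|^(2 j) times the monomial v. *)
Fixpoint dl j (v : word) (w : word) : R :=
  match j, w with
  | 0, _ => (v == w)%:R
  | j'.+1, a :: b :: w' => (a == b)%:R * dl j' v w'
  | _, _ => 0
  end.

Lemma tdot_dl j m v u : size v = m -> tdot (j.*2 + m) (dl j v) u = iter j (@tr _ _) u v.
Proof.
elim: j u => [|j IH] u sv.
  rewrite /tdot /= (bigD1_seq v) ?words_uniq ?mem_words ?sv //= eqxx mul1r.
  by rewrite big1 ?addr0 // => w /negbTE wv; rewrite eq_sym wv mul0r.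
rewrite iterSr -IH // /tdot doubleS !addSn sum_wordsS.
under eq_bigr do rewrite sum_wordsS.
transitivity (\sum_(a < d) \sum_(w <- words d (j.*2 + m)) dl j v w * u [:: a, a & w]).
  apply: eq_bigr => a _; rewrite (bigD1 a) //= [X in _ + X]big1 ?addr0.
    by apply: eq_bigr => w _; rewrite eqxx mul1r.
  move=> b /negbTE ba; apply: big1 => w _.
  by rewrite eq_sym ba !mul0r.
rewrite exchange_big /=; apply: eq_bigr => w _.
by rewrite /tr mulr_sumr.
Qed.

Lemma iter_tr_monom j x v : @dotp R d x x = 1 ->
  iter j (@tr _ _) (monom ^~ x) v = monom v x.
Proof.
move=> x1; elim: j v => //= j IH v; rewrite /tr.
under eq_bigr do rewrite IH !monom_cons mulrA.
by rewrite -mulr_suml [X in X * _]x1 mul1r.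
Qed.

Lemma pol_dl j m v x : @dotp R d x x = 1 -> size v = m ->
  pol (j.*2 + m) (dl j v) x = monom v x.
Proof. by move=> x1 sv; rewrite pol_tdot tdot_dl // iter_tr_monom. Qed.

End Symmetrization.

Section Projection.
Variables (R : realType) (I J : eqType) (r : seq I) (g : J -> I -> R).
Variable S : (I -> R) -> Prop.
Hypothesis S0 : S (fun=> 0).
Hypothesis Slin : forall a f h, S f -> S h -> S (fun i => f i + a * h i).

Local Notation ip f h := (\sum_(i <- r) f i * h i).

(** Gram-Schmidt on a family that may be dependent. The third clause says that [q] lies in the span
    without naming coefficients; [S] transports to [q] whatever linear property the generators
    have. *)
Lemma orth_residual (js : seq J) (Sg : forall j, j \in js -> S (g j)) (u : I -> R) :
  exists q, [/\ S q, forall j, j \in js -> ip (fun i => u i - q i) (g j) = 0 &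
    forall z, (forall j, j \in js -> ip z (g j) = 0) -> ip z q = 0].
Proof.
elim: js Sg u => [|j js IH] Sg u.
  by exists (fun=> 0); split => // z _; apply: big1 => i _; rewrite mulr0.
have Sg' j' : j' \in js -> S (g j') by move=> hj; apply: Sg; rewrite inE hj orbT.
have [q [Sq hq dq]] := IH Sg' u.
have [p [Sp hp dp]] := IH Sg' (g j).
pose h i := g j i - p i.
have Sh : S h.
  have := Slin (-1) (Sg j (mem_head _ _)) Sp.
  by congr S; apply/funext => i; rewrite mulN1r.
have ipB a f1 f2 f : ip (fun i => f1 i - (f2 i + a * f i)) h =
    ip (fun i => f1 i - f2 i) h - a * ip f h.
  by rewrite mulr_sumr -sumrB; apply: eq_bigr => i _; ring.
(* For a dependent generator [N = 0]; then [t = 0], since division by zero gives zero, and [h]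
   vanishes on [r]. *)
pose N := ip h h; pose t := ip (fun i => u i - q i) h / N.
exists (fun i => q i + t * h i); split.
- exact: Slin.
- have hjs j' : j' \in js -> ip (fun i => u i - (q i + t * h i)) (g j') = 0.
    move=> hj; transitivity (ip (fun i => u i - q i) (g j') - t * ip h (g j')).
      by rewrite mulr_sumr -sumrB; apply: eq_bigr => i _; ring.
    by rewrite hq // hp // mulr0 subrr.
  move=> j'; rewrite inE => /orP[/eqP ->|]; last exact: hjs.
  transitivity (ip (fun i => u i - (q i + t * h i)) h + ip (fun i => u i - (q i + t * h i)) p).
    by rewrite -big_split /=; apply: eq_bigr => i _; rewrite /h; ring.
  rewrite (dp _ hjs) addr0 ipB -/N /t.
  have [N0|N0] := eqVneq N 0; last by rewrite mulfVK // subrr.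
  rewrite N0 mulr0 subr0.
  have h0 : forall i, i \in r -> h i = 0.
    move=> i ir; move: N0; rewrite /N => /eqP; rewrite psumr_eq0.
      by move=> /allP/(_ i ir) /=; rewrite mulf_eq0 orbb => /eqP.
    by move=> k _; rewrite -expr2 sqr_ge0.
  by rewrite big_seq big1 // => i ir; rewrite h0 ?mulr0.
- move=> z hz; transitivity (ip z q + t * (ip z (g j) - ip z p)).
    by rewrite -sumrB mulr_sumr -big_split; apply: eq_bigr => i _; rewrite /h /=; ring.
  have hz' j' : j' \in js -> ip z (g j') = 0 by move=> hj; apply: hz; rewrite inE hj orbT.
  by rewrite dq // dp // hz ?mem_head // subrr mulr0 addr0.
Qed.

End Projection.

Section TraceFree.
Variables (R : realType) (d n : nat) (x : 'I_n -> 'rV[R]_d) (v : 'I_n -> R).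
Hypothesis x_sphere : forall i, dotp (x i) (x i) = 1.

(** The generators are the symmetrized tensors [dl j w]. Orthogonality to them is the vanishing of
    the [j]-fold trace, while on the sphere their polynomial is the monomial [w], which [v]
    annihilates; so subtracting [q] does not change the pairing of [u] with [v]. *)
Lemma trace_free_residual j m (u : seq 'I_d -> R) : tsym u ->
  (forall w, size w = m -> \sum_i v i * monom w (x i) = 0) ->
  exists q, [/\ tsym q, \sum_i v i * pol (j.*2 + m) q (x i) = 0,
    forall w, size w = m -> iter j (@tr _ _) (fun w => u w - q w) w = 0 &
    tnorm (j.*2 + m) (fun w => u w - q w) <= tnorm (j.*2 + m) u].
Proof.
move=> su hv; set k := (j.*2 + m)%N.
pose S (q : seq 'I_d -> R) := tsym q /\ \sum_i v i * pol k q (x i) = 0.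
have S0 : S (fun=> 0).
  split => //; apply: big1 => i _; rewrite /pol big1 ?mulr0 // => w _.
  by rewrite mul0r.
have Slin a f h : S f -> S h -> S (fun i => f i + a * h i).
  move=> [sf hf] [sh hh]; split.
    by move=> w1 w2 hw; rewrite (sf _ _ hw) (sh _ _ hw).
  transitivity (\sum_i v i * pol k f (x i) + a * \sum_i v i * pol k h (x i)).
    rewrite mulr_sumr -big_split; apply: eq_bigr => i _ /=.
    rewrite mulrCA -mulrDr; congr (_ * _).
    by rewrite /pol mulr_sumr -big_split; apply: eq_bigr => w _ /=; ring.
  by rewrite hf hh mulr0 addr0.
have Sg w : w \in words d m -> S (symz (dl R j w)).
  rewrite mem_words => /eqP sw; split; first exact: symz_sym.
  by under eq_bigr do rewrite pol_symz pol_dl //; exact: hv.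
have [q [[sq hq] orth dq]] := orth_residual (words d k) S0 Slin Sg u.
have sr : tsym (fun w => u w - q w).
  by move=> w1 w2 hw; rewrite (su _ _ hw) (sq _ _ hw).
exists q; split => //.
  move=> w sw; rewrite -(tdot_dl j _ sw) -(tdot_symz _ _ sr) tdotC.
  by apply: orth; rewrite mem_words sw.
have := dq _ orth => /= h0.
rewrite [leRHS](_ : _ = tnorm k (fun w => u w - q w) + tnorm k q).
  by rewrite lerDl tnorm_ge0.
transitivity (\sum_(w <- words d k) ((u w - q w) ^+ 2 + q w ^+ 2 + 2 * ((u w - q w) * q w))).
  by apply: eq_bigr => w _; ring.
by rewrite !big_split /= -mulr_sumr h0 mulr0 addr0.
Qed.

End TraceFree.

(** * Monomials of degrees k and k - 1 *)

Section MonomialBasis.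
Variables (R : realType) (d : nat).
Local Notation word := (seq 'I_d).

Definition sorted_words k : seq word :=
  [seq w <- words d k | sorted leq (map val w)].

Lemma mem_sorted_words k (w : word) :
  (w \in sorted_words k) = (size w == k) && sorted leq (map val w).
Proof. by rewrite mem_filter mem_words andbC. Qed.

Lemma sorted_words_uniq k : uniq (sorted_words k).
Proof. by rewrite filter_uniq // words_uniq. Qed.

Lemma sort_word k (w : word) : size w = k ->
  exists2 s, s \in sorted_words k & perm_eq s w.
Proof.
move=> sw; pose le := relpre val leq : rel 'I_d.
exists (sort le w); last by rewrite perm_sort.
rewrite mem_sorted_words size_sort sw eqxx /= sorted_map.
by apply: sort_sorted => a b; exact: leq_total.
Qed.

Lemma sorted_words_perm_inj k (s w : word) : s \in sorted_words k ->
  w \in sorted_words k -> perm_eq s w -> s = w.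
Proof.
rewrite !mem_sorted_words => /andP[_ hs] /andP[_ hw] sw.
apply: (inj_map val_inj); apply: (sorted_eq leq_trans anti_leq) => //.
exact: perm_map.
Qed.

(** On the sphere the squared norm is 1, so a polynomial can be raised by two degrees: degrees [k]
    and [k - 1] reach every polynomial of degree at most [k], and their monomials are [r0] in
    number. *)
Definition basis_words k : seq word := sorted_words k ++ sorted_words k.-1.

Lemma basis_words_uniq k : (0 < k)%N -> uniq (basis_words k).
Proof.
move=> k0; rewrite cat_uniq !sorted_words_uniq andbT /=.
apply/hasPn => w; rewrite !mem_sorted_words => /andP[/eqP -> _].
by case: k k0 => //= k _; rewrite ltn_eqF.
Qed.

Definition basis_tensor k (c : 'rV[R]_(size (basis_words k))) (w : word) : R :=
  \sum_i c 0 i * (nth [::] (basis_words k) i == w)%:R.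

Lemma basis_word_size k (i : 'I_(size (basis_words k))) :
  let w := nth [::] (basis_words k) i in
  w \in sorted_words (size w) /\ (size w == k) || (size w == k.-1).
Proof.
move=> w; have : w \in basis_words k by exact: mem_nth.
rewrite mem_cat !mem_sorted_words eqxx /= => h.
by case/orP: h => /andP[-> ->]; rewrite ?orbT.
Qed.

Lemma pol_basis_tensor k c (x : 'rV[R]_d) : (0 < k)%N ->
  pol k (@basis_tensor k c) x + pol k.-1 (@basis_tensor k c) x =
  \sum_i c 0 i * monom (nth [::] (basis_words k) i) x.
Proof.
move=> k0.
have E m : pol m (@basis_tensor k c) x =
    \sum_i c 0 i * ((size (nth [::] (basis_words k) i) == m)%:R *
      monom (nth [::] (basis_words k) i) x).
  rewrite /pol /basis_tensor; under eq_bigr do rewrite mulr_suml.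
  rewrite exchange_big /=; apply: eq_bigr => i _.
  under eq_bigr do rewrite -mulrA.
  rewrite -mulr_sumr; congr (_ * _); set s := nth _ _ _.
  have [sm|sm] := eqVneq (size s) m.
    rewrite (bigD1_seq s) ?words_uniq ?mem_words ?sm //= eqxx.
    rewrite big1 ?addr0 // => w /negbTE ws; by rewrite eq_sym ws mul0r.
  rewrite mul0r big_seq big1 // => w; rewrite mem_words => /eqP sw.
  have [sw'|] := eqVneq s w; last by rewrite mul0r.
  by move: sm; rewrite sw' sw eqxx.
rewrite !E -big_split; apply: eq_bigr => i _ /=; rewrite -mulrDr -mulrDl.
have [_ h] := basis_word_size i; congr (_ * _); rewrite -natrD.
have kp : (k.-1 < k)%N by rewrite ltn_predL.
case/orP: h => /eqP ->; rewrite eqxx.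
  by rewrite (gtn_eqF kp) mul1r.
by rewrite (ltn_eqF kp) mul1r.
Qed.

(** Among the rearrangements of a sorted word only that word carries a coefficient, so the
    symmetrized tensor returns [c i] divided by the size of its class. *)
Lemma basis_tensor_inj k c : (0 < k)%N ->
  tnorm k (symz (@basis_tensor k c)) = 0 ->
  tnorm k.-1 (symz (@basis_tensor k c)) = 0 -> c = 0.
Proof.
move=> k0 h1 h2; apply/rowP => i; rewrite mxE.
set s := nth [::] (basis_words k) i; have [ss hs] := basis_word_size i.
rewrite -/s in ss hs.
have : symz (basis_tensor c) s = 0.
  have tz m : tnorm m (symz (basis_tensor c)) = 0 -> size s = m ->
      symz (basis_tensor c) s = 0.
    move=> /eqP; rewrite psumr_eq0; last by move=> w _; exact: sqr_ge0.
    move=> /allP/(_ s) h sm; apply/eqP; rewrite -sqrf_eq0.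
    by apply: h; rewrite mem_words sm.
  by case/orP: hs => /eqP; exact: tz.
move=> /eqP; rewrite /symz mulf_eq0 invr_eq0 pnatr_eq0.
rewrite (gtn_eqF (size_permutations_gt0 s)) orbF => /eqP <-.
rewrite (bigD1_seq s) ?permutations_uniq ?mem_permutations //=.
rewrite [X in _ + X]big_seq_cond [X in _ + X]big1 ?addr0.
  rewrite /basis_tensor (bigD1 i) //= -/s eqxx mulr1 big1 ?addr0 // => j ji.
  rewrite /s nth_uniq ?basis_words_uniq //.
  by rewrite -[_ == _]/(j == i) (negbTE ji) mulr0.
move=> w /andP[]; rewrite mem_permutations => ws wns.
rewrite /basis_tensor big1 // => j _.
have [e|] := eqVneq (nth [::] (basis_words k) j) w; last by rewrite mulr0.
have [sj _] := basis_word_size j; rewrite e in sj.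
case/negP: wns; apply/eqP; apply: (@sorted_words_perm_inj (size w)) => //.
by rewrite (perm_size ws).
Qed.

End MonomialBasis.

Lemma size_sorted_words d k : (0 < d)%N -> size (sorted_words d k) = 'C(k + d.-1, k).
Proof.
case: d => // d' _; rewrite -card_sorted_tuples /= cardE.
rewrite -(size_map val); apply/perm_size/uniq_perm.
- by rewrite filter_uniq // words_uniq.
- by rewrite map_inj_uniq ?enum_uniq //; exact: val_inj.
- move=> w; rewrite mem_filter mem_words andbC.
  apply/andP/mapP => [[sw srt]|[t ht ->]].
    by exists (Tuple sw); rewrite ?mem_enum ?inE.
  by rewrite size_tuple eqxx; move: ht; rewrite mem_enum inE.
Qed.

(** The dimensions [Ndim] are differences of monomial counts two degrees apart, and telescope. The
    monotonicity [mono] makes the truncated subtraction exact. *)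
Lemma size_basis_words d k : (0 < d)%N -> (0 < k)%N ->
  size (basis_words d k) = r0 d k.
Proof.
move=> d0 k0; rewrite size_cat !size_sorted_words //.
case: k k0 => // k _; case: d d0 => // d' _ /=.
have mono l : ('C(d' + l, l) <= 'C(d' + l.+2, l.+2))%N.
  rewrite -!(bin_sub (leq_addl _ _)) !addnK.
  by apply: leq_bin2l; rewrite leq_add2l; lia.
elim: k => [|k IH].
  by rewrite /r0 !big_ord_recr big_ord0 /= bin0 add1n bin1; lia.
rewrite /r0 big_ord_recr -/(r0 d'.+1 k.+1) -IH /=.
have := mono k; rewrite ![(k.+2 + _)%N]addnC ![(k.+1 + _)%N]addnC ![(k + _)%N]addnC.
have -> : (d'.+1 + k.+1)%N = (d' + k.+2)%N by lia.
have -> : (d'.+1 + k - 1)%N = (d' + k)%N by lia.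
lia.
Qed.

(** * Power series of the kernel *)

Section ArcsinSeries.
Variable R : realType.
Implicit Types (t s e q : R).

(** The central binomial coefficients over [4^k], which are the Taylor coefficients of
    [(1 - s)^(-1/2)]. [Bpol] and [Spol] truncate that series and the arcsine series. *)
Fixpoint bco (k : nat) : R :=
  if k is k'.+1 then bco k' * ((2 * k' + 1)%:R / (2 * k' + 2)%:R) else 1.

Lemma bco_gt0 k : 0 < bco k.
Proof. by elim: k => [|k IH] //=; rewrite !mulr_gt0 ?invr_gt0 ?ltr0n ?addn1 ?addn2. Qed.

Lemma bco_le1 k : bco k <= 1.
Proof.
elim: k => [|k IH] //=; rewrite -[leRHS]mul1r ler_pM ?(ltW (bco_gt0 _)) //.
by rewrite ler_pdivrMr ?mul1r ?ler_nat ?leq_add2l // ltr0n addn2.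
Qed.

Lemma bco_rec k : (2 * k%:R + 2) * bco k.+1 = (2 * k%:R + 1) * bco k.
Proof.
rewrite /=.
have -> : (2 * k + 1)%:R = 2 * k%:R + 1 :> R by rewrite natrD natrM.
have -> : (2 * k + 2)%:R = 2 * k%:R + 2 :> R by rewrite natrD natrM.
have k0 : 0 <= k%:R :> R by [].
by field; apply/lt0r_neq0; lra.
Qed.

Definition Bpol N : {poly R} := \sum_(k < N.+1) bco k *: 'X^k.
Definition Spol N : {poly R} := \sum_(k < N.+1) (bco k / (2 * k + 1)%:R) *: 'X^(2 * k + 1).

Lemma BpolE N s : (Bpol N).[s] = \sum_(k < N.+1) bco k * s ^+ k.
Proof. by rewrite horner_sum; apply: eq_bigr => k _; rewrite hornerZ hornerXn. Qed.

Lemma SpolE N s : (Spol N).[s] = \sum_(k < N.+1) bco k / (2 * k + 1)%:R * s ^+ (2 * k + 1).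
Proof. by rewrite horner_sum; apply: eq_bigr => k _; rewrite hornerZ hornerXn. Qed.

(** The full series solves [2 (1 - s) B' = B]; truncation leaves a single monomial. *)
Lemma Bpol_ode N : 2%:P * (1 - 'X) * (Bpol N)^`() - Bpol N =
  - ((2 * N%:R + 1) * bco N) *: 'X^N.
Proof.
elim: N => [|N IH].
  have -> : Bpol 0 = 1 by rewrite /Bpol big_ord1 /= scale1r expr0.
  have -> : (1 : {poly R})^`() = 0 by rewrite -polyC1 derivC.
  by rewrite !mulr0 !add0r !mulr1 expr0 scaleN1r.
have -> : Bpol N.+1 = Bpol N + bco N.+1 *: 'X^(N.+1) by rewrite /Bpol big_ord_recr.
rewrite derivD derivZ derivXn -[N.+1.-1]/N.
transitivity ((2%:P * (1 - 'X) * (Bpol N)^`() - Bpol N) +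
  (2%:P * (1 - 'X) * (bco N.+1 *: ('X^N *+ N.+1)) - bco N.+1 *: 'X^(N.+1))).
  by ring.
have -> : 'X^N *+ N.+1 = (N%:R + 1)%:P * 'X^N :> {poly R}.
  by rewrite natr1 polyC_natr mulr_natl.
rewrite IH -!mul_polyC exprS; have := bco_rec N.
move: (bco N.+1) (bco N) => b1 b0 /(congr1 polyC).
rewrite -(natr1 N) !(polyCM, polyCD, polyCN, polyC1) => h.
by rewrite -h; ring.
Qed.

Lemma Bpol_ge0 N s : 0 <= s -> 0 <= (Bpol N).[s].
Proof.
by move=> s0; rewrite BpolE sumr_ge0 // => k _; rewrite mulr_ge0 ?exprn_ge0 ?(ltW (bco_gt0 _)).
Qed.

Lemma Bpol_le N s : 0 <= s <= 1 -> (Bpol N).[s] <= N.+1%:R.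
Proof.
move=> /andP[s0 s1]; rewrite BpolE -[leRHS]mulr1 -[N.+1 in leRHS]card_ord mulr_natl -sumr_const.
apply: ler_sum => k _; rewrite -[leRHS]mul1r ler_pM ?exprn_ge0 ?(ltW (bco_gt0 _)) ?bco_le1 //.
exact: exprn_ile1.
Qed.

Definition err N q : R := (2 * N%:R + 1) * N.+1%:R * q ^+ N.+1.

(** For the full series [(1 - s) B^2] is 1. For the truncation its derivative is the remainder of
    [Bpol_ode] times [B], and the mean value theorem bounds the deviation from 1. *)
Lemma Bpol_sq_bounds N s : 0 <= s <= 1 ->
  1 - err N s <= (1 - s) * (Bpol N).[s] ^+ 2 <= 1.
Proof.
move=> /andP[s0 s1].
pose Q := (1 - 'X) * Bpol N ^+ 2.
have QE x : Q.[x] = (1 - x) * (Bpol N).[x] ^+ 2 by rewrite /Q !hornerE.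
have dQ x : (Q^`()).[x] = - ((2 * N%:R + 1) * bco N * x ^+ N * (Bpol N).[x]).
  have -> : Q^`() = (2%:P * (1 - 'X) * (Bpol N)^`() - Bpol N) * Bpol N.
    rewrite /Q expr2 !derivM derivB derivX derivC.
    have -> : (2%:P : {poly R}) = 1 + 1 by rewrite -polyCD.
    by ring.
  by rewrite Bpol_ode hornerM hornerZ hornerXn; ring.
have [c] := @MVT_segment R (horner Q) (horner Q^`()) 0 s s0
  (fun x _ => is_derive_poly Q x) (continuous_subspaceT (@continuous_horner _ Q)).
rewrite in_itv /= => /andP[c0 cs].
have -> : Q.[0] = 1.
  rewrite QE BpolE big_ord_recl /= big1 ?addr0 ?expr0 //.
    by rewrite subr0 !mul1r expr1n.
  by move=> i _; rewrite expr0n mulr0.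
rewrite subr0 dQ QE => h.
have c1 : 0 <= c <= 1 by rewrite c0 (le_trans cs).
have B0 := Bpol_ge0 N c0; have B1 := Bpol_le N c1.
have E0 : 0 <= (2 * N%:R + 1) * bco N * c ^+ N * (Bpol N).[c] * s.
  by rewrite !mulr_ge0 ?exprn_ge0 ?(ltW (bco_gt0 _)) // addr_ge0.
have E1 : (2 * N%:R + 1) * bco N * c ^+ N * (Bpol N).[c] * s <= err N s.
  rewrite /err exprSr [leRHS]mulrA ler_wpM2r //.
  rewrite -[leRHS]mulrA [_ * s ^+ N]mulrC mulrA ler_pM //.
  - by rewrite !mulr_ge0 ?exprn_ge0 ?(ltW (bco_gt0 _)) // addr_ge0.
  - rewrite ler_pM ?exprn_ge0 //.
    + by rewrite mulr_ge0 ?(ltW (bco_gt0 _)) // addr_ge0.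
    + by rewrite ler_piMr ?bco_le1 // addr_ge0.
    + by apply: lerXn2r; rewrite ?nnegrE.
by apply/andP; split; lra.
Qed.

Definition asn t : R := pi / 2 - acos t.

(** The derivative of the difference is [1 / sqrt (1 - x^2) - B (x^2)], which [Bpol_sq_bounds]
    controls away from 1. *)
Lemma asn_Spol_bounds N t : 0 <= t < 1 ->
  0 <= asn t - (Spol N).[t] <= err N (t ^+ 2) / Num.sqrt (1 - t ^+ 2).
Proof.
move=> /andP[t0 t1].
pose D x := asn x - (Spol N).[x].
pose dD x := (Num.sqrt (1 - x ^+ 2))^-1 - (Bpol N).[x ^+ 2].
have dS x : ((Spol N)^`()).[x] = (Bpol N).[x ^+ 2].
  rewrite /Spol raddf_sum horner_sum BpolE; apply: eq_bigr => k _.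
  rewrite /= derivZ derivXn addn1 /= hornerZ hornerMn hornerXn -exprM.
  rewrite -[in X in _ * X]mulr_natr; have k0 : (2 * k).+1%:R != 0 :> R by rewrite pnatr_eq0.
  by rewrite -mulrA [X in _ * X]mulrCA mulVf ?mulr1.
have der x : x \in `]0, t[ -> is_derive x 1 D (dD x).
  rewrite in_itv /= => /andP[x0 xt].
  have x1 : -1 < x < 1 by apply/andP; split; lra.
  have h1 := is_derive1_acos x1; have h2 := is_derive_poly (Spol N) x.
  rewrite /D /dD /asn; apply: trigger_derive.
  by rewrite dS add0r mul1r opprK.
have cD : {within `[0, t], continuous D}.
  apply: continuous_in_subspaceT => x; rewrite inE /= in_itv /= => /andP[x0 xt].
  have x1 : -1 < x < 1 by apply/andP; split; lra.
  apply: cvgB; last exact: continuous_horner.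
  by apply: cvgB; [exact: cvg_cst | exact: continuous_acos].
have [c] := MVT_segment t0 der cD.
rewrite in_itv /= => /andP[c0 ct].
have D0 : D 0 = 0.
  rewrite /D /asn acos0 subrr SpolE big1 ?subrr // => k _.
  by rewrite addn1 exprS mul0r mulr0.
rewrite D0 !subr0 -/(D t) => ->.
have c1 : c < 1 by apply: le_lt_trans t1.
have s01 : 0 <= c ^+ 2 <= 1 by rewrite sqr_ge0 /= expr_le1 // ltW.
have := Bpol_sq_bounds N s01; set b := (Bpol N).[_]; set rt := Num.sqrt (1 - c ^+ 2).
have s1 : c ^+ 2 < 1 by rewrite expr_lt1.
have rt0 : 0 < rt by rewrite sqrtr_gt0 subr_gt0.
have rt2 : rt ^+ 2 = 1 - c ^+ 2 by rewrite sqr_sqrtr // subr_ge0 ltW.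
rewrite -rt2 -exprMn => /andP[h1 h2].
have b0 : 0 <= b by apply: Bpol_ge0; exact: sqr_ge0.
have rb0 : 0 <= rt * b by rewrite mulr_ge0 // ltW.
have rb1 : rt * b <= 1 by rewrite -(@expr_le1 _ 2).
have ddE : dD c = (1 - rt * b) / rt.
  by rewrite /dD -/rt -/b; field; exact: lt0r_neq0.
have tt : t ^+ 2 < 1 by rewrite expr_lt1.
have rtt : Num.sqrt (1 - t ^+ 2) <= rt.
  by rewrite ler_wsqrtr // lerD2l lerN2 ler_pXn2r ?nnegrE // ltW.
have rtt0 : 0 < Num.sqrt (1 - t ^+ 2) by rewrite sqrtr_gt0 subr_gt0.
have e0 : err N (c ^+ 2) <= err N (t ^+ 2).
  rewrite /err ler_wpM2l ?mulr_ge0 ?addr_ge0 //.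
  by rewrite ler_pXn2r ?nnegrE ?sqr_ge0 // ler_pXn2r ?nnegrE.
have u : 1 - rt * b <= err N (t ^+ 2).
  apply: le_trans e0; rewrite lerBlDl -lerBlDr; apply: le_trans h1 _.
  by rewrite expr2 ler_piMr.
have e1 : 0 <= err N (t ^+ 2) by apply: le_trans u; rewrite subr_ge0.
rewrite ddE; apply/andP; split.
  by rewrite mulr_ge0 // divr_ge0 ?subr_ge0 // ltW.
apply: (@le_trans _ _ ((1 - rt * b) / rt)).
  by rewrite ler_piMr ?(ltW t1) // divr_ge0 ?subr_ge0 // ltW.
by rewrite ler_pM ?subr_ge0 ?invr_ge0 ?(ltW rt0) // lef_pV2 ?posrE.
Qed.

Lemma err_small q C e : 0 <= q < 1 -> 0 <= C -> 0 < e ->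
  exists N0, forall N, (N0 <= N)%N -> err N q * C <= e.
Proof.
(* With [q = r^4] the decay absorbs three factors [N + 1]: two from [err], and one that yields the
   rate [1 / (N + 1)]. *)
move=> /andP[q0 q1] C0 e0; pose r := Num.sqrt (Num.sqrt q).
have r4 : r ^+ 4 = q.
  by rewrite (exprM r 2 2) sqr_sqrtr ?sqrtr_ge0 // sqr_sqrtr.
have r0 : 0 <= r by exact: sqrtr_ge0.
have r1 : r < 1 by rewrite -(@expr_lt1 _ 4) // r4.
pose x := 1 - r; have x0 : 0 < x by rewrite subr_gt0.
have x1 : 0 <= x <= 1 by rewrite ltW //= gerBl.
have hb N : N.+1%:R * r ^+ N.+1 <= x^-1.
  have := expr_bernoulli N.+1 x1; rewrite /x opprB addrC subrK -/x => h.
  rewrite -[leRHS]mul1r ler_pdivlMr //; apply: le_trans h.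
  have p0 : 0 <= r ^+ N.+1 by exact: exprn_ge0.
  nra.
have c0 : 0 < 2 * x^-1 ^+ 3 * (C + 1).
  by rewrite !mulr_gt0 ?exprn_gt0 ?invr_gt0 //; lra.
exists (Num.truncn (2 * x^-1 ^+ 3 * (C + 1) / e)).+1 => N hN.
set y := N.+1%:R * r ^+ N.+1 in hb *.
have N10 : 0 < N.+1%:R :> R by rewrite ltr0n.
have y0 : 0 <= N.+1%:R * r ^+ N.+1 by rewrite mulr_ge0 // exprn_ge0.
have e1 : err N q <= 2 * x^-1 ^+ 3 / N.+1%:R.
  rewrite ler_pdivlMr // /err -r4 -exprM mulnC exprM.
  apply: (@le_trans _ _ (2 * (N.+1%:R * r ^+ N.+1) ^+ 3)); last first.
    by rewrite ler_pM2l // ler_pXn2r ?nnegrE ?invr_ge0 // ltW.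
  have rp : r ^+ N.+1 <= 1 by rewrite exprn_ile1 // ltW.
  set p := r ^+ N.+1 in rp *; have p0 : 0 <= p by exact: exprn_ge0.
  have -> : 2 * (N.+1%:R * p) ^+ 3 = (2 * N.+1%:R) * N.+1%:R * p ^+ 3 * N.+1%:R by ring.
  rewrite ler_pM2r // -(mulrA _ _ (p ^+ 4)) -(mulrA _ _ (p ^+ 3)).
  apply: ler_pM; rewrite ?mulr_ge0 ?exprn_ge0 ?addr_ge0 //.
    by rewrite -natr1; lra.
  by rewrite ler_pM2l // ler_wiXn2l.
apply: (@le_trans _ _ (2 * x^-1 ^+ 3 / N.+1%:R * (C + 1))).
  apply: ler_pM => //; last by lra.
  by rewrite /err !mulr_ge0 ?exprn_ge0 // addr_ge0.
rewrite mulrAC ler_pdivrMr // -ler_pdivrMl // mulrC.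
apply: le_trans (ltW (truncnS_gt _)) _.
by rewrite ler_nat ltnW.
Qed.

Lemma Spol_mono N s t : 0 <= s <= t -> (Spol N).[s] <= (Spol N).[t].
Proof.
move=> /andP[s0 st]; rewrite !SpolE; apply: ler_sum => k _.
rewrite ler_wpM2l ?divr_ge0 ?(ltW (bco_gt0 _)) //.
by apply: lerXn2r; rewrite ?nnegrE // (le_trans s0).
Qed.

Lemma Spol_odd N t : (Spol N).[- t] = - (Spol N).[t].
Proof.
rewrite !SpolE -sumrN; apply: eq_bigr => k _.
by rewrite addn1 exprS exprM sqrrN -exprM mulNr -exprS mulrN.
Qed.

(** The bound of [asn_Spol_bounds] degenerates at 1, so the value there is reached from [1 - r]:
    each of the [N + 1] terms changes by at most [r]. *)
Lemma Spol1_le N : (Spol N).[1] <= pi / 2.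
Proof.
apply/ler_addgt0Pr => e e0; pose r := Num.min 1 (e / N.+1%:R).
have N0 : 0 < N.+1%:R :> R by rewrite ltr0n.
have r0 : 0 < r by rewrite lt_min ltr01 divr_gt0.
have r1 : r <= 1 by rewrite ge_min lexx.
have re : r * N.+1%:R <= e by rewrite -ler_pdivlMr // ge_min lexx orbT.
have t01 : 0 <= 1 - r < 1 by apply/andP; split; lra.
have /andP[h _] := asn_Spol_bounds N t01.
have ha : asn (1 - r) <= pi / 2.
  by rewrite /asn lerBlDr lerDl acos_ge0 //; apply/andP; split; lra.
have hd : (Spol N).[1] - (Spol N).[1 - r] <= r * N.+1%:R.
  rewrite !SpolE -sumrB -[N.+1 in leRHS]card_ord mulr_natr -sumr_const.
  apply: ler_sum => k _; rewrite -mulrBr expr1n.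
  set m := (2 * k + 1)%N; have m0 : 0 < m%:R :> R by rewrite ltr0n /m addn1.
  have hm : 1 - (1 - r) ^+ m <= m%:R * r.
    elim: (m) => [|p IH]; first by rewrite expr0 subrr mul0r.
    rewrite exprS -natr1.
    have : 0 <= r * (1 - (1 - r) ^+ p).
      by rewrite mulr_ge0 ?(ltW r0) // subr_ge0 exprn_ile1 //; lra.
    nra.
  apply: (@le_trans _ _ (1 / m%:R * (m%:R * r))).
    rewrite ler_pM ?divr_ge0 ?(ltW (bco_gt0 _)) ?subr_ge0 //.
      by rewrite exprn_ile1 //; lra.
    by rewrite ler_wpM2r ?invr_ge0 ?(ltW m0) // bco_le1.
  by rewrite mulrA divfK ?mul1r // lt0r_neq0.
lra.
Qed.

Lemma Spol_cvg_ge0 t e : 0 <= t <= 1 -> 0 < e ->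
  exists N0, forall N, (N0 <= N)%N -> `|asn t - (Spol N).[t]| <= e.
Proof.
have H u e' : 0 <= u < 1 -> 0 < e' ->
    exists N0, forall N, (N0 <= N)%N -> 0 <= asn u - (Spol N).[u] <= e'.
  move=> u01 e0; have /andP[u0 u1] := u01.
  have q01 : 0 <= u ^+ 2 < 1 by rewrite sqr_ge0 expr_lt1.
  have C0 : 0 <= (Num.sqrt (1 - u ^+ 2))^-1 by rewrite invr_ge0 sqrtr_ge0.
  have [N0 hN] := err_small q01 C0 e0; exists N0 => N /hN h.
  by have /andP[-> h2] := asn_Spol_bounds N u01; rewrite (le_trans h2).
move=> /andP[t0]; rewrite le_eqVlt => /orP[/eqP ->|t1] e0; last first.
  have t01 : 0 <= t < 1 by rewrite t0.
  have [N0 hN] := H _ _ t01 e0; exists N0 => N /hN /andP[h1 h2].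
  by rewrite ger0_norm.
(* At [t = 1] the partial sum is squeezed between its value at [cos th], where arcsine is
   [pi / 2 - th], and [pi / 2]. *)
pose th := Num.min 1 (e / 2).
have th0 : 0 < th by rewrite lt_min ltr01 divr_gt0.
have th1 : th <= 1 by rewrite ge_min lexx.
have the : th <= e / 2 by rewrite ge_min lexx orbT.
have pi2 := @pi_ge2 R.
have ac : acos (cos th) = th by apply: cosK; rewrite in_itv /= ltW //=; lra.
have c01 : 0 <= cos th < 1.
  rewrite cos_ge0_pihalf /=; last by apply/andP; split; lra.
  rewrite lt_neqAle cos_le1 andbT; apply: contraTneq th0 => h.
  by rewrite -ac h acos1 ltxx.
have e20 : 0 < e / 2 by rewrite divr_gt0.
have [N0 hN] := H _ _ c01 e20; exists N0 => N /hN /andP[_ h].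
have hm : (Spol N).[cos th] <= (Spol N).[1].
  by apply: Spol_mono; case/andP: c01 => -> /ltW.
have := Spol1_le N; rewrite /asn ac in h; rewrite /asn acos1 subr0 => h1.
by rewrite ger0_norm; lra.
Qed.

Lemma Spol_cvg t e : -1 <= t <= 1 -> 0 < e ->
  exists N0, forall N, (N0 <= N)%N -> `|asn t - (Spol N).[t]| <= e.
Proof.
move=> /andP[tm1 t1] e0; have [t0|t0] := leP 0 t.
  by apply: Spol_cvg_ge0 => //; rewrite t0.
have t01 : 0 <= - t <= 1 by apply/andP; split; lra.
have [N0 hN] := Spol_cvg_ge0 t01 e0; exists N0 => N /hN.
rewrite Spol_odd /asn acosN; last by apply/andP; split; lra.
have -> : pi / 2 - (pi - acos t) - - (Spol N).[t] = - (pi / 2 - acos t - (Spol N).[t]).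
  by move: pi => p; field.
by rewrite normrN.
Qed.

(* Coefficients of 1/2 - acos t / (2 pi) = 1/4 + arcsin t / (2 pi). *)
Definition alpha k : R :=
  if k == 0%N then 1 / 4 else
  if odd k then bco k./2 / k%:R / (2 * pi) else 0.
Definition kco k : R := alpha k + (if k is k'.+1 then alpha k' else 0).
Definition kap N t : R := \sum_(k < N) kco k * t ^+ k.
Definition ker t : R := (pi - acos t) / (2 * pi) + t * ((pi - acos t) / (2 * pi)).

Lemma Kker_ker d (u v : 'rV[R]_d) : Kker u v = ker (dotp u v).
Proof. by []. Qed.

Lemma alpha_ge0 k : 0 <= alpha k.
Proof.
rewrite /alpha; case: ifP => _; first by rewrite divr_ge0.
case: ifP => // _; rewrite !divr_ge0 ?(ltW (bco_gt0 _)) // mulr_ge0 //.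
exact: pi_ge0.
Qed.

Lemma alpha_odd_gt0 k : odd k -> 0 < alpha k.
Proof.
rewrite /alpha; case: k => // k ok; rewrite ok /=.
by rewrite !divr_gt0 ?bco_gt0 ?ltr0n // mulr_gt0 // pi_gt0.
Qed.

(** [alpha] vanishes at positive even degrees; there the shifted copy, which stems from the factor
    [1 + t] of the kernel, is an odd coefficient and positive. *)
Lemma kco_gt0 k : 0 < kco k.
Proof.
rewrite /kco; case: k => [|k]; first by rewrite /alpha /= addr0 divr_gt0.
have [ok|ok] := boolP (odd k).
  by rewrite ltr_wpDl ?alpha_ge0 // alpha_odd_gt0.
by rewrite ltr_pwDl ?alpha_ge0 // alpha_odd_gt0 //= ok.
Qed.

Definition Apart N t : R := \sum_(k < N) alpha k * t ^+ k.

Lemma Apart_even m t : Apart (m.*2.+2) t = 1 / 4 + (Spol m).[t] / (2 * pi).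
Proof.
have pn : pi != 0 :> R by exact: lt0r_neq0 (pi_gt0 R).
elim: m => [|m IH].
  rewrite /Apart !big_ord_recr big_ord0 /= SpolE big_ord1 /= /alpha /=.
  by rewrite expr0 add0r mulr1 -[0.*2.+1]/1%N muln0 add0n expr1; move: pi pn => p pn; field.
rewrite doubleS [LHS]/Apart 2!big_ord_recr -/(Apart m.*2.+2 t) IH.
rewrite !SpolE [in RHS]big_ord_recr /= /alpha /= odd_double /=.
rewrite mul0r addr0 uphalf_double [in RHS](mulrDl _ _ (2 * pi)^-1) addrA; congr (_ + _).
have -> : (2 * m.+1 + 1)%N = m.*2.+3 by rewrite mul2n doubleS addn1.
by rewrite mulrAC.
Qed.

Lemma Apart_odd m t : Apart (m.*2.+3) t = 1 / 4 + (Spol m).[t] / (2 * pi).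
Proof.
rewrite -Apart_even /Apart [LHS]big_ord_recr /= /alpha /= odd_double /=.
by rewrite mul0r addr0.
Qed.

Lemma ApartE N t : (2 <= N)%N -> Apart N t = 1 / 4 + (Spol (N - 2)./2).[t] / (2 * pi).
Proof.
case: N => [|[|N]] // _; rewrite subn2 /= -{1}(odd_double_half N).
by case: (odd N); rewrite ?add1n ?add0n ?Apart_odd ?Apart_even.
Qed.

Lemma kapS N t : kap N.+1 t = Apart N.+1 t + t * Apart N t.
Proof.
rewrite /kap /kco; under eq_bigr do rewrite mulrDl.
rewrite big_split /=; congr (_ + _).
rewrite big_ord_recl /= mul0r add0r /Apart mulr_sumr; apply: eq_bigr => i _.
by rewrite /= exprS; ring.
Qed.

Lemma kap_cvg1 t e : -1 <= t <= 1 -> 0 < e ->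
  exists N0, forall N, (N0 <= N)%N -> `|ker t - kap N t| <= e.
Proof.
move=> t1 e0; have [N0 hN] := Spol_cvg t1 e0.
have p2 := @pi_ge2 R.
exists (N0.*2.+4)%N => -[|N] // hN1.
have N2 : (2 <= N)%N by lia.
rewrite kapS !ApartE //; last by lia.
have h1 := hN (N.+1 - 2)./2 ltac:(lia); have h2 := hN (N - 2)./2 ltac:(lia).
have pn : pi != 0 :> R by exact: lt0r_neq0 (pi_gt0 R).
set s1 := (Spol _).[t] in h1 *; set s2 := (Spol _).[t] in h2 *.
have -> : ker t - (1 / 4 + s1 / (2 * pi) + t * (1 / 4 + s2 / (2 * pi))) =
    (asn t - s1) / (2 * pi) + t * ((asn t - s2) / (2 * pi)).
  by rewrite /ker /asn; move: pi pn => p pn; field.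
apply: le_trans (ler_normD _ _) _; rewrite (normrM t) !normf_div normrM.
have tn : `|t| <= 1 by rewrite ler_norml.
have pp : `|2 * pi : R| = 2 * pi by rewrite ger0_norm // mulr_ge0 // pi_ge0.
rewrite [`|2|]ger0_norm // [`|pi|]ger0_norm ?pi_ge0 //.
have h3 (x : R) : `|x| <= e -> `|x| / (2 * pi) <= e / 2.
  move=> hx; rewrite ler_pdivrMr ?mulr_gt0 ?pi_gt0 //; apply: le_trans hx _.
  by nra.
have h4 := h3 _ h1; have h5 := h3 _ h2.
have h6 : `|t| * (`|asn t - s2| / (2 * pi)) <= e / 2.
  apply: le_trans h5; rewrite ler_piMl // divr_ge0 // mulr_ge0 // pi_ge0.
  by [].
by lra.
Qed.

Lemma ker1 : ker 1 = 1.
Proof.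
rewrite /ker acos1; have pn : pi != 0 :> R by exact: lt0r_neq0 (pi_gt0 R).
by move: pi pn => p pn; field.
Qed.

Lemma kap_le N M t : (N <= M)%N -> 0 <= t -> kap N t <= kap M t.
Proof.
move=> NM t0; rewrite /kap (big_ord_widen M (fun k => kco k * t ^+ k) NM).
rewrite big_mkcond /=; apply: ler_sum => k _; case: ifP => // _.
by rewrite mulr_ge0 ?exprn_ge0 ?(ltW (kco_gt0 _)).
Qed.

Lemma kap1_le1 N : kap N 1 <= 1.
Proof.
apply/ler_addgt0Pr => e e0.
have i1 : -1 <= (1 : R) <= 1 by apply/andP; split; lra.
have [N0 h] := kap_cvg1 i1 e0.
have := h (maxn N0 N) (leq_maxl _ _); rewrite ker1 => h1.
have := @kap_le N (maxn N0 N) 1 (leq_maxr _ _) ler01.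
by move: h1; rewrite ler_distlC => /andP[_]; lra.
Qed.

Lemma kap_diff N M t : (N <= M)%N -> `|t| <= 1 ->
  `|kap M t - kap N t| <= (kap M 1 - kap N 1) * `|t| ^+ N.
Proof.
move=> NM t1; rewrite /kap -!(big_mkord xpredT (fun k => kco k * _ ^+ k)).
rewrite !(big_cat_nat (leq0n N) NM) /= ![_ + _ - _]addrAC !subrr !add0r.
apply: le_trans (ler_norm_sum _ _ _) _.
rewrite mulr_suml big_nat_cond [leRHS]big_nat_cond; apply: ler_sum => k.
rewrite andbT => /andP[Nk _]; rewrite normrM normrX expr1n mulr1.
rewrite ger0_norm ?(ltW (kco_gt0 _)) // ler_wpM2l ?(ltW (kco_gt0 _)) //.
exact: ler_wiXn2l.
Qed.

(** The coefficients are positive with total mass at most [ker 1 = 1]. *)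
Lemma kap_tail N t : `|t| <= 1 -> `|ker t - kap N t| <= `|t| ^+ N.
Proof.
move=> t1; apply/ler_addgt0Pr => e e0.
have i1 : -1 <= t <= 1 by rewrite -ler_norml.
have [N0 h] := kap_cvg1 i1 e0.
have h1 := h (maxn N0 N) (leq_maxl _ _).
have h2 := kap_diff (leq_maxr N0 N) t1.
have h3 : (kap (maxn N0 N) 1 - kap N 1) * `|t| ^+ N <= `|t| ^+ N.
  rewrite ler_piMl ?exprn_ge0 // lerBlDr (le_trans (kap1_le1 _)) // lerDl.
  by rewrite /kap sumr_ge0 // => k _; rewrite expr1n mulr1 (ltW (kco_gt0 _)).
have := ler_distD (kap (maxn N0 N) t) (ker t) (kap N t); lra.
Qed.

(** As the coefficients are positive, convergence at [t = 1] dominates convergence at every other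
    [t]. *)
Lemma kap_unif e : 0 < e -> exists N0, forall N, (N0 <= N)%N ->
  forall t, `|t| <= 1 -> `|ker t - kap N t| <= e.
Proof.
move=> e0; have e20 : 0 < e / 2 by rewrite divr_gt0.
have i1 : -1 <= (1 : R) <= 1 by apply/andP; split; lra.
have [N0 h] := kap_cvg1 i1 e20; exists N0 => N hN t t1.
have it : -1 <= t <= 1 by rewrite -ler_norml.
have [N1 h1] := kap_cvg1 it e20.
have a1 := h1 (maxn N1 N) (leq_maxl _ _).
have a2 := kap_diff (leq_maxr N1 N) t1.
have a3 := h _ hN; have a4 := kap1_le1 (maxn N1 N).
have a5 : (kap (maxn N1 N) 1 - kap N 1) * `|t| ^+ N <= 1 - kap N 1.
  rewrite -[leRHS]mulr1; apply: ler_pM; rewrite ?exprn_ge0 ?exprn_ile1 ?lerD2r //.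
  by rewrite subr_ge0 kap_le // leq_maxr.
have := ler_distD (kap (maxn N1 N) t) (ker t) (kap N t).
move: a3; rewrite ker1 ger0_norm ?subr_ge0 ?kap1_le1 //; lra.
Qed.

End ArcsinSeries.

(** * Moments of the uniform distribution on the sphere *)

Section Expectation.
Context (R : realType) (dO : measure_display) (Om : measurableType dO)
  (P : probability Om R).

Definition bm (f : Om -> R) : Prop :=
  measurable_fun setT f /\ exists M, forall om, `|f om| <= M.

Definition Ex (f : Om -> R) : R := \int[P]_x f x.

Lemma bm_integrable f : bm f -> P.-integrable setT (EFin \o f).
Proof.
move=> [mf [M hM]]; have Pf : (P setT < +oo)%E by rewrite ltey_eq fin_num_measure.
apply: (measurable_bounded_integrable measurableT Pf mf).
exists M; split; first exact: num_real.
by move=> x Mx y _ /=; rewrite (le_trans (hM y)) // ltW.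
Qed.

Lemma Ex_EFin f : bm f -> (\int[P]_x (f x)%:E = (Ex f)%:E)%E.
Proof.
by move=> /bm_integrable h; rewrite /Ex /Rintegral fineK // integrable_fin_num.
Qed.

Lemma bm_cst c : bm (fun=> c).
Proof. by split; [exact: measurable_cst | exists `|c|]. Qed.

Lemma bmD f g : bm f -> bm g -> bm (fun x => f x + g x).
Proof.
move=> [mf [M hM]] [mg [N hN]]; split; first exact: measurable_funD.
exists (M + N) => x; apply: le_trans (ler_normD _ _) _; exact: lerD.
Qed.

Lemma bmM f g : bm f -> bm g -> bm (fun x => f x * g x).
Proof.
move=> [mf [M hM]] [mg [N hN]]; split; first exact: measurable_funM.
by exists (M * N) => x; rewrite normrM ler_pM.
Qed.

Lemma bmZ c f : bm f -> bm (fun x => c * f x).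
Proof. by move=> h; apply: bmM => //; exact: bm_cst. Qed.

Lemma bmB f g : bm f -> bm g -> bm (fun x => f x - g x).
Proof.
move=> hf hg; have -> : (fun x => f x - g x) = (fun x => f x + (-1) * g x).
  by apply/funext => x; rewrite mulN1r.
by apply: bmD => //; exact: bmZ.
Qed.

Lemma bm_sum (I : Type) (r : seq I) (Q : pred I) (f : I -> Om -> R) :
  (forall i, bm (f i)) -> bm (fun x => \sum_(i <- r | Q i) f i x).
Proof.
move=> h; elim: r => [|i r IH].
  by rewrite (_ : (fun _ => _) = fun=> 0) //; [exact: bm_cst | apply/funext => x; rewrite big_nil].
rewrite (_ : (fun _ => _) = fun x => (if Q i then f i x else 0) + \sum_(j <- r | Q j) f j x).
  by apply: bmD => //; case: (Q i) => //; exact: bm_cst.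
by apply/funext => x; rewrite big_cons; case: ifP => //; rewrite add0r.
Qed.

Lemma bm_prod (I : Type) (r : seq I) (f : I -> Om -> R) :
  (forall i, bm (f i)) -> bm (fun x => \prod_(i <- r) f i x).
Proof.
move=> h; elim: r => [|i r IH].
  by rewrite (_ : (fun _ => _) = fun=> 1) //; [exact: bm_cst | apply/funext => x; rewrite big_nil].
rewrite (_ : (fun _ => _) = fun x => f i x * \prod_(j <- r) f j x).
  exact: bmM.
by apply/funext => x; rewrite big_cons.
Qed.

Lemma bmX n f : bm f -> bm (fun x => f x ^+ n).
Proof.
move=> h; elim: n => [|n IH].
  by under eq_fun do rewrite expr0; exact: bm_cst.
by under eq_fun do rewrite exprS; exact: bmM.
Qed.

Lemma Ex_cst c : Ex (fun=> c) = c.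
Proof. by rewrite /Ex Rintegral_cst // [X in fine X]probability_setT mulr1. Qed.

Lemma ExD f g : bm f -> bm g -> Ex (fun x => f x + g x) = Ex f + Ex g.
Proof. by move=> /bm_integrable hf /bm_integrable hg; rewrite /Ex RintegralD. Qed.

Lemma ExB f g : bm f -> bm g -> Ex (fun x => f x - g x) = Ex f - Ex g.
Proof. by move=> /bm_integrable hf /bm_integrable hg; rewrite /Ex RintegralB. Qed.

Lemma ExZ c f : bm f -> Ex (fun x => c * f x) = c * Ex f.
Proof. by move=> /bm_integrable hf; rewrite /Ex RintegralZl. Qed.

Lemma eq_Ex f g : f =1 g -> Ex f = Ex g.
Proof. by move=> /funext ->. Qed.

Lemma Ex_sum (I : Type) (r : seq I) (f : I -> Om -> R) :
  (forall i, bm (f i)) -> Ex (fun x => \sum_(i <- r) f i x) = \sum_(i <- r) Ex (f i).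
Proof.
move=> h; elim: r => [|i r IH].
  rewrite big_nil; transitivity (Ex (fun=> 0)); last exact: Ex_cst.
  by apply: eq_Ex => x; rewrite big_nil.
rewrite big_cons -IH -ExD //; last exact: bm_sum.
by apply: eq_Ex => x; rewrite big_cons.
Qed.

Lemma Ex_ge0 f : (forall x, 0 <= f x) -> 0 <= Ex f.
Proof. by move=> h; apply: Rintegral_ge0. Qed.

Lemma Ex_le f g : bm f -> bm g -> (forall x, f x <= g x) -> Ex f <= Ex g.
Proof.
by move=> /bm_integrable hf /bm_integrable hg h; apply: le_Rintegral.
Qed.

Lemma Ex_norm f M : bm f -> (forall x, `|f x| <= M) -> `|Ex f| <= M.
Proof.
move=> hf h; rewrite ler_norml -{1}(Ex_cst M) -{2}(Ex_cst M) -[X in X <= _]mulN1r -ExZ; last exact: bm_cst.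
by apply/andP; split; apply: Ex_le => //; rewrite ?mulN1r; try exact: bm_cst;
  move=> x; have := h x; rewrite ler_norml ?mulN1r => /andP[].
Qed.

Lemma Ex_markov f a : bm f -> (forall x, 0 <= f x) -> 0 < a ->
  (P [set x | (a <= f x)%R] <= (Ex f / a)%:E)%E.
Proof.
move=> bf f0 a0; have mA : measurable [set x | a <= f x].
  have := measurable_fun_ler (measurable_cst a) bf.1 measurableT (Y := [set true]).
  by rewrite setTI; apply.
rewrite -[X in (X <= _)%E]fineK ?fin_num_measure // lee_fin ler_pdivlMr //.
have bi : bm (\1_[set x | a <= f x] : Om -> R).
  split; first exact: measurable_indic.
  by exists 1 => x; rewrite indicE; case: (_ \in _); rewrite ?normr1 ?normr0.
have -> : fine (P [set x | a <= f x]) = Ex (\1_[set x | a <= f x] : Om -> R).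
  by rewrite /Ex /Rintegral integral_indic // setIT.
rewrite mulrC -ExZ //; apply: Ex_le => //; first exact: bmZ.
move=> x; rewrite indicE; case: (boolP (x \in _)) => [|_]; last by rewrite mulr0.
by rewrite inE mulr1.
Qed.

End Expectation.

Lemma measurable_fun_le_set d (T : measurableType d) (R : realType) (f : T -> R) :
  (forall c, measurable [set x | f x <= c]) -> measurable_fun setT f.
Proof.
move=> h; apply: (measurability _ (RGenOInfty.measurableE R)) => /= _ [_] [r] -> <-.
rewrite setTI (_ : _ @^-1` _ = ~` [set x | f x <= r]); first exact: measurableC.
by apply/seteqP; split => x /=; rewrite in_itv /= andbT ltNge => /negP.
Qed.

(** * Laws determined by lower orthants *)

Section EqualLaw.
Context (R : realType) (dO : measure_display) (Om : measurableType dO)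
  (P : probability Om R) (d : nat).

(** Laws are given by joint distribution functions, so row vectors carry the sigma-algebra generated
    by lower orthants, on which a pi-system argument recovers the law from these data. *)
Definition boxes : set (set 'rV[R]_d) :=
  [set A | exists a : 'rV[R]_d, A = [set x : 'rV[R]_d | forall k, x 0 k <= a 0 k]].

Lemma boxesI : setI_closed boxes.
Proof.
move=> _ _ [a ->] [b ->]; exists (\row_k Num.min (a 0 k) (b 0 k)).
apply/seteqP; split => x /= h => [k|]; first by rewrite mxE le_min (h.1 k) (h.2 k).
by split => k; have := h k; rewrite mxE le_min => /andP[].
Qed.

Lemma archi_bound (x : 'rV[R]_d) : exists n, forall k, x 0 k <= n%:R.
Proof.
pose F k := (Num.truncn `|x 0 k|).+1; exists (\max_k F k)%N => k.
apply: le_trans (ler_norm _) _; apply: le_trans (ltW (truncnS_gt _)) _.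
by rewrite ler_nat -/(F k); exact: leq_bigmax.
Qed.

Lemma boxes_coord_measurable k :
  measurable_fun setT (fun x : g_sigma_algebraType boxes => x 0 k).
Proof.
apply: measurable_fun_le_set => c.
rewrite (_ : mkset _ = \bigcup_n [set x : 'rV[R]_d | forall j, x 0 j <=
    (\row_j (if j == k then c else n%:R) : 'rV[R]_d) 0 j]).
  apply: bigcup_measurable => n _; apply: sub_sigma_algebra.
  by exists (\row_j (if j == k then c else n%:R)).
apply/seteqP; split => x /= => [xc|[n _ /(_ k)]]; last by rewrite mxE eqxx.
have [n hn] := archi_bound x; exists n => // j; rewrite mxE.
by case: eqP => [->|_].
Qed.

Lemma box_map_measurable (X : Om -> 'rV[R]_d) :
  (forall k, measurable_fun setT (fun om => X om 0 k)) ->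
  measurable_fun setT (X : Om -> g_sigma_algebraType boxes).
Proof.
move=> mX; apply: (@measurability _ _ Om (g_sigma_algebraType boxes) setT X boxes erefl) => // _ [_ [a ->] <-].
rewrite setTI (_ : _ @^-1` _ = \bigcap_(k in [set: 'I_d]) [set om | X om 0 k <= a 0 k]).
  apply: fin_bigcap_measurable => // k _.
  have := mX k measurableT _ (@measurable_itv _ `]-oo, a 0 k]).
  by rewrite setTI; congr measurable; apply/seteqP; split => x /=; rewrite in_itv.
apply/seteqP; split => x /= h => [k _|k]; [exact: h | exact: h].
Qed.

Lemma eq_law_Ex (X Y : Om -> 'rV[R]_d) (f : 'rV[R]_d -> R) :
  (forall k, measurable_fun setT (fun om => X om 0 k)) ->
  (forall k, measurable_fun setT (fun om => Y om 0 k)) ->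
  (forall a : 'rV[R]_d, P [set om | forall k, X om 0 k <= a 0 k] =
     P [set om | forall k, Y om 0 k <= a 0 k]) ->
  measurable_fun setT (f : g_sigma_algebraType boxes -> R) ->
  bm (f \o X) -> bm (f \o Y) -> Ex P (f \o X) = Ex P (f \o Y).
Proof.
move=> mX mY h mf bX bY.
have mX' := box_map_measurable mX; have mY' := box_map_measurable mY.
pose X' : {mfun Om >-> g_sigma_algebraType boxes} :=
  HB.pack (X : Om -> g_sigma_algebraType boxes) (isMeasurableFun.Build _ _ _ _ _ mX').
pose Y' : {mfun Om >-> g_sigma_algebraType boxes} :=
  HB.pack (Y : Om -> g_sigma_algebraType boxes) (isMeasurableFun.Build _ _ _ _ _ mY').
rewrite /Ex /Rintegral; congr fine.
have mfE : measurable_fun setT (EFin \o f : g_sigma_algebraType boxes -> _).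
  exact/measurable_EFinP.
have := @integral_distribution _ _ _ _ _ P X' (EFin \o f) mfE (bm_integrable P bX).
have := @integral_distribution _ _ _ _ _ P Y' (EFin \o f) mfE (bm_integrable P bY).
rewrite /= => <- <-; apply: eq_measure_integral => A mA _.
apply: (@measure_unique _ _ (g_sigma_algebraType boxes) boxes (fun n => [set x : 'rV[R]_d | forall k, x 0 k <= (const_mx n%:R : 'rV[R]_d) 0 k])) => //.
- exact: boxesI.
- by move=> n; exists (const_mx n%:R).
- apply/seteqP; split => // x _; have [n hn] := archi_bound x.
  by exists n => // k; rewrite mxE.
- by move=> _ [a ->]; rewrite /distribution /pushforward; exact: h.
- by move=> n; rewrite ltey_eq fin_num_measure //; apply: sub_sigma_algebra; exists (const_mx n%:R).
Qed.

End EqualLaw.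

(** * Integration by parts from rotation invariance *)

Section SphereMoments.
Context (R : realType) (dO : measure_display) (Om : measurableType dO)
  (P : probability Om R) (d : nat) (X : Om -> 'rV[R]_d).
Hypothesis hX : uniform_sphere_rv P X.

Lemma sphere_coord_le1 (x : 'rV[R]_d) k : on_sphere x -> `|x 0 k| <= 1.
Proof.
move=> x1; rewrite -(@expr_le1 _ 2) // -normrX ger0_norm ?sqr_ge0 //.
rewrite -x1 /dotp (bigD1 k) //= -expr2 lerDl.
by apply: sumr_ge0 => i _; rewrite -expr2 sqr_ge0.
Qed.

Lemma bm_coord k : bm (fun om => X om 0 k).
Proof.
split; first exact: hX.1.
by exists 1 => om; apply: sphere_coord_le1; exact: hX.2.1.
Qed.

Lemma bm_monom w : bm (fun om => monom w (X om)).
Proof. by apply: bm_prod => k; exact: bm_coord. Qed.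

Definition smom (w : seq 'I_d) : R := Ex P (fun om => monom w (X om)).

Lemma smom_nil : smom [::] = 1.
Proof.
by rewrite -(Ex_cst P 1); apply: eq_Ex => om; rewrite /monom big_nil.
Qed.

Lemma smom_perm : tsym smom.
Proof. by move=> v w vw; apply: eq_Ex => om; exact: monom_sym. Qed.

Lemma smom_pos (r : seq (seq 'I_d * R)) :
  0 <= \sum_(p <- r) \sum_(q <- r) p.2 * q.2 * smom (p.1 ++ q.1).
Proof.
have bp (p : seq 'I_d * R) : bm (fun om => p.2 * monom p.1 (X om)).
  by apply: bmZ; exact: bm_monom.
have -> : \sum_(p <- r) \sum_(q <- r) p.2 * q.2 * smom (p.1 ++ q.1) =
   Ex P (fun om => (\sum_(p <- r) p.2 * monom p.1 (X om)) ^+ 2).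
  transitivity (Ex P (fun om => \sum_(p <- r) \sum_(q <- r)
      (p.2 * monom p.1 (X om)) * (q.2 * monom q.1 (X om)))).
    rewrite Ex_sum; last by move=> p; apply: bm_sum => q; apply: bmM.
    apply: eq_bigr => p _; rewrite Ex_sum; last by move=> q; apply: bmM.
    apply: eq_bigr => q _; rewrite -ExZ; last exact: bm_monom.
    by apply: eq_Ex => om; rewrite monom_cat; ring.
  apply: eq_Ex => om; rewrite expr2 mulr_suml; apply: eq_bigr => p _.
  by rewrite mulr_sumr.
by apply: Ex_ge0 => om; exact: sqr_ge0.
Qed.

Lemma monom_le1 (x : 'rV[R]_d) w : on_sphere x -> `|monom w x| <= 1.
Proof.
move=> x1; elim: w => [|k w IH]; first by rewrite /monom big_nil normr1.
by rewrite monom_cons normrM mulr_ile1 // sphere_coord_le1.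
Qed.

Lemma monom_measurable w :
  measurable_fun setT (fun x : g_sigma_algebraType (@boxes R d) => monom w x).
Proof.
elim: w => [|k w IH].
  by under eq_fun do rewrite /monom big_nil; exact: measurable_cst.
under eq_fun do rewrite monom_cons.
apply: measurable_funM; last exact: IH.
exact: boxes_coord_measurable.
Qed.

Lemma smom_rotate (Q : 'M[R]_d) w : Q *m Q^T = 1%:M ->
  Ex P (fun om => monom w (X om *m Q)) = smom w.
Proof.
move=> hQ; have sQ om : on_sphere (X om *m Q).
  have := hX.2.1 om; rewrite /on_sphere => <-.
  have E (x : 'rV[R]_d) : dotp x x = (x *m x^T) 0 0.
    by rewrite mxE; apply: eq_bigr => k _; rewrite mxE.
  by rewrite !E trmx_mul mulmxA -(mulmxA (X om)) hQ mulmx1.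
have mQ k : measurable_fun setT (fun om => (X om *m Q) 0 k).
  rewrite (_ : (fun _ => _) = fun om => \sum_j X om 0 j * Q j k); last first.
    by apply/funext => om; rewrite mxE.
  apply: (proj1 (@bm_sum R dO Om _ _ _ (fun j om => X om 0 j * Q j k) _)) => j.
  by apply: bmM; [exact: bm_coord | exact: bm_cst].
apply: (@eq_law_Ex _ _ _ P d (fun om => X om *m Q) X (monom w)) => //.
- exact: hX.1.
- exact: hX.2.2.
- exact: monom_measurable.
- split; last by exists 1 => om; exact: monom_le1.
  have := measurableT_comp (monom_measurable w) (box_map_measurable mQ).
  by [].
- exact: bm_monom.
Qed.

Section Givens.
Variables (a b : 'I_d).
Hypothesis ab : a != b.

(** Velocity at the identity of the rotations [givens_mx] of the plane of [a] and [b]. *)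
Definition givens_dir (x : 'rV[R]_d) : 'rV[R]_d :=
  \row_k (if k == a then - x 0 b else if k == b then x 0 a else 0).

Definition givens_mx (c s : R) : 'M[R]_d :=
  1%:M + (c - 1) *: (delta_mx a a + delta_mx b b) + s *: (delta_mx a b - delta_mx b a).

Lemma givens_mx_orth c s : c ^+ 2 + s ^+ 2 = 1 ->
  givens_mx c s *m (givens_mx c s)^T = 1%:M.
Proof.
move=> cs; have ba : b == a = false by rewrite eq_sym (negbTE ab).
pose S : 'M[R]_d := delta_mx a a + delta_mx b b.
pose J : 'M[R]_d := delta_mx a b - delta_mx b a.
have SS : S *m S = S.
  by rewrite /S mulmxDl !mulmxDr !mul_delta_mx_cond !eqxx (negbTE ab) ba !mulr0n !mulr1n addr0 add0r.
have SJ : S *m J = J.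
  rewrite /S /J mulmxDl !mulmxBr !mul_delta_mx_cond !eqxx (negbTE ab) ba !mulr0n !mulr1n.
  by rewrite subr0 sub0r.
have JS : J *m S = J.
  rewrite /S /J mulmxBl !mulmxDr !mul_delta_mx_cond !eqxx (negbTE ab) ba !mulr0n !mulr1n.
  by rewrite addr0 add0r.
have JJ : J *m J = - S.
  rewrite /S /J mulmxBl !mulmxBr !mul_delta_mx_cond !eqxx (negbTE ab) ba !mulr0n !mulr1n.
  by rewrite subr0 sub0r opprD.
have -> : (givens_mx c s)^T = 1%:M + (c - 1) *: S - s *: J.
  apply/matrixP => i j; rewrite /S /J !mxE (eq_sym j i) !(andbC (j == _)); ring.
rewrite /givens_mx -/S -/J.
rewrite !mulmxDl !mulmxDr !mulmxN !mul1mx !mulmx1 -!scalemxAl -!scalemxAr SS SJ JS JJ.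
apply/matrixP => i j; rewrite !mxE.
move: (S i j) (J i j) (_%:R : R) => p q e.
have e' : s * s = 1 - c * c by rewrite -cs; ring.
ring: e'.
Qed.

(** With sine [t c] the rotation is a move by [t] along the tangent followed by a scaling of two
    coordinates. Parametrizing by the tangent keeps monomials polynomial in [t] up to a power of
    [c]. *)
Lemma givens_mx_mul c t (x : 'rV[R]_d) k :
  (x *m givens_mx c (t * c)) 0 k =
  (if (k == a) || (k == b) then c else 1) * (x + t *: givens_dir x) 0 k.
Proof.
have D i j : x *m delta_mx i j = \row_l (x 0 i * (l == j)%:R) :> 'rV[R]_d.
  apply/rowP => k'; rewrite !mxE (bigD1 i) //= mxE !eqxx big1 ?addr0 // => l /negbTE li.
  by rewrite mxE li mulr0.
rewrite /givens_mx !mulmxDr mulmx1 -!scalemxAr mulmxBr mulmxDr.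
rewrite !D !mxE.
have ba : b == a = false by rewrite eq_sym (negbTE ab).
have [->|ka] := eqVneq k a; first by rewrite (negbTE ab) /=; ring.
have [->|kb] := eqVneq k b; rewrite /=; ring.
Qed.

Lemma givens_monom c t (x : 'rV[R]_d) v :
  monom v (x *m givens_mx c (t * c)) =
  c ^+ (count_mem a v + count_mem b v) * monom v (x + t *: givens_dir x).
Proof.
elim: v => [|k v IH]; first by rewrite /monom !big_nil mulr1.
rewrite !monom_cons givens_mx_mul IH /=.
have [ka|ka] := eqVneq k a; first by rewrite ka (negbTE ab) /= add1n add0n addSn exprS; ring.
by have [kb|kb] := eqVneq k b; rewrite /= ?add1n ?add0n ?addnS ?exprS; ring.
Qed.

Definition givens_der (v : seq 'I_d) (x : 'rV[R]_d) : R :=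
  (count_mem b v)%:R * monom (a :: rem b v) x - (count_mem a v)%:R * monom (b :: rem a v) x.

Lemma givens_der_cons k v x :
  givens_der (k :: v) x = givens_dir x 0 k * monom v x + x 0 k * givens_der v x.
Proof.
have ba : b == a = false by rewrite eq_sym (negbTE ab).
have R1 (c e : 'I_d) : (count_mem c v)%:R * monom (e :: c :: rem c v) x =
    (count_mem c v)%:R * monom (e :: v) x.
  have [cv|cv] := boolP (c \in v); last by rewrite (count_memPn cv) !mul0r.
  congr (_ * _); apply: monom_sym; rewrite perm_cons perm_sym.
  exact: perm_to_rem.
have := R1 a b; have := R1 b a; rewrite /givens_der !mxE /= !monom_cons.
have [->|ka] := eqVneq k a.
  rewrite (negbTE ab) add1n add0n -natr1 !monom_cons => h1 h2.
  lra.
have [->|kb] := eqVneq k b.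
  rewrite add1n add0n -natr1 !monom_cons => h1 h2.
  lra.
by rewrite !add0n !monom_cons => _ _; ring.
Qed.

Lemma givens_dir_le1 x k : on_sphere x -> `|givens_dir x 0 k| <= 1.
Proof.
move=> x1; rewrite mxE; case: ifP => _; first by rewrite normrN sphere_coord_le1.
by case: ifP => _; rewrite ?normr0 ?sphere_coord_le1.
Qed.

Lemma givens_der_bound v x : on_sphere x -> `|givens_der v x| <= (size v)%:R.
Proof.
move=> x1; elim: v => [|k v IH].
  by rewrite /givens_der /= !mul0r subrr normr0.
rewrite givens_der_cons; apply: le_trans (ler_normD _ _) _.
rewrite !normrM /= -natr1 addrC lerD //.
  by rewrite -[leRHS]mul1r ler_pM // sphere_coord_le1.
by rewrite mulr_ile1 // ?givens_dir_le1 // monom_le1.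
Qed.

Lemma givens_taylor v : exists2 C : R, 0 <= C & forall t x, `|t| <= 1 -> on_sphere x ->
  `|monom v (x + t *: givens_dir x) - monom v x - t * givens_der v x| <= C * t ^+ 2.
Proof.
elim: v => [|k v [C C0 IH]].
  exists 0 => // t x _ _; rewrite /monom !big_nil /givens_der /= !mul0r subrr.
  by rewrite subrr mulr0 subr0 normr0.
exists (2 * C + (size v)%:R); first by rewrite addr_ge0 ?mulr_ge0.
move=> t x t1 x1; rewrite !monom_cons givens_der_cons.
set M := monom v x; set M' := monom v _; set D := givens_der v x.
set y := givens_dir x 0 k; set xk := x 0 k.
have -> : (x + t *: givens_dir x) 0 k = xk + t * y by rewrite mxE [X in _ + X]mxE.
have -> : (xk + t * y) * M' - xk * M - t * (y * M + xk * D) =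
    (xk + t * y) * (M' - M - t * D) + t ^+ 2 * (y * D) by ring.
apply: le_trans (ler_normD _ _) _; rewrite [leRHS]mulrDl lerD //.
  rewrite normrM -mulrA ler_pM //; last exact: IH.
  apply: le_trans (ler_normD _ _) _; rewrite normrM.
  have h1 := sphere_coord_le1 k x1; have h2 := givens_dir_le1 k x1.
  have h3 : `|t| * `|y| <= 1 by rewrite mulr_ile1.
  by rewrite -/xk in h1; lra.
rewrite normrM ger0_norm ?sqr_ge0 // mulrC ler_wpM2r ?sqr_ge0 // normrM.
rewrite -[leRHS]mul1r ler_pM // ?givens_dir_le1 //; exact: givens_der_bound.
Qed.

Lemma bm_givens_der v : bm (fun om => givens_der v (X om)).
Proof. by apply: bmB; apply: bmZ; exact: bm_monom. Qed.

Lemma bm_givens_monom t v : bm (fun om => monom v (X om + t *: givens_dir (X om))).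
Proof.
apply: bm_prod => k.
rewrite (_ : (fun _ => _) = fun om => X om 0 k + t * givens_dir (X om) 0 k); last first.
  by apply/funext => om; rewrite mxE [X in _ + X]mxE.
apply: bmD; first exact: bm_coord.
apply: bmZ; rewrite /givens_dir; under eq_fun do rewrite mxE.
case: (k == a).
  by under eq_fun do rewrite -mulN1r; apply: bmZ; exact: bm_coord.
by case: (k == b); [exact: bm_coord | exact: bm_cst].
Qed.

(** Undoing the scaling by [c] and using rotation invariance makes the expectation a function of
    [t^2]; [givens_der_Ex0] exploits this evenness. *)
Lemma givens_even t v :
  Ex P (fun om => monom v (X om + t *: givens_dir (X om))) =
  smom v * Num.sqrt (1 + t ^+ 2) ^+ (count_mem a v + count_mem b v).
Proof.
set m := (_ + _)%N; have t0 : 0 < 1 + t ^+ 2 by rewrite ltr_pwDl ?sqr_ge0.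
pose r := Num.sqrt (1 + t ^+ 2); have r0 : 0 < r by rewrite sqrtr_gt0.
have r2 : r ^+ 2 = 1 + t ^+ 2 by rewrite sqr_sqrtr // ltW.
pose c := r^-1; have cr : c * r = 1 by rewrite mulVf // lt0r_neq0.
have cs : c ^+ 2 + (t * c) ^+ 2 = 1.
  by rewrite exprMn -[X in X + _]mul1r -mulrDl -r2 -exprMn mulrC cr expr1n.
rewrite -(smom_rotate v (givens_mx_orth cs)) -/r mulrC -ExZ.
  apply: eq_Ex => om; rewrite givens_monom -/m mulrA -exprMn (mulrC r) cr.
  by rewrite expr1n mul1r.
have := bmZ (c ^+ m) (bm_givens_monom t v).
by congr bm; apply/funext => om; rewrite givens_monom.
Qed.

(** An even function has derivative 0 at 0: subtracting the expansions at [t] and [- t] leaves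
    [2 t D] against an error of order [t^2]. *)
Lemma givens_der_Ex0 v : Ex P (fun om => givens_der v (X om)) = 0.
Proof.
have [C C0 hC] := givens_taylor v.
apply/eqP; rewrite -normr_le0; apply/ler_addgt0Pr => e e0; rewrite add0r.
pose t := Num.min 1 (e / (C + 1)).
have C1 : 0 < C + 1 by lra.
have t0 : 0 < t by rewrite lt_min ltr01 divr_gt0.
have t1 : `|t| <= 1 by rewrite ger0_norm ?ge_min ?lexx // ltW.
have te : t * (C + 1) <= e by rewrite -ler_pdivlMr // ge_min lexx orbT.
have H u : `|u| <= 1 -> `|Ex P (fun om => monom v (X om + u *: givens_dir (X om))) -
    smom v - u * Ex P (fun om => givens_der v (X om))| <= C * u ^+ 2.
  move=> u1; rewrite -ExZ; last exact: bm_givens_der.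
  rewrite -ExB; [|exact: bm_givens_monom|exact: bm_monom].
  rewrite -ExB; [|by apply: bmB; [exact: bm_givens_monom|exact: bm_monom]|
    by apply: bmZ; exact: bm_givens_der].
  apply: Ex_norm; last by move=> om; apply: hC => //; exact: hX.2.1.
  apply: bmB; last by apply: bmZ; exact: bm_givens_der.
  by apply: bmB; [exact: bm_givens_monom|exact: bm_monom].
have := H t t1; have := H (- t); rewrite normrN => /(_ t1).
rewrite !givens_even sqrrN; set p := _ * _; set D := Ex _ _ => h1 h2.
have : `|2 * t * D| <= 2 * (C * t ^+ 2).
  have -> : 2 * t * D = (p - smom v - - t * D) - (p - smom v - t * D) by ring.
  apply: le_trans (ler_normB _ _) _; lra.
rewrite !normrM (ger0_norm (ltW t0)) ger0_norm // -!mulrA ler_pM2l // expr2 mulrCA ler_pM2l //.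
by move: te; rewrite mulrDr mulr1 mulrC; lra.
Qed.

Lemma smom_givens w :
  (1 + (count_mem b w)%:R) * smom (a :: w) = (count_mem a w)%:R * smom [:: b, b & rem a w].
Proof.
have := givens_der_Ex0 (b :: w).
have ba : b == a = false by rewrite eq_sym (negbTE ab).
rewrite /givens_der /= eqxx ba add0n ExB; last 2 first.
- by apply: bmZ; exact: bm_monom.
- by apply: bmZ; exact: bm_monom.
rewrite !ExZ; [|exact: bm_monom..].
by rewrite natrD => /eqP; rewrite subr_eq0 => /eqP.
Qed.

End Givens.

Lemma smom_sphere w : \sum_a smom [:: a, a & w] = smom w.
Proof.
rewrite -Ex_sum; last by move=> a; exact: bm_monom.
apply: eq_Ex => om; under eq_bigr do rewrite !monom_cons mulrA.
by rewrite -mulr_suml [X in X * _](hX.2.1 om) mul1r.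
Qed.

(** Sum [smom_givens] over all [b] other than [a]: the sphere equation collapses the moments [smom
    [:: b, b & rem a w]], and the missing term [b = a] is a multiple of the left side. *)
Lemma smom_ibp a w :
  (d%:R + (size w)%:R - 1) * smom (a :: w) = (count_mem a w)%:R * smom (rem a w).
Proof.
have h : \sum_(b | b != a) (1 + (count_mem b w)%:R) * smom (a :: w) =
    \sum_(b | b != a) (count_mem a w)%:R * smom [:: b, b & rem a w].
  by apply: eq_bigr => b ba; apply: smom_givens; rewrite eq_sym.
have sc : \sum_(b < d) (count_mem b w)%:R = (size w)%:R :> R.
  elim: w {h} => [|k w IH] /=; first by rewrite big1.
  under eq_bigr do rewrite natrD.
  rewrite big_split /= IH -natr1 addrC; congr (_ + _).
  rewrite (bigD1 k) //= eqxx big1 ?addr0 // => b.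
  by rewrite eq_sym => /negbTE ->.
have h1 : (\sum_(b | b != a) (1 + (count_mem b w)%:R)) =
    d%:R + (size w)%:R - 1 - (count_mem a w)%:R :> R.
  have : \sum_(b < d) (1 + (count_mem b w)%:R) = d%:R + (size w)%:R :> R.
    by rewrite big_split /= sumr_const card_ord sc.
  by rewrite (bigD1 a) //= => <-; ring.
have h2 : \sum_(b | b != a) smom [:: b, b & rem a w] =
    smom (rem a w) - smom [:: a, a & rem a w].
  by rewrite -(smom_sphere (rem a w)) [in RHS](bigD1 a) //= addrC addrK.
have h3 : (count_mem a w)%:R * smom [:: a, a & rem a w] = (count_mem a w)%:R * smom (a :: w).
  have [aw|aw] := boolP (a \in w); last by rewrite (count_memPn aw) !mul0r.
  congr (_ * _); apply: smom_perm; rewrite perm_cons perm_sym; exact: perm_to_rem.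
move: h; rewrite -mulr_suml h1 -mulr_sumr h2 mulrBr h3 => h.
by rewrite -[LHS](subrK ((count_mem a w)%:R * smom (a :: w))) -mulrBl h subrK.
Qed.

End SphereMoments.

(** [smom_ibp] expresses each moment through shorter ones; [1 < d] keeps its factor nonzero for the
    empty word. *)
Lemma smom_unique (R : realType) dO (Om : measurableType dO) (P : probability Om R)
    d (X Y : Om -> 'rV[R]_d) : (1 < d)%N ->
  uniform_sphere_rv P X -> uniform_sphere_rv P Y -> smom P X =1 smom P Y.
Proof.
move=> d0 hX hY w; have [n sn] : exists n, (size w <= n)%N by exists (size w).
elim: n w sn => [|n IH] w.
  by rewrite leqn0 => /nilP ->; rewrite !smom_nil.
case: w => [|a w]; first by rewrite !smom_nil.
rewrite /= ltnS => sn.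
have := smom_ibp hX a w; have := smom_ibp hY a w.
have [aw|aw] := boolP (a \in w).
  rewrite (IH (rem a w)); last by rewrite size_rem // (leq_trans (leq_pred _)).
  have c0 : d%:R + (size w)%:R - 1 != 0 :> R.
    have : (0 < size w)%N by case: (w) aw.
    rewrite -(ler_nat R) => w1; have : 1 <= d%:R :> R by rewrite ler1n ltnW.
    by move=> d1; apply/lt0r_neq0; lra.
  by move=> <- /(mulfI c0).
rewrite (count_memPn aw) !mul0r => h1 h2.
have c0 : d%:R + (size w)%:R - 1 != 0 :> R.
  have d1 : 2 <= d%:R :> R by rewrite ler_nat.
  have w0 : 0 <= (size w)%:R :> R by [].
  by apply/lt0r_neq0; lra.
move/eqP: h1; rewrite mulf_eq0 (negbTE c0) => /eqP ->.
by move/eqP: h2; rewrite mulf_eq0 (negbTE c0) => /eqP ->.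
Qed.

(** * Concentration *)

Section ExpBounds.
Variable R : realType.

Lemma expR_le_quadratic (z : R) : z <= 1 -> expR z <= 1 + z + 2 * z ^+ 2.
Proof.
move=> z1; have [z0|z0] := leP 0 z.
  have h := expR_ge1Dx (- (z / 2)).
  have h2 : (1 - z / 2) ^+ 2 <= expR (- z).
    have -> : - z = - (z / 2) + - (z / 2) by field.
    rewrite expRD -expr2; apply: lerXn2r; rewrite ?nnegrE ?expR_ge0 //; lra.
  have e0 := expR_gt0 z.
  have : expR z * (1 - z / 2) ^+ 2 <= 1.
    apply: (@le_trans _ _ (expR z * expR (- z))); first by rewrite ler_pM2l.
    by rewrite -expRD subrr expR0.
  have p : 0 <= z ^+ 2 * ((1 - z) * (5 / 2 - z)) by rewrite !mulr_ge0 ?sqr_ge0 //; lra.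
  have q0 : 0 < (1 - z / 2) ^+ 2 by rewrite exprn_gt0 //; lra.
  move=> h3; rewrite -(ler_pM2r q0); apply: le_trans h3 _.
  have -> : (1 + z + 2 * z ^+ 2) * (1 - z / 2) ^+ 2 =
    1 + z ^+ 2 * ((1 - z) * (5 / 2 - z)) / 2 by field.
  lra.
have h := expR_ge1Dx (- z); have e0 := expR_gt0 z.
have : expR z * (1 - z) <= 1.
  apply: (@le_trans _ _ (expR z * expR (- z))); first by rewrite ler_pM2l.
  by rewrite -expRD subrr expR0.
have q0 : 0 < 1 - z by lra.
move=> h3; rewrite -(ler_pM2r q0); apply: le_trans h3 _.
have : 0 <= z ^+ 2 * (1 - 2 * z) by rewrite mulr_ge0 ?sqr_ge0 //; lra.
lra.
Qed.

(* The linear term integrates to 0 against a centred variable, so each summand costs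
   only a factor in the quadratic exponent. *)
Lemma expR_le_id_sq (z : R) : expR z <= z + expR (2 * z ^+ 2).
Proof.
have [z1|z1] := leP z 1.
  apply: le_trans (expR_le_quadratic z1) _.
  by have := expR_ge1Dx (2 * z ^+ 2); lra.
have : expR z <= expR (2 * z ^+ 2) by rewrite ler_expR; nra.
by lra.
Qed.

End ExpBounds.

(** * Sums of independent bounded vectors *)

Section BoundedSums.
Context (R : realType) (dO : measure_display) (Om : measurableType dO)
  (P : probability Om R).
Variables (T : eqType) (r : seq T) (xi : nat -> T -> Om -> R) (b : R) (n : nat).
Variable G : nat -> set (set Om).

Definition adapted m (f : Om -> R) :=
  measurable_fun setT (f : g_sigma_algebraType (G m) -> R).

Hypothesis xi_bm : forall m a, bm (xi m a).
Hypothesis xi_bound : forall m om, \sum_(a <- r) xi m a om ^+ 2 <= b ^+ 2.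
Hypothesis xi_adapted : forall m j a, (j < m)%N -> (m <= n)%N -> adapted m (xi j a).
Hypothesis xi_indep : forall m a (B : Om -> R), (m < n)%N -> adapted m B -> bm B ->
  Ex P (fun om => B om * xi m a om) = 0.

Definition psum m a om : R := \sum_(j < m) xi j a om.
Definition psq m om : R := \sum_(a <- r) psum m a om ^+ 2.

Lemma bm_psum m a : bm (psum m a).
Proof. by apply: bm_sum => j; exact: xi_bm. Qed.

Lemma bm_psq m : bm (psq m).
Proof. by apply: bm_sum => a; apply: bmX; exact: bm_psum. Qed.

Lemma psq_ge0 m om : 0 <= psq m om.
Proof. by apply: sumr_ge0 => a _; exact: sqr_ge0. Qed.

Lemma bm_expR (f : Om -> R) : bm f -> bm (fun om => expR (f om)).
Proof.
move=> [mf [M hM]]; split; first exact: (measurableT_comp (@measurable_expR R) mf).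
exists (expR M) => om; rewrite ger0_norm ?expR_ge0 // ler_expR.
exact: le_trans (ler_norm _) (hM om).
Qed.

Lemma adapted_psum m a : (m <= n)%N -> adapted m (psum m a).
Proof.
move=> mn; rewrite /adapted /psum; apply: measurable_sum => j.
exact: xi_adapted.
Qed.

Lemma adapted_psq m : (m <= n)%N -> adapted m (psq m).
Proof.
move=> mn; rewrite /adapted /psq; apply: measurable_sum => a.
by apply: measurable_funX; exact: adapted_psum.
Qed.

Lemma psqS m om : psq m.+1 om = psq m om + \sum_(a <- r) xi m a om ^+ 2 +
  2 * \sum_(a <- r) psum m a om * xi m a om.
Proof.
rewrite /psq /psum mulr_sumr -!big_split /=; apply: eq_bigr => a _.
by rewrite big_ord_recr /=; ring.
Qed.

(** Adding one vector replaces [s] by [s + 8 s^2 b^2]: the cross term with the past has mean zero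
    and costs only its square, which Cauchy-Schwarz bounds by [b^2] times the previous sum. The
    condition [16 s m b^2 <= 1] survives the replacement, so the growth of [s] stays under
    control. *)
Lemma psq_mgf m (s : R) : (m <= n)%N -> 0 <= s -> 16 * s * m%:R * b ^+ 2 <= 1 ->
  Ex P (fun om => expR (s * psq m om)) <= expR (2 * s * m%:R * b ^+ 2).
Proof.
elim: m s => [|m IH] s mn s0 hs.
  rewrite mulr0 mul0r expR0 -[leRHS](Ex_cst P) le_eqVlt; apply/orP; left; apply/eqP.
  apply: eq_Ex => om; rewrite /psq big1 ?mulr0 ?expR0 // => a _.
  by rewrite /psum big_ord0 expr0n.
pose s' := s + 8 * s ^+ 2 * b ^+ 2.
have B2 : 0 <= b ^+ 2 by exact: sqr_ge0.
have m0 : 0 <= m%:R :> R by [].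
have s'0 : 0 <= s' by rewrite /s' addr_ge0 // mulr_ge0 // mulr_ge0 ?sqr_ge0.
pose c om := \sum_(a <- r) psum m a om * xi m a om.
have bc : bm c by apply: bm_sum => a; apply: bmM; [exact: bm_psum|exact: xi_bm].
have be t : bm (fun om => expR (t * psq m om)).
  by apply: bm_expR; apply: bmZ; exact: bm_psq.
have pt om : expR (s * psq m.+1 om) <=
    expR (s * b ^+ 2) * (2 * s * (expR (s * psq m om) * c om) + expR (s' * psq m om)).
  rewrite psqS -/(c om).
  have -> : s * (psq m om + \sum_(a <- r) xi m a om ^+ 2 + 2 * c om) =
    s * \sum_(a <- r) xi m a om ^+ 2 + (s * psq m om + 2 * s * c om) by ring.
  rewrite expRD ler_pM ?expR_ge0 //.
    by rewrite ler_expR ler_wpM2l ?xi_bound.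
  rewrite expRD.
  apply: (@le_trans _ _ (expR (s * psq m om) * (2 * s * c om + expR (2 * (2 * s * c om) ^+ 2)))).
    by rewrite ler_wpM2l ?expR_ge0 // expR_le_id_sq.
  rewrite mulrDr; apply: lerD; first by rewrite le_eqVlt; apply/orP; left; apply/eqP; ring.
  rewrite -expRD ler_expR /s' [leRHS]mulrDl lerD2l.
  have cs : c om ^+ 2 <= psq m om * b ^+ 2.
    by apply: le_trans (sum_CS _ _ _) _; rewrite ler_wpM2l ?psq_ge0 ?xi_bound.
  have -> : 2 * (2 * s * c om) ^+ 2 = 8 * s ^+ 2 * c om ^+ 2 by ring.
  have -> : 8 * s ^+ 2 * b ^+ 2 * psq m om = 8 * s ^+ 2 * (psq m om * b ^+ 2) by ring.
  by rewrite ler_wpM2l // mulr_ge0 ?sqr_ge0.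
have Ec : Ex P (fun om => expR (s * psq m om) * c om) = 0.
  have -> : Ex P (fun om => expR (s * psq m om) * c om) =
      Ex P (fun om => \sum_(a <- r) (expR (s * psq m om) * psum m a om) * xi m a om).
    by apply: eq_Ex => om; rewrite mulr_sumr; apply: eq_bigr => a _; rewrite mulrA.
  rewrite Ex_sum; last first.
    move=> a; apply: bmM; last exact: xi_bm.
    by apply: bmM; [exact: be | exact: bm_psum].
  apply: big1 => a _; apply: xi_indep => //; last by apply: bmM; [exact: be|exact: bm_psum].
  apply: measurable_funM; last by apply: adapted_psum; exact: ltnW.
  apply: (measurableT_comp (@measurable_expR R)).
  by apply: measurable_funM; [exact: measurable_cst | apply: adapted_psq; exact: ltnW].
apply: (@le_trans _ _ (expR (s * b ^+ 2) * Ex P (fun om => expR (s' * psq m om)))).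
  have b1 : bm (fun om => expR (s * psq m om) * c om) by apply: bmM.
  have -> : expR (s * b ^+ 2) * Ex P (fun om => expR (s' * psq m om)) =
      Ex P (fun om => expR (s * b ^+ 2) *
        (2 * s * (expR (s * psq m om) * c om) + expR (s' * psq m om))).
    rewrite ExZ; last by apply: bmD => //; exact: bmZ.
    rewrite ExD //; last exact: bmZ.
    by rewrite ExZ // Ec mulr0 add0r.
  apply: Ex_le => //.
    by apply: bm_expR; apply: bmZ; exact: bm_psq.
  by apply: bmZ; apply: bmD => //; exact: bmZ.
have q0 : 0 <= s * b ^+ 2 by rewrite mulr_ge0.
have IH' := IH s' (ltnW mn) s'0.
set p := s * b ^+ 2 in q0 *.
have e1 : s' = s * (1 + 8 * p) by rewrite /s' /p; ring.
have hs1 : 16 * p * (m%:R + 1) <= 1 by move: hs; rewrite -natr1 /p; lra.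
have e2 : 16 * s' * m%:R * b ^+ 2 = 16 * p * m%:R * (1 + 8 * p) by rewrite e1 /p; ring.
have h3 : 16 * s' * m%:R * b ^+ 2 <= 1 by rewrite e2; nra.
apply: le_trans (ler_wpM2l (expR_ge0 _) (IH' h3)) _.
rewrite -expRD ler_expR -(natr1 m).
have -> : 2 * s' * m%:R * b ^+ 2 = 2 * p * m%:R * (1 + 8 * p) by rewrite e1 /p; ring.
have -> : 2 * s * (m%:R + 1) * b ^+ 2 = 2 * p * (m%:R + 1) by rewrite /p; ring.
nra.
Qed.

Lemma psq_tail L : (0 < n)%N -> 0 < b ->
  (P [set om | (16 * n%:R * b ^+ 2 * L <= psq n om)%R] <= (2 * expR (- L))%:E)%E.
Proof.
move=> n0 b0; have n0' : 0 < n%:R :> R by rewrite ltr0n.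
(* The largest [s] that [psq_mgf] admits; its bound is then [exp (1/4 times 1/2)], which is below
   2. *)
pose s := (16 * n%:R * b ^+ 2)^-1.
have D0 : 0 < 16 * n%:R * b ^+ 2 by rewrite !mulr_gt0 ?exprn_gt0.
have s0 : 0 < s by rewrite invr_gt0.
have sD : s * (16 * n%:R * b ^+ 2) = 1 by rewrite mulVf // lt0r_neq0.
have := @psq_mgf n s (leqnn _) (ltW s0).
have -> : 16 * s * n%:R * b ^+ 2 = 1 by rewrite -[RHS]sD; clearbody s; ring.
move=> /(_ (lexx _)).
have -> : 2 * s * n%:R * b ^+ 2 = 8^-1 * (s * (16 * n%:R * b ^+ 2)) by field.
rewrite sD mulr1 => h.
have bf : bm (fun om => expR (s * psq n om)).
  by apply: bm_expR; apply: bmZ; exact: bm_psq.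
rewrite (_ : [set _ | _] = [set om | expR L <= expR (s * psq n om)]); last first.
  have E om : (16 * n%:R * b ^+ 2 * L <= psq n om) = (L <= s * psq n om).
    by rewrite -[LHS](ler_pM2l s0) mulrA sD mul1r.
  by apply/seteqP; split => om /=; rewrite ler_expR E.
apply: le_trans (Ex_markov P bf (fun om => expR_ge0 _) (expR_gt0 L)) _.
rewrite lee_fin -expRN ler_wpM2r ?expR_ge0 //; apply: le_trans h _.
by have := @expR_le_quadratic R 8^-1; lra.
Qed.

End BoundedSums.

(** * Independence of features and noise *)

Section SampleIndependence.
Context (R : realType) (dO : measure_display) (Om : measurableType dO)
  (P : probability Om R) (n d : nat)
  (X : 'I_n -> Om -> 'rV[R]_d) (w : 'I_n -> Om -> R).
Hypothesis hX : forall i, uniform_sphere_rv P (X i).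
Hypothesis mw : forall i, measurable_fun setT (w i).
Hypothesis hind : indep_sample P X w.

Definition evX (a : 'I_n -> 'rV[R]_d) : set Om :=
  [set om | forall i k, X i om 0 k <= a i 0 k].
Definition evW (J : {set 'I_n}) (b : 'I_n -> R) : set Om :=
  [set om | forall i, i \in J -> w i om <= b i].

(** The threshold 1 imposes nothing on the sphere, so it stands for a feature left free. The noise
    is unbounded and has no such threshold, hence [piW] omits indices instead. *)
Definition piX (I : pred 'I_n) : set (set Om) :=
  [set A | exists a, (forall i, ~~ I i -> a i = const_mx 1) /\ A = evX a].
Definition piW (J : {set 'I_n}) : set (set Om) :=
  [set A | exists (J' : {set 'I_n}) b, J' \subset J /\ A = evW J' b].

Let one (i : 'I_n) : 'rV[R]_d := const_mx 1.

Lemma le_set_measurable d1 (T : measurableType d1) (f : T -> R) c :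
  measurable_fun setT f -> measurable [set om | f om <= c].
Proof.
move=> mf; have := mf measurableT _ (@measurable_itv _ `]-oo, c]).
by rewrite setTI; congr measurable; apply/seteqP; split => x /=; rewrite in_itv.
Qed.

Lemma evX_measurable a : measurable (evX a).
Proof.
rewrite (_ : evX a = \bigcap_(i in [set: 'I_n]) \bigcap_(k in [set: 'I_d])
    [set om | X i om 0 k <= a i 0 k]).
  apply: fin_bigcap_measurable => // i _; apply: fin_bigcap_measurable => // k _.
  by apply: le_set_measurable; exact: (hX i).1.
by apply/seteqP; split => om h i => [_ k _|k]; apply: h.
Qed.

Lemma evW_measurable J b : measurable (evW J b).
Proof.
rewrite (_ : evW J b = \bigcap_(i in [set i | i \in J]) [set om | w i om <= b i]).
  by apply: fin_bigcap_measurable => // i _; exact: le_set_measurable.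
by apply/seteqP; split => om h i; apply: h.
Qed.

Lemma evX1 : evX one = setT.
Proof.
apply/seteqP; split => // om _ i k; rewrite mxE.
by apply: le_trans (ler_norm _) _; apply: sphere_coord_le1; exact: (hX i).2.1.
Qed.

Lemma evXI a b : evX a `&` evX b = evX (fun i => \row_k Num.min (a i 0 k) (b i 0 k)).
Proof.
apply/seteqP; split => om /= h => [i k|].
  by rewrite mxE le_min h.1 h.2.
by split => i k; have := h i k; rewrite mxE le_min => /andP[].
Qed.

(** [indep_sample] constrains every noise variable. One variable at a time is freed by sending its
    threshold to infinity on both sides. *)
Lemma indep_sub (J : {set 'I_n}) a b :
  P (evX a `&` evW J b) = (\prod_(i < n) P [set om | (forall k, X i om 0 k <= a i 0 k)%R] *
     \prod_(i in J) P [set om | (w i om <= b i)%R])%E.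
Proof.
have [m hm] : exists m, #|~: J| = m by exists #|~: J|.
elim: m J b hm => [|m IH] J b hm.
  have JT : J = [set: 'I_n]%SET.
    apply/setP => j; rewrite finset.inE; apply: contraT => jJ.
    have : (0 < #|~: J|)%N by apply/card_gt0P; exists j; rewrite finset.inE.
    by rewrite hm.
  rewrite JT; under [X in (_ * X)%E]eq_bigl do rewrite inE.
  rewrite -hind; congr (P _); apply/seteqP; split => om /= [h1 h2]; split => // i.
  by apply: h2; rewrite finset.inE.
have [j jJ] : exists j, j \notin J.
  have : (0 < #|~: J|)%N by rewrite hm.
  by move=> /card_gt0P[j]; rewrite inE => jJ; exists j.
pose bN (N : nat) i := if i == j then N%:R else b i.
have hJ : #|~: (j |: J)%SET| = m.
  have := cardsC (j |: J)%SET; have := cardsC J; rewrite cardsU1 jJ hm; lia.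
have E N := IH (j |: J)%SET (bN N) hJ.
set c := (\prod_(i < n) P [set om | (forall k, X i om 0 k <= a i 0 k)%R] *
     \prod_(i in J) P [set om | (w i om <= b i)%R])%E.
have cfin : c \is a fin_num.
  have pf (I : finType) (Q : pred I) (F : I -> set Om) : (forall i, measurable (F i)) ->
      (\prod_(i | Q i) P (F i))%E \is a fin_num.
    move=> mF; elim/big_ind: _ => // [u v hu hv|i _]; first exact: fin_numM.
    exact: fin_num_measure.
  rewrite /c fin_numM //; apply: pf => i; last exact: le_set_measurable.
  rewrite (_ : mkset _ = \bigcap_(k in [set: 'I_d]) [set om | X i om 0 k <= a i 0 k]).
    by apply: fin_bigcap_measurable => // k _; apply: le_set_measurable; exact: (hX i).1.
  by apply/seteqP; split => om /= h k; [move=> _; exact: h | exact: h].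
have EN N : P (evX a `&` evW (j |: J)%SET (bN N)) = (c * P [set om | (w j om <= N%:R)%R])%E.
  rewrite E big_setU1 //= /bN eqxx [X in (_ * X)%E]muleC muleA; congr (_ * _ * _)%E.
  apply: eq_bigr => i iJ; rewrite ifN //; apply: contraNneq jJ => <-.
  exact: iJ.
have L1 : P (evX a `&` evW (j |: J)%SET (bN N)) @[N --> \oo] --> P (evX a `&` evW J b).
  have U : \bigcup_N (evX a `&` evW (j |: J)%SET (bN N)) = evX a `&` evW J b.
    rewrite -setI_bigcupr; congr (_ `&` _); apply/seteqP; split => om.
      move=> [N _ h] i iJ; have := h i; rewrite inE iJ orbT => /(_ isT).
      by rewrite /bN ifN //; apply: contraNneq jJ => <-.
    move=> h; exists (Num.truncn `|w j om|).+1 => // i; rewrite finset.in_setU1 /bN.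
    case: eqVneq => [->|ij] /= hi; last exact: h.
    by apply: le_trans (ler_norm _) _; exact: ltW (truncnS_gt _).
  rewrite -U; apply: nondecreasing_cvg_mu.
  - by move=> N; apply: measurableI; [exact: evX_measurable | exact: evW_measurable].
  - apply: bigcupT_measurable => N.
    by apply: measurableI; [exact: evX_measurable | exact: evW_measurable].
  - move=> N N' NN; apply/subsetPset => om [h1 h2]; split => // i iJ.
    apply: le_trans (h2 i iJ) _; rewrite /bN; case: ifP => // _.
    by rewrite ler_nat.
have L2 : (c * P [set om | (w j om <= N%:R)%R])%E @[N --> \oo] --> (c * 1)%E.
  apply: cvgeZl => //.
  rewrite -(@probability_setT _ _ _ P).
  have U : \bigcup_N [set om | w j om <= N%:R] = setT.
    apply/seteqP; split => // om _; exists (Num.truncn `|w j om|).+1 => //=.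
    by apply: le_trans (ler_norm _) _; exact: ltW (truncnS_gt _).
  rewrite -U; apply: nondecreasing_cvg_mu.
  - by move=> N; exact: le_set_measurable.
  - by apply: bigcupT_measurable => N; exact: le_set_measurable.
  - move=> N N' NN; apply/subsetPset => om /= h.
    by apply: le_trans h _; rewrite ler_nat.
move: L1; under eq_fun do rewrite EN.
by move=> L1; have := cvg_unique _ L1 L2; rewrite mule1; apply.
Qed.

Lemma P_evX a : P (evX a) = (\prod_(i < n) P [set om | (forall k, X i om 0 k <= a i 0 k)%R])%E.
Proof.
have := indep_sub (finset.set0 : {set 'I_n}) a (fun=> 0).
rewrite big_set0 mule1 => <-; congr (P _).
by apply/seteqP; split => om => [h|[]//]; split => // i; rewrite inE.
Qed.

Lemma P_coord1 i : P [set om | forall k, X i om 0 k <= one i 0 k] = 1%E.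
Proof.
rewrite -(@probability_setT _ _ _ P); congr (P _); apply/seteqP; split => // om _ k.
rewrite mxE; apply: le_trans (ler_norm _) _.
by apply: sphere_coord_le1; exact: (hX i).2.1.
Qed.

Lemma P_evW J b : P (evW J b) = (\prod_(i in J) P [set om | (w i om <= b i)%R])%E.
Proof.
have := indep_sub J one b; rewrite evX1 setTI => ->.
by rewrite big1 ?mul1e // => i _; exact: P_coord1.
Qed.

Lemma piX_sub I : piX I `<=` measurable.
Proof. by move=> _ [a [_ ->]]; exact: evX_measurable. Qed.

Lemma piW_sub J : piW J `<=` measurable.
Proof. by move=> _ [J' [b [_ ->]]]; exact: evW_measurable. Qed.

Lemma piX_setI I : setI_closed (piX I).
Proof.
move=> _ _ [a [ha ->]] [b [hb ->]]; rewrite evXI; eexists; split; last by [].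
move=> i iI; apply/rowP => k; rewrite !mxE ha // hb // !mxE.
exact: minxx.
Qed.

Lemma piW_setI J : setI_closed (piW J).
Proof.
move=> _ _ [J1 [b1 [h1 ->]]] [J2 [b2 [h2 ->]]].
exists (J1 :|: J2)%SET, (fun i => if i \in J1 then
   (if i \in J2 then Num.min (b1 i) (b2 i) else b1 i) else b2 i).
split; first by rewrite finset.subUset h1 h2.
apply/seteqP; split => om /= => [[e1 e2] i|h].
  rewrite inE; case: ifP => [i1|_] /= => [|i2]; last exact: e2.
  by case: ifP => i2 _; rewrite ?le_min ?e1 ?e2.
split => i iJ; have := h i; rewrite inE iJ ?orbT => /(_ isT).
  by case: ifP => _ //; rewrite le_min => /andP[].
by case: ifP => // _; rewrite le_min => /andP[].
Qed.

Lemma piX_setT I : piX I setT.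
Proof. by exists one; rewrite evX1. Qed.

Lemma piW_setT J : piW J setT.
Proof.
exists finset.set0, (fun=> 0); split; first by rewrite finset.sub0set.
by apply/seteqP; split => // om _ i; rewrite inE.
Qed.

Lemma piX_coord_measurable (I : pred 'I_n) i k : I i ->
  measurable_fun setT ((fun om => X i om 0 k) : g_sigma_algebraType (piX I) -> R).
Proof.
move=> Ii; apply: measurable_fun_le_set => c; apply: sub_sigma_algebra.
exists (fun j => if j == i then \row_l (if l == k then c else 1) else one j).
split; first by move=> j jI; case: eqVneq => // ji; rewrite ji Ii in jI.
apply/seteqP; split => om /= h => [j l|].
  have le1 : X j om 0 l <= 1.
    by apply: le_trans (ler_norm _) _; apply: sphere_coord_le1; exact: (hX j).2.1.
  case: eqVneq => [->|_]; rewrite !mxE //; case: eqVneq => [->//|_].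
  by apply: le_trans (ler_norm _) _; apply: sphere_coord_le1; exact: (hX i).2.1.
by have := h i k; rewrite eqxx mxE eqxx.
Qed.

Lemma piW_measurable (J : {set 'I_n}) i : i \in J ->
  measurable_fun setT (w i : g_sigma_algebraType (piW J) -> R).
Proof.
move=> iJ; apply: measurable_fun_le_set => c; apply: sub_sigma_algebra.
exists [set i]%SET, (fun=> c); split; first by rewrite finset.sub1set.
apply/seteqP; split => om /= h => [j|]; first by rewrite inE => /eqP ->.
by apply: h; rewrite inE.
Qed.

Lemma piX_indep (I1 I2 : pred 'I_n) A B : (forall i, ~~ (I1 i && I2 i)) ->
  piX I1 A -> piX I2 B -> P (A `&` B) = (P A * P B)%E.
Proof.
move=> dis [a [ha ->]] [b [hb ->]]; rewrite evXI !P_evX -big_split /=.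
apply: eq_bigr => i _.
have [i1|i1] := boolP (I1 i).
  have i2 : ~~ I2 i by have := dis i; rewrite i1.
  rewrite (hb i i2) P_coord1 mule1; congr (P _); apply/seteqP; split => om /= h k.
    by have := h k; rewrite mxE le_min => /andP[].
  rewrite mxE le_min h mxE.
  by apply: le_trans (ler_norm _) _; apply: sphere_coord_le1; exact: (hX i).2.1.
rewrite (ha i i1) P_coord1 mul1e; congr (P _); apply/seteqP; split => om /= h k.
  by have := h k; rewrite mxE le_min => /andP[].
rewrite mxE le_min h mxE andbT.
by apply: le_trans (ler_norm _) _; apply: sphere_coord_le1; exact: (hX i).2.1.
Qed.

Lemma piXW_indep I J A B : piX I A -> piW J B -> P (A `&` B) = (P A * P B)%E.
Proof. by move=> [a [_ ->]] [J' [b [_ ->]]]; rewrite indep_sub P_evX P_evW. Qed.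

Lemma piW_indep (J1 J2 : {set 'I_n}) A B : (forall i, ~~ ((i \in J1) && (i \in J2))) ->
  piW J1 A -> piW J2 B -> P (A `&` B) = (P A * P B)%E.
Proof.
move=> dis [J1' [b1 [h1 ->]]] [J2' [b2 [h2 ->]]].
have d' i : i \in J2' -> (i \in J1') = false.
  move=> i2; apply: contraNF (dis i) => i1.
  by rewrite (fintype.subsetP h1 _ i1) (fintype.subsetP h2 _ i2).
have -> : evW J1' b1 `&` evW J2' b2 =
    evW (J1' :|: J2')%SET (fun i => if i \in J1' then b1 i else b2 i).
  apply/seteqP; split => om /= => [[e1 e2] i|h].
    by rewrite inE; case: ifP => [i1 _|_] /=; [exact: e1 | exact: e2].
  split => i iJ; have := h i; rewrite inE iJ ?orbT => /(_ isT) //.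
  by rewrite (d' _ iJ).
rewrite !P_evW (bigID (mem J1')) /=; congr (_ * _)%E.
  apply: eq_big => i; last by case/andP => _ ->.
  by rewrite finset.inE andbC; case: (i \in J1').
apply: eq_big => i; last by case/andP => _ /negbTE ->.
rewrite finset.inE; case: (boolP (i \in J2')) => [/d' ->//|].
by case: (i \in J1').
Qed.

End SampleIndependence.

(** * Quadratic forms in the noise *)

Section GaussianMixing.
Variable R : realType.
Local Notation mu := (@lebesgue_measure R).
Local Notation phi := (normal_pdf (0 : R) 1).

Lemma eq_ler (x y : R) : x = y -> x <= y.
Proof. by move=> ->. Qed.

(** Completing the square: the integrand is a multiple of the normal density with mean [v b] and
    variance [v = 1 / (1 - a)]. *)
Lemma gauss_quad_mgf (a b : R) : a < 1 ->
  (\int[mu]_g (expR (b * g + a * g ^+ 2 / 2) * phi g)%:E =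
   (Num.sqrt (1 - a)^-1 * expR ((1 - a)^-1 * b ^+ 2 / 2))%:E)%E.
Proof.
move=> a1; pose v := (1 - a)^-1; have c0 : 0 < 1 - a by rewrite subr_gt0.
have v0 : 0 < v by rewrite invr_gt0.
pose s := Num.sqrt v; have s0 : 0 < s by rewrite sqrtr_gt0.
have s2 : s ^+ 2 = v by rewrite sqr_sqrtr // ltW.
have E g : expR (b * g + a * g ^+ 2 / 2) * phi g =
    s * expR (v * b ^+ 2 / 2) * normal_pdf (v * b) s g.
  rewrite !normal_pdfE ?oner_eq0 ?lt0r_neq0 //.
  rewrite /normal_peak /normal_fun s2.
  have -> : Num.sqrt (1 ^+ 2 * pi *+ 2) = Num.sqrt (pi *+ 2) :> R by rewrite expr1n mul1r.
  have -> : Num.sqrt (v * pi *+ 2) = s * Num.sqrt (pi *+ 2).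
    by rewrite -mulrnAr sqrtrM // ltW.
  rewrite invfM; set K := (Num.sqrt (pi *+ 2))^-1.
  rewrite [LHS]mulrCA -expRD.
  have -> u e' : s * u * (s^-1 * K * e' : R) = K * (u * e') :> R.
    by rewrite -!mulrA (mulrCA K) mulrCA (mulrCA u) (mulVKf (lt0r_neq0 s0)) mulrCA.
  rewrite -expRD; congr (_ * _); congr expR.
  rewrite expr1n -(mulr_natr 1) -(mulr_natr v) mul1r subr0 /v.
  have := lt0r_neq0 c0; move: (1 - a) (subKr 1 a) => c <- h; field.
  exact: h.
under eq_integral do rewrite E EFinM.
rewrite integralZl //; last exact: integrable_normal_pdf.
by rewrite integral_normal_pdf mule1.
Qed.

Lemma sqrt_inv_le_expR (x : R) : 0 <= x <= 1 / 2 -> Num.sqrt (1 - x)^-1 <= expR x.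
Proof.
move=> /andP[x0 x1]; have c0 : 0 < 1 - x by lra.
have e0 := expR_gt0 x.
rewrite -[leRHS](ger0_norm (ltW e0)) -sqrtr_sqr ler_wsqrtr //.
have h : 1 <= (1 - x) * expR x ^+ 2.
  have h1 := expR_ge1Dx x.
  have h2 : (1 + x) ^+ 2 <= expR x ^+ 2 by apply: lerXn2r; rewrite ?nnegrE ?expR_ge0 //; lra.
  have h3 : 0 <= (1 - x) * (expR x ^+ 2 - (1 + x) ^+ 2) by rewrite mulr_ge0 ?subr_ge0 //; lra.
  have h4 : 0 <= x * (1 - x * (1 + x)) by rewrite mulr_ge0 //; nra.
  have -> : (1 - x) * expR x ^+ 2 = 1 + x * (1 - x * (1 + x)) +
     (1 - x) * (expR x ^+ 2 - (1 + x) ^+ 2) by ring.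
  lra.
by rewrite -[leLHS]mul1r ler_pdivrMr // mulrC.
Qed.

End GaussianMixing.

Section NoiseMgf.
Context (R : realType) (dO : measure_display) (Om : measurableType dO)
  (P : probability Om R).

(** The random elements are the identity into two sub-sigma-algebras, so the splitting applies to
    any nonnegative integrand that is measurable for their product. *)
Lemma indep_integral_id (G1 G2 : set (set Om)) (f : Om -> Om -> \bar R) :
  G1 `<=` measurable -> setI_closed G1 -> G1 setT ->
  G2 `<=` measurable -> setI_closed G2 -> G2 setT ->
  (forall A B, G1 A -> G2 B -> P (A `&` B) = (P A * P B)%E) ->
  measurable_fun [set: (g_sigma_algebraType G1 * g_sigma_algebraType G2)%type]
    (fun z => f z.1 z.2) ->
  (forall x y, (0 <= f x y)%E) ->
  (\int[P]_om f om om = \int[P]_om \int[P]_om' f om om')%E.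
Proof.
move=> mG1 IG1 TG1 mG2 IG2 TG2 h mf f0.
have m1 : measurable_fun setT (id : Om -> g_sigma_algebraType G1).
  by move=> _ A mA; rewrite setTI; exact: (sigma_sub_measurable mG1).
have m2 : measurable_fun setT (id : Om -> g_sigma_algebraType G2).
  by move=> _ A mA; rewrite setTI; exact: (sigma_sub_measurable mG2).
pose X1 : {mfun Om >-> g_sigma_algebraType G1} :=
  HB.pack (id : Om -> g_sigma_algebraType G1) (isMeasurableFun.Build _ _ _ _ _ m1).
pose X2 : {mfun Om >-> g_sigma_algebraType G2} :=
  HB.pack (id : Om -> g_sigma_algebraType G2) (isMeasurableFun.Build _ _ _ _ _ m2).
by have := @indep_integral R dO Om P _ _ (g_sigma_algebraType G1) (g_sigma_algebraType G2) G1 G2 X1 X2 (fun z => f z.1 z.2)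
  erefl IG1 TG1 erefl IG2 TG2 h mf (fun z => f0 _ _).
Qed.

Variables (n d : nat) (X : 'I_n -> Om -> 'rV[R]_d) (w : 'I_n -> Om -> R) (s0 : R).
Hypothesis hX : forall i, uniform_sphere_rv P (X i).
Hypothesis hw : noise_model P w s0.
Hypothesis hind : indep_sample P X w.

Let mw i : measurable_fun setT (w i). Proof. exact: hw.1. Qed.

Lemma noise_lin_mgf (J : {set 'I_n}) (u : 'I_n -> R) :
  (\int[P]_om (expR (\sum_(i in J) u i * w i om))%:E <=
   (expR (s0 ^+ 2 / 2 * \sum_(i in J) u i ^+ 2))%:E)%E.
Proof.
have [m hm] : exists m, #|J| = m by exists #|J|.
elim: m J hm => [|m IH] J hm.
  move/cards0_eq: hm => ->.
  under eq_integral do rewrite big_set0 expR0.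
  rewrite big_set0 mulr0 expR0 integral_cst // mul1e.
  exact: probability_le1.
have [j jJ] : exists j, j \in J by apply/card_gt0P; rewrite hm.
have hJ : #|(J :\ j)%SET| = m by have := cardsD1 j J; rewrite jJ hm; lia.
pose f om om' := (expR (\sum_(i in (J :\ j)%SET) u i * w i om) * expR (u j * w j om'))%:E.
have -> : (\int[P]_om (expR (\sum_(i in J) u i * w i om))%:E = \int[P]_om f om om)%E.
  apply: eq_integral => om _; rewrite /f -expRD; congr (expR _)%:E.
  by rewrite (big_setD1 j) //= addrC.
rewrite (@indep_integral_id (piW w (J :\ j)%SET) (piW w [set j]%SET)); last 9 first.
- exact: (piW_sub mw).
- exact: piW_setI.
- exact: piW_setT.
- exact: (piW_sub mw).
- exact: piW_setI.
- exact: piW_setT.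
- move=> A B hA hB; apply: (piW_indep hX mw hind _ hA hB) => i.
  by rewrite !finset.inE; case: (i == j); rewrite ?andbF.
- have m1 i : i \in (J :\ j)%SET -> measurable_fun setT (fun z : (g_sigma_algebraType (piW w (J :\ j)%SET)
      * g_sigma_algebraType (piW w [set j]%SET))%type => w i z.1).
    move=> hi; apply: (measurableT_comp (piW_measurable hi)); exact: measurable_fst.
  have m2 : measurable_fun setT (fun z : (g_sigma_algebraType (piW w (J :\ j)%SET)
      * g_sigma_algebraType (piW w [set j]%SET))%type => w j z.2).
    apply: (measurableT_comp (@piW_measurable _ _ _ _ w [set j]%SET j _)).
      by rewrite finset.inE.
    exact: measurable_snd.
  apply/measurable_EFinP/measurable_funM.
    apply: (measurableT_comp (@measurable_expR R)).
    under eq_fun do rewrite big_mkcond /=.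
    apply: measurable_sum => i; have [hi|hi] := boolP (i \in (J :\ j)%SET).
      by apply: measurable_funM; [exact: measurable_cst | exact: m1].
    exact: measurable_cst.
  apply: (measurableT_comp (@measurable_expR R)).
  by apply: measurable_funM; [exact: measurable_cst | exact: m2].
- by move=> x y; rewrite lee_fin mulr_ge0 ?expR_ge0.
have msum : measurable_fun setT (fun om => (expR (\sum_(i in (J :\ j)%SET) u i * w i om))%:E).
  apply/measurable_EFinP; apply: (measurableT_comp (@measurable_expR R)).
  under eq_fun do rewrite big_mkcond /=.
  apply: measurable_sum => i.
  have [hi|hi] := boolP (i \in (J :\ j)%SET); last exact: measurable_cst.
  by apply: measurable_funM; [exact: measurable_cst | exact: mw].
have inner om : (\int[P]_om' f om om' = (expR (\sum_(i in (J :\ j)%SET) u i * w i om))%:E *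
    \int[P]_om' (expR (u j * w j om'))%:E)%E.
  rewrite /f; under eq_integral do rewrite EFinM.
  rewrite ge0_integralZl_EFin ?expR_ge0 //.
  apply/measurable_EFinP; apply: (measurableT_comp (@measurable_expR R)).
  by apply: measurable_funM; [exact: measurable_cst | exact: mw].
under eq_integral do rewrite inner.
have I0 : (0 <= \int[P]_om' (expR (u j * w j om'))%:E)%E.
  by apply: integral_ge0 => om _; rewrite lee_fin expR_ge0.
rewrite ge0_integralZr //.
apply: le_trans (lee_wpmul2r I0 (IH _ hJ)) _.
apply: le_trans (lee_wpmul2l _ (hw.2.2.2.1 j (u j))) _; first by rewrite lee_fin expR_ge0.
rewrite -EFinM -expRD lee_fin ler_expR [leRHS](_ : _ = s0 ^+ 2 / 2 * (u j ^+ 2 + \sum_(i in (J :\ j)%SET) u i ^+ 2)).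
  by apply: eq_ler; ring.
by rewrite (big_setD1 j).
Qed.

Let wv om : 'cV[R]_n := \col_i w i om.

Lemma noise_coef_measurable (U : 'M[R]_n) k : measurable_fun setT (fun om => coef U (wv om) k).
Proof.
under eq_fun do rewrite /coef mxE.
apply: measurable_sum => i; under eq_fun do rewrite !mxE.
by apply: measurable_funM; [exact: measurable_cst | exact: mw].
Qed.

(* Induction on the number of squares: each square is linearised through
   exp (x ^ 2 / 2) = E_g exp (g x) with g standard Gaussian. *)
Lemma noise_quad_mgf_aux (U : 'M[R]_n) (al : 'I_n -> R) (v := fun k => (1 - s0 ^+ 2 * al k)^-1) m
    (z : 'I_n -> R) : U *m U^T = 1%:M -> (forall k, 0 <= al k) ->
  (forall k, s0 ^+ 2 * al k < 1) -> (m <= n)%N ->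
  (\int[P]_om (expR (2^-1 * (\sum_(k : 'I_n | (k < m)%N) al k * coef U (wv om) k ^+ 2)
      + \sum_k z k * coef U (wv om) k))%:E <=
   ((\prod_(k : 'I_n | (k < m)%N) Num.sqrt (v k)) *
    expR (s0 ^+ 2 / 2 * \sum_(k : 'I_n) (if (k < m)%N then v k else 1) * z k ^+ 2))%:E)%E.
Proof.
move=> hU al0 al1; elim: m z => [|m IH] z mn.
  rewrite big_pred0_eq mul1r.
  pose u := U *m \col_k z k.
  have E om : \sum_k z k * coef U (wv om) k = \sum_(i in [set: 'I_n]%SET) u i 0 * w i om.
    under [RHS]eq_bigl do rewrite finset.inE.
    transitivity (dotv u (wv om)).
      by rewrite (dotv_coef hU); apply: eq_bigr => k _; rewrite (coef_col hU) mxE.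
    by rewrite dotvE; apply: eq_bigr => i _; rewrite [wv om _ _]mxE.
  under eq_integral do rewrite big_pred0_eq mulr0 add0r E.
  apply: le_trans (noise_lin_mgf _ _) _; rewrite lee_fin ler_expR ler_wpM2l //.
    by rewrite divr_ge0 ?sqr_ge0.
  under eq_bigl do rewrite finset.inE.
  rewrite -/(sqn u) (sqn_coef hU); apply: eq_ler; apply: eq_bigr => k _.
  by rewrite (coef_col hU) mxE mul1r.
(* Linearizing the square of index [j] adds [g y] to its linear coefficient; this is why the
   statement carries an arbitrary [z]. *)
pose j := Ordinal mn; pose y := Num.sqrt (al j).
have y2 : y ^+ 2 = al j by rewrite sqr_sqrtr.
pose z' (g : R) k := if k == j then z k + g * y else z k.
pose A om := 2^-1 * (\sum_(k : 'I_n | (k < m)%N) al k * coef U (wv om) k ^+ 2).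
have sumS (f : 'I_n -> R) : \sum_(k : 'I_n | (k < m.+1)%N) f k = f j + \sum_(k : 'I_n | (k < m)%N) f k.
  rewrite (bigD1 j) //=; congr (_ + _); apply: eq_bigl => k.
  by rewrite ltnS -val_eqE /= ltn_neqAle andbC.
have sumz g om : \sum_k z' g k * coef U (wv om) k =
    \sum_k z k * coef U (wv om) k + g * (y * coef U (wv om) j).
  rewrite (bigD1 j) //= [in RHS](bigD1 j) //= /z' eqxx.
  under eq_bigr => k kj do rewrite (negbTE kj).
  ring.
pose f (p : Om * R) := (expR (A p.1 + \sum_k z' p.2 k * coef U (wv p.1) k) * normal_pdf 0 1 p.2)%:E.
have E om : (expR (2^-1 * (\sum_(k : 'I_n | (k < m.+1)%N) al k * coef U (wv om) k ^+ 2)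
      + \sum_k z k * coef U (wv om) k))%:E = (\int[lebesgue_measure]_g f (om, g))%E.
  have -> : (\int[lebesgue_measure]_g f (om, g) =
     \int[lebesgue_measure]_g ((expR (A om + \sum_k z k * coef U (wv om) k))%:E *
       (expR (y * coef U (wv om) j * g + 0 * g ^+ 2 / 2) * normal_pdf 0 1 g)%:E))%E.
    apply: eq_integral => g _; rewrite /f /= sumz -EFinM [in RHS]mulrA -[in RHS]expRD.
    by congr (expR _ * _)%:E; ring.
  rewrite ge0_integralZl_EFin ?expR_ge0 //; last 2 first.
  - by move=> g _; rewrite lee_fin mulr_ge0 ?expR_ge0 ?normal_pdf_ge0.
  - apply/measurable_EFinP/measurable_funM; last exact: measurable_normal_pdf.
    apply: (measurableT_comp (@measurable_expR R)); apply: measurable_funD.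
      by apply: measurable_funM; [exact: measurable_cst|].
    by under eq_fun do rewrite !mul0r; exact: measurable_cst.
  rewrite gauss_quad_mgf // subr0 invr1 sqrtr1 !mul1r -EFinM -expRD; congr (expR _)%:E.
  by rewrite sumS /A exprMn y2; field.
under eq_integral do rewrite E.
have mf : measurable_fun setT f.
  apply/measurable_EFinP/measurable_funM; last first.
    by apply: (measurableT_comp (@measurable_normal_pdf R 0 1)); exact: measurable_snd.
  apply: (measurableT_comp (@measurable_expR R)).
  have mc k : measurable_fun setT (fun p : Om * R => coef U (wv p.1) k).
    by apply: (measurableT_comp (noise_coef_measurable U k)); exact: measurable_fst.
  apply: measurable_funD.
    rewrite /A; apply: measurable_funM; first exact: measurable_cst.
    under eq_fun do rewrite big_mkcond /=.
    apply: measurable_sum => k; case: (k < m)%N; last exact: measurable_cst.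
    by apply: measurable_funM; [exact: measurable_cst | apply: measurable_funX].
  apply: measurable_sum => k; apply: measurable_funM => //.
  rewrite /z'; case: (k == j); last exact: measurable_cst.
  apply: measurable_funD; first exact: measurable_cst.
  by apply: measurable_funM; [exact: measurable_snd | exact: measurable_cst].
rewrite (@fubini_tonelli _ _ _ _ R P (@lebesgue_measure R) f) //; last first.
  by move=> p; rewrite lee_fin mulr_ge0 ?expR_ge0 ?normal_pdf_ge0.
pose V := \prod_(k : 'I_n | (k < m)%N) Num.sqrt (v k).
pose Z := \sum_(k : 'I_n) (if (k < m)%N then v k else 1) * z k ^+ 2.
have V0 : 0 <= V by apply: prodr_ge0 => k _; exact: sqrtr_ge0.
have sumz' g : \sum_(k : 'I_n) (if (k < m)%N then v k else 1) * z' g k ^+ 2 =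
    Z + 2 * g * y * z j + g ^+ 2 * al j.
  rewrite /Z (bigD1 j) //= [in RHS](bigD1 j) //= /z' eqxx ltnn.
  under eq_bigr => k kj do rewrite (negbTE kj).
  by rewrite -y2; ring.
pose a := s0 ^+ 2 * al j.
apply: (@le_trans _ _ (\int[lebesgue_measure]_g ((V * expR (s0 ^+ 2 / 2 * Z))%:E *
   (expR (s0 ^+ 2 * y * z j * g + a * g ^+ 2 / 2) * normal_pdf 0 1 g)%:E))%E).
  apply: ge0_le_integral => //.
  - move=> g _; apply: integral_ge0 => om _.
    by rewrite lee_fin mulr_ge0 ?expR_ge0 ?normal_pdf_ge0.
  - apply: (@measurable_fun_fubini_tonelli_G _ _ _ _ _ P f) => // p.
    by rewrite lee_fin mulr_ge0 ?expR_ge0 ?normal_pdf_ge0.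
  - apply: emeasurable_funM; first exact: measurable_cst.
    apply/measurable_EFinP/measurable_funM; last exact: measurable_normal_pdf.
    apply: (measurableT_comp (@measurable_expR R)); apply: measurable_funD.
      by apply: measurable_funM; [exact: measurable_cst|].
    apply: measurable_funM; last exact: measurable_cst.
    by apply: measurable_funM; [exact: measurable_cst| apply: measurable_funX].
  move=> g _; rewrite /f; under eq_integral do rewrite /= [X in X%:E]mulrC EFinM.
  rewrite ge0_integralZl_EFin ?normal_pdf_ge0 //; last first.
    apply/measurable_EFinP; apply: (measurableT_comp (@measurable_expR R)).
    apply: measurable_funD.
      rewrite /A; apply: measurable_funM; first exact: measurable_cst.
      under eq_fun do rewrite big_mkcond /=.
      apply: measurable_sum => k; case: (k < m)%N; last exact: measurable_cst.
      apply: measurable_funM; first exact: measurable_cst.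
      by apply: measurable_funX; exact: noise_coef_measurable.
    apply: measurable_sum => k; apply: measurable_funM; first exact: measurable_cst.
    exact: noise_coef_measurable.
  apply: le_trans (lee_wpmul2l _ (IH (z' g) (ltnW mn))) _; first by rewrite lee_fin normal_pdf_ge0.
  rewrite -!EFinM lee_fin -/V sumz'; apply: eq_ler.
  rewrite [in RHS]mulrA -(mulrA V) -expRD mulrC; congr (V * expR _ * _).
  by rewrite /a; field.
rewrite ge0_integralZl_EFin ?mulr_ge0 ?expR_ge0 //; last 2 first.
- by move=> g _; rewrite lee_fin mulr_ge0 ?expR_ge0 ?normal_pdf_ge0.
- apply/measurable_EFinP/measurable_funM; last exact: measurable_normal_pdf.
  apply: (measurableT_comp (@measurable_expR R)); apply: measurable_funD.
    by apply: measurable_funM; [exact: measurable_cst|].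
  apply: measurable_funM; last exact: measurable_cst.
  by apply: measurable_funM; [exact: measurable_cst| apply: measurable_funX].
(* The remaining integral over [g] has quadratic coefficient [a = s0^2 al_j < 1]; it supplies the
   factor [sqrt (v j)] and turns the weight of [z_j^2] from 1 into [v j]. *)
rewrite gauss_quad_mgf ?al1 // -EFinM lee_fin.
rewrite [in leRHS](bigD1 j) //=.
have -> : \prod_(k : 'I_n | (k < m.+1)%N && (k != j)) Num.sqrt (v k) = V.
  by apply: eq_bigl => k; rewrite ltnS -val_eqE /= ltn_neqAle andbC.
rewrite -/a -/(v j) mulrACA (mulrC V) -expRD ler_wpM2l ?mulr_ge0 ?sqrtr_ge0 //.
rewrite ler_expR.
have -> : \sum_(k : 'I_n) (if (k < m.+1)%N then v k else 1) * z k ^+ 2 = Z + (v j - 1) * z j ^+ 2.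
  rewrite /Z (bigD1 j) //= [in RHS](bigD1 j) //= ltnn ltnSn.
  have -> : \sum_(k < n | k != j) (if (k < m.+1)%N then v k else 1) * z k ^+ 2 =
     \sum_(k < n | k != j) (if (k < m)%N then v k else 1) * z k ^+ 2.
    by apply: eq_bigr => k; rewrite -val_eqE /= => kj; rewrite ltnS leq_eqVlt (negbTE kj).
  ring.
have c0 : 1 - a != 0 by rewrite subr_eq0 eq_sym lt_eqF // al1.
have -> : v j = (1 - a)^-1 by [].
apply: eq_ler; rewrite !exprMn y2 /a; move: c0; rewrite /a => c0; field.
exact: c0.
Qed.

Lemma noise_quad_mgf (U : 'M[R]_n) (al : 'I_n -> R) : U *m U^T = 1%:M ->
  (forall k, 0 <= al k) -> (forall k, s0 ^+ 2 * al k <= 1 / 2) ->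
  (\int[P]_om (expR (2^-1 * \sum_k al k * coef U (wv om) k ^+ 2))%:E <=
    (expR (s0 ^+ 2 * \sum_k al k))%:E)%E.
Proof.
move=> hU al0 al1.
have := @noise_quad_mgf_aux U al n (fun=> 0) hU al0 _ (leqnn n).
have -> : (\int[P]_om (expR (2^-1 * (\sum_(k : 'I_n | (k < n)%N) al k * coef U (wv om) k ^+ 2)
    + \sum_(k : 'I_n) 0 * coef U (wv om) k))%:E =
    \int[P]_om (expR (2^-1 * \sum_k al k * coef U (wv om) k ^+ 2))%:E)%E.
  apply: eq_integral => om _; rewrite [X in _ + X]big1 ?addr0; last by move=> *; rewrite mul0r.
  by congr (expR (_ * _))%:E; apply: eq_bigl => k; rewrite ltn_ord.
move=> h; apply: le_trans (h _) _; first by move=> k; apply: le_lt_trans (al1 k) _; lra.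
rewrite lee_fin [X in _ * expR (_ * X)]big1; last by move=> k _; rewrite expr0n mulr0.
rewrite mulr0 expR0 mulr1 mulr_sumr expR_sum.
rewrite [leLHS](eq_bigl xpredT); last by move=> k; rewrite ltn_ord.
apply: ler_prod => k _; rewrite sqrtr_ge0 sqrt_inv_le_expR // al1 mulr_ge0 ?sqr_ge0 //.
Qed.

(** Given the features, [H] is a fixed matrix, and Markov applies to the exponential of its
    quadratic form. [U] and [f] are asked for at each outcome separately; measurability is asked of
    [H] itself. *)
Lemma noise_quad_tail (H : Om -> 'M[R]_n) (T y : R) :
  (forall i j, measurable_fun setT ((fun om => H om i j) : g_sigma_algebraType (piX X predT) -> R)) ->
  0 < s0 ->
  (forall om, exists U f, [/\ U *m U^T = 1%:M, H om = spec_mx U f,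
     forall k, 0 <= f k <= 1 & \sum_k f k ^+ 2 <= T]) ->
  (P [set om | (4 * s0 ^+ 2 * y <= sqn (H om *m wv om))%R] <= (expR (T / 2 - y))%:E)%E.
Proof.
(* This [s] gives [s0^2 (2 s f^2) = f^2 / 2], within the limit 1/2 of [noise_quad_mgf] because
   [f <= 1]. *)
move=> mH s00 hH; pose s := (4 * s0 ^+ 2)^-1.
have s2 : 0 < 4 * s0 ^+ 2 by rewrite mulr_gt0 ?exprn_gt0.
have sp : 0 < s by rewrite invr_gt0.
pose f om om' := (expR (s * sqn (H om *m wv om')))%:E.
have f0 om om' : (0 <= f om om')%E by rewrite lee_fin expR_ge0.
have inner om : (\int[P]_om' f om om' <= (expR (T / 2))%:E)%E.
  have [U [h [hU eH h01 hT]]] := hH om.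
  have h2 k : 0 <= h k ^+ 2 <= 1.
    by rewrite sqr_ge0 /= expr_le1 //; case/andP: (h01 k).
  have e k : s0 ^+ 2 * (2 * s * h k ^+ 2) = h k ^+ 2 / 2.
    by rewrite /s; field; exact: lt0r_neq0.
  have := @noise_quad_mgf U (fun k => 2 * s * h k ^+ 2) hU.
  have -> : (\int[P]_om (expR (2^-1 * \sum_k 2 * s * h k ^+ 2 * coef U (wv om) k ^+ 2))%:E =
     \int[P]_om' f om om')%E.
    apply: eq_integral => om' _; rewrite /f eH (sqn_coef hU); congr (expR _)%:E.
    rewrite !mulr_sumr; apply: eq_bigr => k _; rewrite (coef_spec hU) exprMn.
    by field.
  move=> q; apply: le_trans (q _ _) _.
  - by move=> k; rewrite mulr_ge0 ?sqr_ge0 // mulr_ge0 // ltW.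
  - by move=> k; rewrite e; case/andP: (h2 k) => _; lra.
  rewrite lee_fin ler_expR mulr_sumr.
  under eq_bigr do rewrite e.
  by rewrite -mulr_suml ler_wpM2r.
have jm d1 d2 (T1 : measurableType d1) (T2 : measurableType d2) (g : T1 -> 'M[R]_n)
    (v : T2 -> 'cV[R]_n) : (forall i j, measurable_fun setT (fun x => g x i j)) ->
    (forall i, measurable_fun setT (fun x => v x i 0)) ->
    measurable_fun setT (fun z : T1 * T2 => (expR (s * sqn (g z.1 *m v z.2)))%:E).
  move=> mg mv; apply/measurable_EFinP; apply: (measurableT_comp (@measurable_expR R)).
  apply: measurable_funM; first exact: measurable_cst.
  apply: measurable_sum => i; apply: measurable_funX.
  under eq_fun do rewrite mxE.
  apply: measurable_sum => j; apply: measurable_funM.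
    by apply: (measurableT_comp (mg i j)); exact: measurable_fst.
  by apply: (measurableT_comp (mv j)); exact: measurable_snd.
have mH' i j : measurable_fun setT (fun om => H om i j).
  move=> _ A mA; have := mH i j measurableT _ mA.
  rewrite !setTI => hm; have := @sigma_sub_measurable _ _ _ (@piX_sub _ _ _ _ _ _ _ hX predT) => /(_ _ hm) hq; exact: hq.
have mw' i : measurable_fun setT (fun om => wv om i 0).
  by under eq_fun do rewrite mxE; exact: mw.
have E : (\int[P]_om f om om <= (expR (T / 2))%:E)%E.
  rewrite (@indep_integral_id (piX X predT) (piW w [set: 'I_n]%SET)).
  - apply: (@le_trans _ _ (\int[P]_om (expR (T / 2))%:E)%E); last first.
      rewrite integral_cst // -[leRHS]mule1 lee_wpmul2l ?lee_fin ?expR_ge0 //.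
      exact: probability_le1.
    apply: ge0_le_integral => //.
    + by move=> om _; apply: integral_ge0.
    + have := @measurable_fun_fubini_tonelli_F _ _ Om Om R P _ (jm _ _ _ _ H wv mH' mw').
      by apply => z; exact: f0.
  - exact: (piX_sub hX).
  - exact: piX_setI.
  - exact: (piX_setT hX).
  - exact: (piW_sub mw).
  - exact: piW_setI.
  - exact: piW_setT.
  - by move=> A B hA hB; exact: (piXW_indep hX mw hind hA hB).
  - apply: (jm _ _ (g_sigma_algebraType (piX X predT)) (g_sigma_algebraType (piW w [set: 'I_n]%SET))
      (fun om => H om : 'M[R]_n) (fun om => wv om)) => // i.
    by under eq_fun do rewrite mxE; apply: piW_measurable; rewrite finset.inE.
  - by [].
have md : measurable_fun setT (fun om => f om om).
  have := measurableT_comp (jm _ _ _ _ H wv mH' mw')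
    (measurable_fun_pair (@measurable_id _ Om setT) (@measurable_id _ Om setT)).
  exact.
have mA : measurable [set om | 4 * s0 ^+ 2 * y <= sqn (H om *m wv om)].
  have ms : measurable_fun setT (fun om => - sqn (H om *m wv om)).
    apply: measurableT_comp => //; apply: measurable_sum => i; apply: measurable_funX.
    under eq_fun do rewrite mxE.
    by apply: measurable_sum => j; apply: measurable_funM; [exact: mH' | exact: mw'].
  have := le_set_measurable (- (4 * s0 ^+ 2 * y)) ms.
  by congr measurable; apply/seteqP; split => om /=; rewrite lerN2.
apply: (@le_trans _ _ ((expR (- y))%:E * \int[P]_om f om om)%E); last first.
  apply: le_trans (lee_wpmul2l _ E) _; first by rewrite lee_fin expR_ge0.
  by rewrite -EFinM -expRD addrC.
rewrite -ge0_integralZl_EFin ?expR_ge0 //.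
set B := [set om | _]; have := integral_indic P measurableT mA.
rewrite setIT => <-.
apply: ge0_le_integral => //.
- by apply/measurable_EFinP; exact: measurable_indic.
- by apply: emeasurable_funM => //; exact: measurable_cst.
move=> om _; rewrite indicE; case: (boolP (om \in _)) => [|_]; last first.
  by apply: mule_ge0; rewrite ?lee_fin ?expR_ge0.
rewrite inE /f -EFinM -expRD lee_fin /= => h.
rewrite -[leLHS]expR0 ler_expR addrC subr_ge0.
by rewrite -(ler_pM2l s2) /s (mulVKf (lt0r_neq0 s2)).
Qed.

End NoiseMgf.

(** * Spectrum of the Gram matrix *)

Lemma ler_norm_sq (R : realDomainType) (a b : R) : 0 <= b -> a ^+ 2 <= b ^+ 2 -> `|a| <= b.
Proof. by move=> b0 h; rewrite -ler_sqr ?nnegrE // real_normK ?num_real. Qed.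

Section SampleForms.
Variables (R : realType) (d n : nat) (x : 'I_n -> 'rV[R]_d).
Hypothesis n_gt0 : (0 < n)%N.
Hypothesis x_sphere : forall i, dotp (x i) (x i) = 1.
Local Notation word := (seq 'I_d).

Let n0 : 0 < n%:R :> R. Proof. by rewrite ltr0n. Qed.

Lemma sum_words_cat k m (F : word -> R) : \sum_(w <- words d (k + m)) F w =
  \sum_(w <- words d k) \sum_(w' <- words d m) F (w ++ w').
Proof.
elim: k F => [|k IH] F; first by rewrite sum_words0.
by rewrite addSn !sum_wordsS; apply: eq_bigr => a _; exact: IH.
Qed.

Lemma sphere_dotp_le1 (y z : 'rV[R]_d) : dotp y y = 1 -> dotp z z = 1 -> `|dotp y z| <= 1.
Proof.
move=> y1 z1; rewrite -(@expr_le1 _ 2) // -normrX ger0_norm ?sqr_ge0 //.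
apply: le_trans (sum_CS _ _ _) _.
have e (v : 'rV[R]_d) : dotp v v = 1 -> \sum_(i < d) v 0 i ^+ 2 = 1.
  by move=> <-; apply: eq_bigr => i _; rewrite expr2.
by rewrite !e // mulr1.
Qed.

Definition emp (w : word) : R := n%:R^-1 * \sum_i monom w (x i).

Lemma mform_emp k m u v :
  mform emp k m u v = n%:R^-1 * \sum_i pol k u (x i) * pol m v (x i).
Proof.
rewrite /mform /emp mulr_sumr.
under eq_bigr do under eq_bigr do rewrite mulrCA mulr_sumr mulr_sumr.
rewrite (eq_bigr (fun w => \sum_i \sum_(w' <- words d m)
    n%:R^-1 * (u w * monom w (x i)) * (v w' * monom w' (x i)))); last first.
  move=> w _; rewrite exchange_big /=; apply: eq_bigr => i _; apply: eq_bigr => w' _.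
  by rewrite monom_cat; ring.
rewrite exchange_big /=; apply: eq_bigr => i _.
rewrite /pol mulr_suml mulr_sumr; apply: eq_bigr => w _.
by rewrite mulr_sumr mulr_sumr; apply: eq_bigr => w' _; ring.
Qed.

(** The difference of the forms pairs the tensor product of [u] and [v] with the difference of the
    moment tensors, so Cauchy-Schwarz gives a bound free of the dimension. *)
Lemma mform_close (mom mom' : word -> R) k m u v e : 0 <= e ->
  \sum_(w <- words d (k + m)) (mom' w - mom w) ^+ 2 <= e ^+ 2 ->
  `|mform mom' k m u v - mform mom k m u v| <= e * ((tnorm k u + tnorm m v) / 2).
Proof.
move=> e0 he; pose r := [seq (w, w') | w <- words d k, w' <- words d m].
have E : mform mom' k m u v - mform mom k m u v =
    \sum_(p <- r) (u p.1 * v p.2) * (mom' (p.1 ++ p.2) - mom (p.1 ++ p.2)).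
  rewrite big_allpairs_dep /= /mform -sumrB; apply: eq_bigr => w _.
  by rewrite -sumrB; apply: eq_bigr => w' _; rewrite mulrBr.
have T0 : 0 <= (tnorm k u + tnorm m v) / 2 by rewrite divr_ge0 ?addr_ge0 ?tnorm_ge0.
apply: ler_norm_sq; first by rewrite mulr_ge0.
rewrite E; apply: le_trans (sum_CS _ _ _) _.
have -> : \sum_(p <- r) (mom' (p.1 ++ p.2) - mom (p.1 ++ p.2)) ^+ 2 =
    \sum_(w <- words d (k + m)) (mom' w - mom w) ^+ 2.
  by rewrite big_allpairs_dep /= sum_words_cat.
have -> : \sum_(p <- r) (u p.1 * v p.2) ^+ 2 = tnorm k u * tnorm m v.
  rewrite big_allpairs_dep /= /tnorm mulr_suml; apply: eq_bigr => w _.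
  by rewrite mulr_sumr; apply: eq_bigr => w' _; rewrite exprMn.
rewrite exprMn mulrC; apply: ler_pM => //.
- by apply: sumr_ge0 => p _; exact: sqr_ge0.
- by rewrite mulr_ge0 ?tnorm_ge0.
have := sqr_ge0 (tnorm k u - tnorm m v); lra.
Qed.

(** Moment tensor of the signed measure with mass [v i] at [x i]. Its squared norm in degree [k] is
    the quadratic form of the matrix of [k]-th powers of inner products, so [n] times
    [quad (gram x)] is a series of these norms with positive coefficients. *)
Definition vmom (v : 'I_n -> R) (w : word) : R := \sum_i v i * monom w (x i).

Lemma vmom_sym v : tsym (vmom v).
Proof. by move=> w w' ww; apply: eq_bigr => i _; rewrite (monom_sym _ ww). Qed.

Lemma tnorm_vmom k v : tnorm k (vmom v) = \sum_i \sum_j v i * v j * dotp (x i) (x j) ^+ k.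
Proof.
rewrite /tnorm /vmom; under eq_bigr do rewrite expr2 mulr_suml.
rewrite exchange_big /=; apply: eq_bigr => i _.
under eq_bigr do rewrite mulr_sumr.
rewrite exchange_big /=; apply: eq_bigr => j _.
by rewrite -sum_monom2 mulr_sumr; apply: eq_bigr => w _; ring.
Qed.

Lemma tdot_vmom k v u : tdot k u (vmom v) = \sum_i v i * pol k u (x i).
Proof.
rewrite /tdot /vmom; under eq_bigr do rewrite mulr_sumr.
rewrite exchange_big /=; apply: eq_bigr => i _.
by rewrite /pol mulr_sumr; apply: eq_bigr => w _; ring.
Qed.

Lemma kap_form N v : \sum_i \sum_j v i * v j * kap N (dotp (x i) (x j)) =
  \sum_(k < N) kco R k * tnorm k (vmom v).
Proof.
under [RHS]eq_bigr do rewrite tnorm_vmom mulr_sumr.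
rewrite [RHS]exchange_big /=; apply: eq_bigr => i _.
under [RHS]eq_bigr do rewrite mulr_sumr.
rewrite [RHS]exchange_big /=; apply: eq_bigr => j _.
by rewrite /kap mulr_sumr; apply: eq_bigr => k _; ring.
Qed.

Lemma quad_gram (v : 'cV[R]_n) :
  n%:R * quad (gram x) v = \sum_i \sum_j v i 0 * v j 0 * ker (dotp (x i) (x j)).
Proof.
rewrite /quad dotvE mulr_sumr; apply: eq_bigr => i _.
rewrite mxE !mulr_sumr; apply: eq_bigr => j _.
by rewrite mxE Kker_ker; field; exact: lt0r_neq0.
Qed.

(** The omitted degrees contribute nonnegative terms; uniform convergence of the kernel series
    handles the limit. *)
Lemma gram_ge_partial N (v : 'cV[R]_n) :
  \sum_(k < N) kco R k * tnorm k (vmom (v ^~ 0)) <= n%:R * quad (gram x) v.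
Proof.
rewrite quad_gram; set V := \sum_i _.
pose a := \sum_i \sum_j `|v i 0| * `|v j 0|.
have a0 : 0 <= a by apply: sumr_ge0 => i _; apply: sumr_ge0 => j _; rewrite mulr_ge0.
apply/ler_addgt0Pr => e e0.
have e1 : 0 < e / (a + 1) by rewrite divr_gt0 // ltr_wpDl.
have [M hM] := kap_unif e1; pose L := maxn M N.
have h := hM L (leq_maxl _ _).
apply: (@le_trans _ _ (\sum_(k < L) kco R k * tnorm k (vmom (v ^~ 0)))).
  rewrite (big_ord_widen L (fun k => kco R k * tnorm k (vmom (v ^~ 0))) (leq_maxr _ _)).
  rewrite big_mkcond /=; apply: ler_sum => k _; case: ifP => // _.
  by rewrite mulr_ge0 ?tnorm_ge0 // ltW // kco_gt0.
rewrite -kap_form -lerBlDl -sumrB.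
apply: (@le_trans _ _ (e / (a + 1) * a)).
  rewrite /a mulr_sumr; apply: ler_sum => i _; rewrite mulr_sumr -sumrB; apply: ler_sum => j _.
  rewrite -mulrBr; apply: le_trans (ler_norm _) _; rewrite normrM normrM mulrC.
  by rewrite ler_wpM2r ?mulr_ge0 // distrC h // sphere_dotp_le1.
rewrite mulrAC ler_pdivrMr ?ltr_wpDl // ler_pM2l //; lra.
Qed.

Lemma quad_gram_ge0 v : 0 <= quad (gram x) v.
Proof.
have := gram_ge_partial 0 v; rewrite big_ord0 => h.
by rewrite -(pmulr_rge0 _ n0).
Qed.

Lemma ker_norm_le1 (t : R) : `|t| <= 1 -> `|ker t| <= 1.
Proof.
move=> t1; have i1 : -1 <= t <= 1 by rewrite -ler_norml.
apply/ler_addgt0Pr => e e0; have [N hN] := kap_cvg1 i1 e0.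
have := hN N (leqnn _) => h.
have : `|kap N t| <= 1.
  have := @kap_diff R 0 N t (leq0n _) t1; rewrite /kap big_ord0 !subr0 expr0 mulr1.
  by move=> /le_trans; apply; rewrite big_ord0 subr0; exact: kap1_le1.
have -> : ker t = (ker t - kap N t) + kap N t by rewrite subrK.
by move=> h2; apply: le_trans (ler_normD _ _) _; rewrite addrC lerD.
Qed.

Lemma quad_gram_le v : quad (gram x) v <= sqn v.
Proof.
rewrite -(ler_pM2l n0) quad_gram.
apply: (@le_trans _ _ (\sum_i \sum_j (v i 0 ^+ 2 + v j 0 ^+ 2) / 2)).
  apply: ler_sum => i _; apply: ler_sum => j _.
  apply: le_trans (ler_norm _) _; rewrite normrM.
  have h1 : `|v i 0 * v j 0| * `|ker (dotp (x i) (x j))| <= `|v i 0 * v j 0|.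
    by rewrite -[leRHS]mulr1 ler_wpM2l // ker_norm_le1 // sphere_dotp_le1.
  apply: le_trans h1 _; rewrite normrM -(real_normK (num_real (v i 0))) -(real_normK (num_real (v j 0))).
  have := sqr_ge0 (`|v i 0| - `|v j 0|); lra.
have -> : \sum_i \sum_j (v i 0 ^+ 2 + v j 0 ^+ 2) / 2 = n%:R * sqn v.
  under eq_bigr do rewrite -mulr_suml big_split /=.
  rewrite -mulr_suml big_split /= [X in _ + X]sumr_const.
  under [X in X + _]eq_bigr do rewrite sumr_const.
  rewrite sumrMnl -!/(sqn v) card_ord -mulr_natl; by field.
by [].
Qed.

(** On the sphere a monomial of degree [m] equals its product with the [i]-th power of the squared
    norm, a polynomial of degree [k]. *)
Lemma vmom_lower_degree m i k v : (m + i.*2 = k)%N ->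
  (forall w, size w = k -> vmom v w = 0) -> forall w, size w = m -> vmom v w = 0.
Proof.
move=> e h w sw; rewrite /vmom -e addnC in h *.
under eq_bigr do rewrite -(pol_dl i (x_sphere _) sw).
rewrite -tdot_vmom /tdot big_seq big1 // => w'.
by rewrite mem_words => /eqP /h; rewrite /vmom => ->; rewrite mulr0.
Qed.

Section MomentBounds.
Variables (mom : word -> R) (e : R).
Hypothesis d_gt1 : (1 < d)%N.
Hypothesis mom_nil : mom [::] = 1.
Hypothesis mom_perm : tsym mom.
Hypothesis mom_ibp : forall a w,
  (d%:R + (size w)%:R - 1) * mom (a :: w) = (count_mem a w)%:R * mom (rem a w).
Hypothesis mom_pos : forall r : seq (word * R),
  0 <= \sum_(p <- r) \sum_(q <- r) p.2 * q.2 * mom (p.1 ++ q.1).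
Hypothesis e_ge0 : 0 <= e.

Let d_gt0 : (0 < d)%N. Proof. exact: ltnW. Qed.
Let d0 : 0 < d%:R :> R. Proof. by rewrite ltr0n. Qed.
Let d1 : 1 < d%:R :> R. Proof. by rewrite ltr1n. Qed.

Definition moment_close p := \sum_(w <- words d p) (emp w - mom w) ^+ 2 <= e ^+ 2.

Lemma mom_odd w : odd (size w) -> mom w = 0.
Proof.
have [m hm] : exists m, (size w <= m)%N by exists (size w).
elim: m w hm => [|m IH] [|a w] //= hm ow.
have c0 : d%:R + (size w)%:R - 1 != 0 :> R.
  have : 0 <= (size w)%:R :> R by [].
  by move: d1 => h1 h2; apply: lt0r_neq0; lra.
apply: (mulfI c0); rewrite mom_ibp mulr0.
have [aw|aw] := boolP (a \in w); last by rewrite (count_memPn aw) mul0r.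
have sr : (size (rem a w)).+1 = size w by rewrite size_rem // prednK // -has_predT; apply/hasP; exists a.
rewrite IH ?mulr0 //.
  by rewrite -ltnS sr ltnW.
by move: ow; rewrite -sr /= negbK.
Qed.

Lemma mform_odd k m u v : odd (k + m) -> mform mom k m u v = 0.
Proof.
move=> km; rewrite /mform big_seq big1 // => w; rewrite mem_words => /eqP sw.
rewrite big_seq big1 // => w'; rewrite mem_words => /eqP sw'.
by rewrite mom_odd ?mulr0 // size_cat sw sw'.
Qed.

(** Duality: [S] is the pairing of [v] with the values of [u], so [S^2] is at most the squared norm
    of [v] times [n] times the empirical form of [u]. That form is at most a small multiple of [S],
    and one [S] cancels. *)
Lemma vmom_test k j v (u : word -> R) : moment_close (k + k)%N -> tsym u ->
  (forall w, (size w + j.*2 = k)%N -> iter j (@tr R d) u w = 0) ->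
  tnorm k u <= tnorm k (vmom v) -> tnorm k (vmom v) = \sum_i v i * pol k u (x i) ->
  tnorm k (vmom v) <= n%:R * (\sum_i v i ^+ 2) *
    ((ucoef k).1 * d%:R ^+ j / d%:R ^+ k.+1 + e).
Proof.
move=> clk su htr; set S := tnorm k (vmom v) => uS SE.
have V0 : 0 <= \sum_i v i ^+ 2 by apply: sumr_ge0 => i _; exact: sqr_ge0.
have S0 : 0 <= S by exact: tnorm_ge0.
have S2 : S ^+ 2 <= (\sum_i v i ^+ 2) * (n%:R * mform emp k k u u).
  rewrite {1}SE; apply: le_trans (sum_CS _ _ _) _.
  rewrite mform_emp (mulVKf (lt0r_neq0 n0)).
  by under [X in _ <= _ * X]eq_bigr do rewrite -expr2.
set c := (ucoef k).1 * d%:R ^+ j / d%:R ^+ k.+1.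
have c0 : 0 <= c by rewrite !mulr_ge0 ?invr_ge0 ?exprn_ge0 //; case/andP: (@ucoef_ge0 R k).
have hm : mform mom k k u u <= c * tnorm k u.
  have := @mform_upper R d mom d_gt0 mom_nil mom_perm mom_ibp mom_pos k j u su htr.
  have D : 0 < d%:R ^+ k.+1 :> R by rewrite exprn_gt0.
  by move=> h; rewrite /c mulrAC ler_pdivlMr // mulrC.
have he : mform emp k k u u <= (c + e) * S.
  have := @mform_close mom emp k k u u e e_ge0 clk.
  rewrite ler_norml => /andP[_ h].
  apply: (@le_trans _ _ ((c + e) * tnorm k u)); first by lra.
  by rewrite ler_wpM2l // addr_ge0.
move: S0; rewrite le_eqVlt => /orP[/eqP <-|S0].
  by rewrite !mulr_ge0 ?addr_ge0 // ltW.
rewrite -(ler_pM2r S0) -expr2; apply: le_trans S2 _.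
rewrite [n%:R * (\sum_i _)]mulrC -!mulrA; apply: ler_wpM2l => //.
by apply: ler_wpM2l; [exact: ltW|].
Qed.

(* If the moment vector of v vanishes in degree m, its k-tensor may be tested
   against a tensor whose j-fold trace vanishes, where the form is small. *)
Lemma vmom_upper j m v (k := (j.*2 + m)%N) : moment_close ((j.*2 + m) + (j.*2 + m))%N ->
  (forall w, size w = m -> vmom v w = 0) ->
  tnorm k (vmom v) <= n%:R * (\sum_i v i ^+ 2) *
    ((ucoef k).1 * d%:R ^+ j / d%:R ^+ k.+1 + e).
Proof.
move=> clk hv.
have [q [sq q0 qtr qn]] := trace_free_residual x_sphere j (vmom_sym v) hv.
rewrite -/k in q0 qn; apply: (vmom_test clk _ _ qn).
- by move=> w w' ww; rewrite (vmom_sym v ww) (sq _ _ ww).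
- by move=> w hw; apply: qtr; lia.
rewrite tnormE tdot_vmom -[LHS]subr0 -[X in _ - X]q0 -sumrB; apply: eq_bigr => i _.
rewrite -mulrBr /pol -sumrB; congr (_ * _); apply: eq_bigr => w _.
by rewrite -mulrBl.
Qed.

Variable k0 : nat.
Hypothesis k0_gt0 : (0 < k0)%N.
Hypothesis cl : forall p, (p <= 4 * k0 + 6)%N -> moment_close p.

Definition Cup : R := \sum_(k < k0.*2.+3) (ucoef k).1.

Lemma ucoef_le_Cup k : (k <= k0.*2.+2)%N -> (ucoef k).1 <= Cup.
Proof.
move=> kk; rewrite /Cup (bigD1 (Ordinal (kk : k < k0.*2.+3)%N)) //= lerDl.
by apply: sumr_ge0 => i _; case/andP: (@ucoef_ge0 R i).
Qed.

Lemma Cup_ge0 : 0 <= Cup.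
Proof. by apply: sumr_ge0 => i _; case/andP: (@ucoef_ge0 R i). Qed.

(** Up to a factor 2, the size of the eigenvalues from index [r0] on: one power of [d] below
    [d^-k0], plus the sampling error. *)
Definition upb : R := Cup / d%:R ^+ k0.+1 + e.

Lemma vmom_upb j m v : (k0.*2.+2 >= j.*2 + m)%N -> (k0 + 1 + j <= (j.*2 + m).+1)%N ->
  (forall w, size w = m -> vmom v w = 0) ->
  tnorm (j.*2 + m) (vmom v) <= n%:R * (\sum_i v i ^+ 2) * upb.
Proof.
move=> h1 h2 hv; apply: le_trans (vmom_upper (cl _) hv) _; first by lia.
have V0 : 0 <= \sum_i v i ^+ 2 by apply: sumr_ge0 => i _; exact: sqr_ge0.
apply: ler_wpM2l; first by rewrite mulr_ge0 // ltW.
rewrite /upb lerD2r -mulrA; apply: ler_pM.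
- by case/andP: (@ucoef_ge0 R (j.*2 + m)).
- by rewrite divr_ge0 ?exprn_ge0.
- exact: ucoef_le_Cup.
rewrite ler_pdivrMr ?exprn_gt0 // mulrC ler_pdivlMr ?exprn_gt0 // -exprD.
by rewrite ler_weXn2l ?ltW //; lia.
Qed.

(** Degrees up to [k0] vanish because they can be raised to [k0] or [k0 - 1]; those between [k0] and
    [2 k0 + 2] go through [vmom_upb]; the infinite remainder is dominated by a single power. *)
Lemma quad_gram_upper (v : 'cV[R]_n) :
  (forall w, (size w == k0) || (size w == k0.-1) -> vmom (v ^~ 0) w = 0) ->
  quad (gram x) v <= 2 * upb * sqn v.
Proof.
move=> hv; have upb0 : 0 <= upb.
  by rewrite addr_ge0 // divr_ge0 ?exprn_ge0 // Cup_ge0.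
(* [N] is even, so [|t|^N] is again a power of the inner product, and large enough for the bound
   without any trace condition to reach [d^-(k0 + 1)]. *)
rewrite -(ler_pM2l n0) quad_gram; set N := k0.*2.+2.
pose a (i : 'I_n) := `|v i 0|.
have sa : \sum_i a i ^+ 2 = sqn v.
  by apply: eq_bigr => i _; rewrite /a real_normK // num_real.
have -> : \sum_i \sum_j v i 0 * v j 0 * ker (dotp (x i) (x j)) =
   \sum_i \sum_j v i 0 * v j 0 * kap N (dotp (x i) (x j)) +
   \sum_i \sum_j v i 0 * v j 0 * (ker (dotp (x i) (x j)) - kap N (dotp (x i) (x j))).
  rewrite -big_split; apply: eq_bigr => i _; rewrite -big_split; apply: eq_bigr => j _ /=.
  by rewrite -mulrDr addrC subrK.
have h1 : \sum_i \sum_j v i 0 * v j 0 * kap N (dotp (x i) (x j)) <= n%:R * sqn v * upb.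
  rewrite kap_form.
  apply: (@le_trans _ _ (\sum_(k < N) kco R k * (n%:R * sqn v * upb))).
    apply: ler_sum => k _; apply: ler_wpM2l; first by rewrite ltW // kco_gt0.
    have [kk|kk] := leqP k k0.
      have Z w : size w = k -> vmom (v ^~ 0) w = 0.
        have [ko|ko] := boolP (odd (k0 - k)).
          apply: (@vmom_lower_degree k (k0 - k).-1./2 k0.-1); first by lia.
          by move=> w' sw'; apply: hv; rewrite sw' eqxx orbT.
        apply: (@vmom_lower_degree k (k0 - k)./2 k0); first by lia.
        by move=> w' sw'; apply: hv; rewrite sw' eqxx.
      rewrite /tnorm big_seq big1; last by move=> w; rewrite mem_words => /eqP/Z ->; rewrite expr0n.
      by rewrite !mulr_ge0 ?sqn_ge0 // ltW.
    (* Half of the excess degree, rounded up, so that [m] is [k0] or [k0 - 1], where the moments of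
       [v] vanish. *)
    pose j := (k - k0).+1./2; pose m := (k - j.*2)%N.
    have kN := ltn_ord k.
    have kE : nat_of_ord k = (j.*2 + m)%N by rewrite /m /j; lia.
    rewrite kE; apply: vmom_upb; [lia|rewrite /m /j; lia|].
    by move=> w sw; apply: hv; rewrite sw /m /j; lia.
  rewrite -mulr_suml -[leRHS]mul1r; apply: ler_wpM2r.
    by rewrite !mulr_ge0 ?sqn_ge0 // ltW.
  have := kap1_le1 R N; rewrite /kap; apply: le_trans.
  by apply: ler_sum => k _; rewrite expr1n mulr1.
have h2 : \sum_i \sum_j v i 0 * v j 0 * (ker (dotp (x i) (x j)) - kap N (dotp (x i) (x j)))
    <= n%:R * sqn v * upb.
  apply: (@le_trans _ _ (tnorm N (vmom a))).
    rewrite tnorm_vmom; apply: ler_sum => i _; apply: ler_sum => j _.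
    apply: le_trans (ler_norm _) _; rewrite normrM normrM.
    apply: ler_wpM2l; first by rewrite mulr_ge0.
    have -> : dotp (x i) (x j) ^+ N = `|dotp (x i) (x j)| ^+ N.
      by rewrite -normrX ger0_norm // /N -doubleS -muln2 exprM sqr_ge0.
    by apply: kap_tail; exact: sphere_dotp_le1.
  apply: (@le_trans _ _ (n%:R * (\sum_i a i ^+ 2) * ((ucoef N).1 * d%:R ^+ k0.+2 / d%:R ^+ N.+1 + e))).
    (* With [2 j > N] the trace condition is void and [vmom a] is tested against itself; the ratio
       [d^(k0 + 2) / d^(2 k0 + 3)] is still [d^-(k0 + 1)]. *)
    apply: (@vmom_test N k0.+2 a (vmom a)) => //; first by apply: cl; rewrite /N; lia.
    - exact: vmom_sym.
    - by move=> w; rewrite /N; lia.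
    - by rewrite tnormE tdot_vmom.
  rewrite sa; apply: ler_wpM2l; first by rewrite mulr_ge0 ?sqn_ge0 // ltW.
  rewrite /upb lerD2r -mulrA; apply: ler_pM.
  - by case/andP: (@ucoef_ge0 R N).
  - by rewrite divr_ge0 ?exprn_ge0.
  - exact: ucoef_le_Cup.
  rewrite ler_pdivrMr ?exprn_gt0 // mulrC ler_pdivlMr ?exprn_gt0 // -exprD.
  by rewrite ler_weXn2l ?ltW // /N; lia.
lra.
Qed.

Let th1 : R := ((2 * d%:R) ^+ k0)^-1.
Hypothesis k0_d : (k0.*2 <= d)%N.
Hypothesis e_small : 4 * e <= th1.

Let th1_gt0 : 0 < th1. Proof. by rewrite invr_gt0 exprn_gt0 // mulr_gt0. Qed.

Let ptens (c : 'rV[R]_(size (basis_words d k0))) : word -> R := symz (@basis_tensor R d k0 c).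
Let pval c i := pol k0 (ptens c) (x i) + pol k0.-1 (ptens c) (x i).

(** The cross term between degrees [k0] and [k0 - 1] vanishes for the uniform law by parity, so only
    sampling errors, [2 e] in total, are lost out of [th1]. *)
Lemma pval_lower c :
  n%:R * (th1 / 2) * (tnorm k0 (ptens c) + tnorm k0.-1 (ptens c)) <= \sum_i pval c i ^+ 2.
Proof.
set u := ptens c; set T := tnorm k0 u; set T' := tnorm k0.-1 u.
have T0 : 0 <= T by exact: tnorm_ge0.
have T'0 : 0 <= T' by exact: tnorm_ge0.
have E : n%:R^-1 * \sum_i pval c i ^+ 2 = mform emp k0 k0 u u +
    2 * mform emp k0 k0.-1 u u + mform emp k0.-1 k0.-1 u u.
  rewrite !mform_emp mulrCA -!mulrDr; congr (_ * _).
  rewrite mulr_sumr -!big_split /=; apply: eq_bigr => i _.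
  by rewrite /pval -/u; ring.
have L k : (k <= k0)%N -> th1 * tnorm k u <= mform mom k k u u.
  move=> kk; have kd : (k.*2 <= d)%N by lia.
  have := @mform_lower R d mom d_gt0 mom_nil mom_perm mom_ibp mom_pos k u kd (symz_sym _).
  have dk : 0 < (2 * d%:R) ^+ k :> R by rewrite exprn_gt0 // mulr_gt0.
  rewrite -ler_pdivrMl //; apply: le_trans; apply: ler_wpM2r; first exact: tnorm_ge0.
  rewrite /th1 lef_pV2 ?posrE ?exprn_gt0 ?mulr_gt0 // ler_weXn2l //.
  by move: d1; lra.
have cc k m : (k <= k0)%N -> (m <= k0)%N -> moment_close (k + m)%N.
  by move=> kk mk; apply: cl; lia.
have c1 := @mform_close mom emp k0 k0 u u e e_ge0 (cc _ _ (leqnn _) (leqnn _)).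
have c2 := @mform_close mom emp k0 k0.-1 u u e e_ge0 (cc _ _ (leqnn _) (leq_pred _)).
have c3 := @mform_close mom emp k0.-1 k0.-1 u u e e_ge0 (cc _ _ (leq_pred _) (leq_pred _)).
rewrite (@mform_odd k0 k0.-1) ?subr0 in c2; last by move: k0_gt0; lia.
move: c1 c2 c3; rewrite -/T -/T' !ler_norml => /andP[c1 _] /andP[c2 _] /andP[c3 _].
have l1 := L k0 (leqnn _); have l2 := L k0.-1 (leq_pred _).
rewrite -/T -/T' in l1 l2.
have h : th1 / 2 * (T + T') <= n%:R^-1 * \sum_i pval c i ^+ 2.
  rewrite E; have := @mulr_ge0 R (th1 - 4 * e) (T + T'); rewrite subr_ge0 addr_ge0 //.
  move=> /(_ e_small isT); lra.
by rewrite -mulrA -ler_pdivlMl.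
Qed.

Definition basis_mx : 'M[R]_(size (basis_words d k0), n) :=
  \matrix_(a, i) monom (nth [::] (basis_words d k0) a) (x i).

Lemma basis_mx_pval c : (c *m basis_mx)^T = \col_i pval c i.
Proof.
apply/colP => i; rewrite !mxE /pval /ptens !pol_symz pol_basis_tensor //.
by apply: eq_bigr => a _; rewrite mxE.
Qed.

Lemma basis_mx_free (c : 'rV[R]_(size (basis_words d k0))) : c *m basis_mx = 0 -> c = 0.
Proof.
move=> c0; have := pval_lower c.
rewrite big1; last first.
  move=> i _; have /colP/(_ i) := basis_mx_pval c; rewrite c0 trmx0 mxE [RHS]mxE => <-.
  by rewrite expr0n.
have T0 : 0 <= tnorm k0 (ptens c) by exact: tnorm_ge0.
have T'0 : 0 <= tnorm k0.-1 (ptens c) by exact: tnorm_ge0.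
rewrite pmulr_rle0 ?mulr_gt0 ?divr_gt0 // => h.
apply: (basis_tensor_inj k0_gt0); apply/eqP; rewrite eq_le tnorm_ge0 andbT;
  rewrite -/(ptens c); lra.
Qed.

(** Duality in the reverse direction: [sqn v] is the pairing of the coefficient tensors with the
    moments of [v], so its square is at most [T S]. By [pval_lower] [T] is bounded by a multiple of
    [sqn v], which forces [S], and with it the form, to be large. *)
Lemma quad_gram_lower c0 c : 0 <= c0 -> c0 <= kco R k0 -> c0 <= kco R k0.-1 ->
  c0 * (th1 / 2) * sqn (c *m basis_mx)^T <= quad (gram x) (c *m basis_mx)^T.
Proof.
move=> c00 ck ck1; rewrite basis_mx_pval; set v := \col_i pval c i.
set T := tnorm k0 (ptens c) + tnorm k0.-1 (ptens c).
set S := tnorm k0 (vmom (v ^~ 0)) + tnorm k0.-1 (vmom (v ^~ 0)).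
have T0 : 0 <= T by rewrite addr_ge0 ?tnorm_ge0.
have S0 : 0 <= S by rewrite addr_ge0 ?tnorm_ge0.
have hq : c0 * S <= n%:R * quad (gram x) v.
  apply: le_trans (gram_ge_partial k0.+1 v).
  rewrite big_ord_recr /= /S mulrDr [leLHS]addrC; apply: lerD; last first.
    by apply: ler_wpM2r; rewrite ?tnorm_ge0.
  have k1 : (k0.-1 < k0)%N by move: k0_gt0; lia.
  rewrite (bigD1 (Ordinal k1)) //= -[leLHS]addr0; apply: lerD.
    by apply: ler_wpM2r; rewrite ?tnorm_ge0.
  by apply: sumr_ge0 => i _; rewrite mulr_ge0 ?tnorm_ge0 // ltW // kco_gt0.
have sv : sqn v = \sum_i pval c i ^+ 2 by apply: eq_bigr => i _; rewrite mxE.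
have s0 := sqn_ge0 v.
have hT : n%:R * (th1 / 2) * T <= sqn v by rewrite sv; exact: pval_lower.
have hS : sqn v ^+ 2 <= T * S.
  have E : sqn v = tdot k0 (ptens c) (vmom (v ^~ 0)) + tdot k0.-1 (ptens c) (vmom (v ^~ 0)).
    rewrite !tdot_vmom -big_split sv; apply: eq_bigr => i _ /=.
    by rewrite /v mxE -mulrDr expr2.
  have cs k : tdot k (ptens c) (vmom (v ^~ 0)) ^+ 2 <= tnorm k (ptens c) * tnorm k (vmom (v ^~ 0)).
    exact: sum_CS.
  have := cs k0; have := cs k0.-1; rewrite E /T /S.
  set a := tdot _ _ _; set b := tdot _ _ _.
  set ta := tnorm k0.-1 (ptens c); set sa := tnorm k0.-1 _.
  set tb := tnorm k0 (ptens c); set sb := tnorm k0 _.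
  have [h1 h2 h3 h4] : [/\ 0 <= ta, 0 <= sa, 0 <= tb & 0 <= sb] by split; exact: tnorm_ge0.
  move=> ha hb.
  have hab : (2 * (a * b)) ^+ 2 <= (ta * sb + tb * sa) ^+ 2.
    have : a ^+ 2 * b ^+ 2 <= (ta * sa) * (tb * sb) by rewrite ler_pM ?sqr_ge0.
    have := sqr_ge0 (ta * sb - tb * sa); lra.
  have : 2 * (a * b) <= ta * sb + tb * sa.
    apply: le_trans (ler_norm _) _.
    by rewrite -(@ler_pXn2r _ 2) ?nnegrE ?addr_ge0 ?mulr_ge0 // -normrX ger0_norm ?sqr_ge0.
  by lra.
rewrite -(ler_pM2l n0); apply: le_trans hq.
have -> : n%:R * (c0 * (th1 / 2) * sqn v) = c0 * (n%:R * (th1 / 2) * sqn v) by ring.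
apply: ler_wpM2l => //.
have h2 : 0 <= n%:R * (th1 / 2) by rewrite mulr_ge0 ?divr_ge0 // ltW.
move: s0; rewrite le_eqVlt => /orP[/eqP <-|s0]; first by rewrite mulr0.
rewrite -(ler_pM2r s0).
have -> : n%:R * (th1 / 2) * sqn v * sqn v = n%:R * (th1 / 2) * (sqn v ^+ 2) by ring.
apply: le_trans (ler_wpM2l h2 hS) _.
by rewrite [leLHS]mulrA [leLHS]mulrC; apply: ler_wpM2l.
Qed.

End MomentBounds.
End SampleForms.

(** * Eigenfunctions of the kernel *)

Section HomogeneousPolynomials.
Variables (R : realType) (d : nat).

Definition exp_word l (a : {ffun 'I_d -> 'I_l.+1}) : seq 'I_d :=
  flatten [seq nseq (a k) k | k <- enum 'I_d].

Lemma size_exp_word l (a : {ffun 'I_d -> 'I_l.+1}) : size (exp_word a) = \sum_(k < d) (a k : nat).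
Proof.
rewrite size_flatten /shape -map_comp sumnE big_map big_enum.
by apply: eq_bigr => k _; rewrite /= size_nseq.
Qed.

Lemma monom_exp_word l (a : {ffun 'I_d -> 'I_l.+1}) (x : 'rV[R]_d) :
  monom (exp_word a) x = \prod_(k < d) x 0 k ^+ a k.
Proof.
rewrite /monom /exp_word big_flatten big_map big_enum /=; apply: eq_bigr => k _.
by rewrite big_nseq -Monoid.iteropE.
Qed.

Lemma homog_poly_pol l (c : {ffun 'I_d -> 'I_l.+1} -> R) :
  exists2 u : seq 'I_d -> R, tsym u & forall x, homog_poly c x = pol l u x.
Proof.
pose u0 w := \sum_(a : {ffun 'I_d -> 'I_l.+1} | (\sum_(k < d) (a k : nat) == l)%N)
  c a * (exp_word a == w)%:R.
exists (symz u0); first exact: symz_sym.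
move=> x; rewrite pol_symz /homog_poly /pol /u0.
under [RHS]eq_bigr do rewrite mulr_suml.
rewrite exchange_big /=; apply: eq_bigr => a /eqP ha.
rewrite (bigD1_seq (exp_word a)) ?words_uniq ?mem_words ?size_exp_word ?ha //= eqxx mulr1.
rewrite [X in _ + X]big1 ?addr0 ?monom_exp_word // => w wa.
by rewrite eq_sym (negbTE wa) mulr0 mul0r.
Qed.

End HomogeneousPolynomials.

Section KernelDuality.
Variables (R : realType) (d n : nat) (x : 'I_n -> 'rV[R]_d).
Hypothesis n_gt0 : (0 < n)%N.
Hypothesis x_sphere : forall i, dotp (x i) (x i) = 1.

(** Cauchy-Schwarz in the feature space of the kernel, with weight [kco k] in degree [k]. Only
    partial sums are formed; [s] is the limit of their pairings. *)
Lemma kernel_CS (be : seq 'I_d -> R) (a : 'cV[R]_n) (s B : R) :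
  (forall N, \sum_(k < N) kco R k * tnorm k be <= B) ->
  (forall e, 0 < e -> exists N0, forall N, (N0 <= N)%N ->
     `|s - \sum_(k < N) kco R k * tdot k be (vmom x (a ^~ 0))| <= e) ->
  s ^+ 2 <= n%:R * quad (gram x) a * B.
Proof.
move=> hB hs; set Q := n%:R * quad (gram x) a.
have Q0 : 0 <= Q by rewrite mulr_ge0 // quad_gram_ge0.
have B0 : 0 <= B by have := hB 0%N; rewrite big_ord0.
have hP N : `|\sum_(k < N) kco R k * tdot k be (vmom x (a ^~ 0))| <= Num.sqrt (Q * B).
  apply: ler_norm_sq; first exact: sqrtr_ge0.
  rewrite sqr_sqrtr; last exact: mulr_ge0.
  pose r := [seq (k, w) | k <- iota 0 N, w <- words d k].
  pose F (h : seq 'I_d -> R) (p : nat * seq 'I_d) := Num.sqrt (kco R p.1) * h p.2.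
  have k0 k : Num.sqrt (kco R k) * Num.sqrt (kco R k) = kco R k.
    by rewrite -expr2 sqr_sqrtr // ltW // kco_gt0.
  have E (g h : seq 'I_d -> R) : \sum_(k < N) kco R k * tdot k g h = \sum_(p <- r) F g p * F h p.
    rewrite big_allpairs_dep /= -(big_mkord xpredT (fun k => kco R k * tdot k g h)) /index_iota subn0.
    apply: eq_bigr => k _; rewrite /tdot mulr_sumr; apply: eq_bigr => w _.
    by rewrite /F /= -[in LHS]k0; ring.
  rewrite E; apply: le_trans (sum_CS _ _ _) _; rewrite mulrC.
  have E2 (g : seq 'I_d -> R) : \sum_(p <- r) F g p ^+ 2 = \sum_(k < N) kco R k * tnorm k g.
    under eq_bigr do rewrite expr2.
    by rewrite -E; apply: eq_bigr => k _; rewrite tnormE.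
  rewrite !E2; apply: ler_pM.
  - by apply: sumr_ge0 => k _; rewrite mulr_ge0 ?tnorm_ge0 // ltW // kco_gt0.
  - by apply: sumr_ge0 => k _; rewrite mulr_ge0 ?tnorm_ge0 // ltW // kco_gt0.
  - exact: gram_ge_partial.
  exact: hB.
have hs' : `|s| <= Num.sqrt (Q * B).
  apply/ler_addgt0Pr => e e0; have [N0 /(_ _ (leqnn N0)) hN] := hs e e0.
  move: (hP N0) hN; set S := \sum_(k < N0) _ => hS hN.
  have -> : s = (s - S) + S by rewrite subrK.
  by apply: le_trans (ler_normD _ _) _; rewrite addrC lerD.
rewrite -(real_normK (num_real s)) -[leRHS]sqr_sqrtr; last exact: mulr_ge0.
by apply: lerXn2r; rewrite ?nnegrE ?sqrtr_ge0.
Qed.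

End KernelDuality.

Section Eigenfunction.
Context (R : realType) (dO : measure_display) (Om : measurableType dO)
  (P : probability Om R) (d : nat) (Z : Om -> 'rV[R]_d).
Hypothesis hZ : uniform_sphere_rv P Z.
Local Notation word := (seq 'I_d).

Let Z1 om : dotp (Z om) (Z om) = 1. Proof. exact: hZ.2.1. Qed.

Lemma bm_pol k u : bm (fun om => pol k u (Z om)).
Proof. by apply: bm_sum => w; apply: bmZ; exact: (bm_monom hZ). Qed.

Lemma bm_dotp (y : 'rV[R]_d) : bm (fun om => dotp y (Z om)).
Proof. by apply: bm_sum => k; apply: bmZ; exact: (bm_coord hZ). Qed.

Lemma ker_measurable d1 (T : measurableType d1) (g : T -> R) :
  measurable_fun setT g -> (forall z, `|g z| <= 1) -> measurable_fun setT (fun z => ker (g z)).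
Proof.
move=> mg g1; apply: (@measurable_fun_cvg _ _ _ setT (fun N z => kap N (g z))).
  move=> N; apply: measurable_sum => k; apply: measurable_funM; first exact: measurable_cst.
  exact: measurable_funX.
move=> z _; apply/cvgrPdist_le => e e0; have i1 : -1 <= g z <= 1 by rewrite -ler_norml.
have [N hN] := kap_cvg1 i1 e0.
by exists N => // m /= hm; exact: hN.
Qed.

Lemma bm_ker (y : 'rV[R]_d) : dotp y y = 1 -> bm (fun om => ker (dotp y (Z om))).
Proof.
move=> y1; have h om : `|dotp y (Z om)| <= 1 by exact: sphere_dotp_le1.
split; first by apply: ker_measurable => //; exact: (bm_dotp y).1.
by exists 1 => om; exact: ker_norm_le1.
Qed.

Lemma smom_mform k m u v :
  Ex P (fun om => pol k u (Z om) * pol m v (Z om)) = mform (smom P Z) k m u v.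
Proof.
rewrite /mform /pol.
rewrite (eq_Ex P (g := fun om => \sum_(w <- words d k) \sum_(w' <- words d m)
   (u w * v w') * monom (w ++ w') (Z om))); last first.
  move=> om; rewrite mulr_suml; apply: eq_bigr => w _; rewrite mulr_sumr.
  by apply: eq_bigr => w' _; rewrite monom_cat; ring.
rewrite Ex_sum; last by move=> w; apply: bm_sum => w'; apply: bmZ; exact: (bm_monom hZ).
apply: eq_bigr => w _; rewrite Ex_sum; last by move=> w'; apply: bmZ; exact: (bm_monom hZ).
by apply: eq_bigr => w' _; rewrite ExZ //; exact: (bm_monom hZ).
Qed.

Variables (f : 'rV[R]_d -> R) (mu : R).
Hypothesis bf : bm (fun om => f (Z om)).
Hypothesis mu_gt0 : 0 < mu.
Hypothesis f_eig : forall y, dotp y y = 1 ->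
  Ex P (fun om => ker (dotp y (Z om)) * f (Z om)) = mu * f y.

(** These are the coefficients of [mu f] in the kernel expansion, as [eig_approx] makes precise. *)
Definition fmom (w : word) : R := Ex P (fun om => monom w (Z om) * f (Z om)).
Definition Ef2 : R := Ex P (fun om => f (Z om) ^+ 2).

Let bmf w : bm (fun om => monom w (Z om) * f (Z om)).
Proof. by apply: bmM => //; exact: (bm_monom hZ). Qed.

Lemma Ef2_ge0 : 0 <= Ef2.
Proof. by apply: Ex_ge0 => om; exact: sqr_ge0. Qed.

Lemma kap_fmom N y : Ex P (fun om => kap N (dotp y (Z om)) * f (Z om)) =
  \sum_(k < N) kco R k * pol k fmom y.
Proof.
rewrite (eq_Ex P (g := fun om => \sum_(k < N) \sum_(w <- words d k)
    (kco R k * monom w y) * (monom w (Z om) * f (Z om)))); last first.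
  move=> om; rewrite /kap mulr_suml; apply: eq_bigr => k _.
  rewrite -sum_monom2 mulr_sumr mulr_suml; apply: eq_bigr => w _; ring.
rewrite Ex_sum; last by move=> k; apply: bm_sum => w; apply: bmZ; exact: bmf.
apply: eq_bigr => k _; rewrite Ex_sum; last by move=> w; apply: bmZ; exact: bmf.
rewrite /pol mulr_sumr; apply: eq_bigr => w _; rewrite ExZ // /fmom.
ring.
Qed.

Lemma eig_approx e : 0 < e -> exists N0, forall N, (N0 <= N)%N -> forall y, dotp y y = 1 ->
  `|mu * f y - \sum_(k < N) kco R k * pol k fmom y| <= e.
Proof.
move=> e0; have [mf [M hM]] := bf; pose M' := `|M| + 1.
have M0 : 0 < M' by rewrite ltr_wpDl.
have [N0 hN0] := @kap_unif R (e / M') (divr_gt0 e0 M0).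
exists N0 => N NN y y1; rewrite -f_eig // -kap_fmom.
have bk : bm (fun om => kap N (dotp y (Z om)) * f (Z om)).
  apply: bmM => //; apply: bm_sum => k; apply: bmZ; apply: bmX; exact: bm_dotp.
have bK : bm (fun om => ker (dotp y (Z om)) * f (Z om)) by apply: bmM => //; exact: bm_ker.
rewrite -ExB //; apply: Ex_norm; first exact: bmB.
move=> om; rewrite -mulrBl normrM.
have -> : e = e / M' * M' by rewrite divfK // lt0r_neq0.
apply: ler_pM => //; first by apply: hN0 => //; exact: sphere_dotp_le1.
apply: le_trans (hM om) _; apply: le_trans (ler_norm _) _.
by rewrite /M' lerDl.
Qed.

(** Integrating the expansion of [mu f] against [f] gives [mu Ef2] as the sum over all degrees: the
    squared kernel norm of [mu f]. *)
Lemma fmom_bound N : \sum_(k < N) kco R k * tnorm k fmom <= mu * Ef2.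
Proof.
have [mf [M hM]] := bf; pose M' := `|M| + 1.
have M0 : 0 < M' by rewrite ltr_wpDl.
apply/ler_addgt0Pr => e e0.
have [N0 hN0] := eig_approx (divr_gt0 e0 M0).
pose L := maxn N0 N; have hL := hN0 L (leq_maxl _ _).
apply: (@le_trans _ _ (\sum_(k < L) kco R k * tnorm k fmom)).
  rewrite (big_ord_widen L (fun k => kco R k * tnorm k fmom) (leq_maxr _ _)).
  rewrite big_mkcond /=; apply: ler_sum => k _; case: ifP => // _.
  by rewrite mulr_ge0 ?tnorm_ge0 // ltW // kco_gt0.
have bp : bm (fun om => \sum_(k < L) kco R k * pol k fmom (Z om)).
  by apply: bm_sum => k; apply: bmZ; exact: bm_pol.
have -> : \sum_(k < L) kco R k * tnorm k fmom =
    Ex P (fun om => (\sum_(k < L) kco R k * pol k fmom (Z om)) * f (Z om)).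
  rewrite (eq_Ex P (g := fun om => \sum_(k < L) \sum_(w <- words d k)
    (kco R k * fmom w) * (monom w (Z om) * f (Z om)))); last first.
    move=> om; rewrite mulr_suml; apply: eq_bigr => k _.
    by rewrite /pol mulr_sumr mulr_suml; apply: eq_bigr => w _; ring.
  rewrite Ex_sum; last by move=> k; apply: bm_sum => w; apply: bmZ; exact: bmf.
  apply: eq_bigr => k _; rewrite Ex_sum; last by move=> w; apply: bmZ; exact: bmf.
  by rewrite /tnorm mulr_sumr; apply: eq_bigr => w _; rewrite ExZ // -/(fmom w); ring.
rewrite /Ef2 -ExZ; last exact: bmX.
rewrite -[X in _ + X](Ex_cst P) -ExD; [|by apply: bmZ; exact: bmX|exact: bm_cst].
apply: Ex_le; [exact: bmM|by apply: bmD; [apply: bmZ; exact: bmX|exact: bm_cst]|].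
move=> om; have h := hL _ (Z1 om).
rewrite -lerBlDl expr2 mulrA -mulrBl; apply: le_trans (ler_norm _) _; rewrite normrM.
have -> : e = e / M' * M' by rewrite divfK // lt0r_neq0.
apply: ler_pM => //; first by rewrite distrC.
apply: le_trans (hM om) _; apply: le_trans (ler_norm _) _.
by rewrite /M' lerDl.
Qed.

(** [mu f] has squared kernel norm at most [mu Ef2], hence [f] at most [Ef2 / mu]; [kernel_CS] then
    bounds every combination of values of [f]. *)
Lemma eig_eval_bound n (x : 'I_n -> 'rV[R]_d) (a : 'cV[R]_n) : (0 < n)%N ->
  (forall i, dotp (x i) (x i) = 1) ->
  (\sum_i a i 0 * f (x i)) ^+ 2 <= n%:R * quad (gram x) a * (Ef2 / mu).
Proof.
move=> n0 x1; have h := @kernel_CS R d n x n0 x1 fmom a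
  (\sum_i a i 0 * (mu * f (x i))) (mu * Ef2) fmom_bound.
have E : \sum_i a i 0 * (mu * f (x i)) = mu * \sum_i a i 0 * f (x i).
  by rewrite mulr_sumr; apply: eq_bigr => i _; ring.
have m2 : 0 < mu ^+ 2 by rewrite exprn_gt0.
rewrite -(ler_pM2l m2) -exprMn -E.
have -> : mu ^+ 2 * (n%:R * quad (gram x) a * (Ef2 / mu)) =
   n%:R * quad (gram x) a * (mu * Ef2) by field; exact: lt0r_neq0.
apply: h => e e0; pose A := \sum_i `|a i 0| + 1.
have A0 : 0 < A by rewrite ltr_wpDl // sumr_ge0.
have [N0 hN0] := eig_approx (divr_gt0 e0 A0); exists N0 => N NN.
have -> : \sum_(k < N) kco R k * tdot k fmom (vmom x (a ^~ 0)) =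
    \sum_i a i 0 * \sum_(k < N) kco R k * pol k fmom (x i).
  under eq_bigr do rewrite tdot_vmom mulr_sumr.
  rewrite exchange_big /=; apply: eq_bigr => i _; rewrite mulr_sumr.
  by apply: eq_bigr => k _; ring.
rewrite -sumrB; apply: le_trans (ler_norm_sum _ _ _) _.
apply: (@le_trans _ _ (\sum_i `|a i 0| * (e / A))).
  by apply: ler_sum => i _; rewrite -mulrBr normrM; apply: ler_wpM2l => //; exact: hN0.
rewrite -mulr_suml mulrA ler_pdivrMr // mulrC ler_pM2l // /A lerDl //.
Qed.

(** One sample point with mass 1, the kernel being 1 on the diagonal. *)
Lemma eig_sup_bound y : dotp y y = 1 -> f y ^+ 2 <= Ef2 / mu.
Proof.
move=> y1; have := @eig_eval_bound 1 (fun=> y) (const_mx 1) isT (fun=> y1).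
rewrite big_ord1 mxE mul1r quad_gram // !big_ord1 !mxE y1 ker1 !mul1r.
exact.
Qed.

Definition empf n (x : 'I_n -> 'rV[R]_d) (w : word) : R :=
  n%:R^-1 * \sum_j monom w (x j) * f (x j).

(** The residual is the integral operator minus its empirical version, applied to [f]. Its expansion
    coefficients are [fmom - empf], so their weighted norm gives the dual bound that [eig_tail]
    takes. *)
Lemma eig_residual_bound n (x : 'I_n -> 'rV[R]_d) (a : 'cV[R]_n) B : (0 < n)%N ->
  (forall i, dotp (x i) (x i) = 1) ->
  (forall N, \sum_(k < N) kco R k * tnorm k (fun w => fmom w - empf x w) <= B) ->
  (dotv a (mu *: (\col_i f (x i)) - gram x *m (\col_i f (x i)))) ^+ 2 <=
    n%:R * B * quad (gram x) a.
Proof.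
move=> n0 x1 hB; rewrite mulrAC; have n0' : 0 < n%:R :> R by rewrite ltr0n.
apply: (kernel_CS n0 x1 hB) => e e0.
pose A := \sum_i `|a i 0| + 1; pose G := n%:R^-1 * \sum_i `|f (x i)| + 1.
have A0 : 0 < A by rewrite ltr_wpDl // sumr_ge0.
have G0 : 0 < G by rewrite ltr_wpDl // mulr_ge0 ?invr_ge0 // sumr_ge0.
have [N1 hN1] := eig_approx (divr_gt0 e0 (mulr_gt0 (ltr0n R 2) A0)).
have [N2 hN2] := @kap_unif R (e / (2 * A * G)) (divr_gt0 e0 (mulr_gt0 (mulr_gt0 (ltr0n R 2) A0) G0)).
exists (maxn N1 N2) => N; rewrite geq_max => /andP[h1 h2].
have E1 : \sum_(k < N) kco R k * tdot k (fun w => fmom w - empf x w) (vmom x (a ^~ 0)) =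
    \sum_i a i 0 * (\sum_(k < N) kco R k * pol k fmom (x i) -
       n%:R^-1 * \sum_j kap N (dotp (x i) (x j)) * f (x j)).
  under eq_bigr do rewrite tdot_vmom mulr_sumr.
  rewrite exchange_big /=; apply: eq_bigr => i _.
  have -> : n%:R^-1 * \sum_j kap N (dotp (x i) (x j)) * f (x j) =
     \sum_(k < N) kco R k * pol k (empf x) (x i).
    have Q k y : pol k (empf x) y = n%:R^-1 * \sum_j dotp y (x j) ^+ k * f (x j).
      rewrite /pol /empf.
      under eq_bigr do rewrite -mulrA mulr_suml.
      rewrite -mulr_sumr exchange_big /=; congr (_ * _); apply: eq_bigr => j _.
      by rewrite -sum_monom2 mulr_suml; apply: eq_bigr => w _; ring.
    under [RHS]eq_bigr do rewrite Q mulrCA.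
    rewrite -mulr_sumr; congr (_ * _).
    under [RHS]eq_bigr do rewrite mulr_sumr.
    rewrite [RHS]exchange_big /=; apply: eq_bigr => j _.
    by rewrite /kap mulr_suml; apply: eq_bigr => k _; rewrite mulrA.
  rewrite -sumrB mulr_sumr; apply: eq_bigr => k _.
  rewrite -mulrBr /pol -sumrB mulrCA; congr (_ * (_ * _)); apply: eq_bigr => w _.
  by rewrite mulrBl.
have E2 : dotv a (mu *: (\col_i f (x i)) - gram x *m (\col_i f (x i))) =
    \sum_i a i 0 * (mu * f (x i) - n%:R^-1 * \sum_j ker (dotp (x i) (x j)) * f (x j)).
  rewrite dotvE; apply: eq_bigr => i _; rewrite !mxE; congr (_ * (_ - _)).
  rewrite mulr_sumr; apply: eq_bigr => j _; rewrite !mxE Kker_ker; ring.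
rewrite E1 E2 -sumrB; apply: le_trans (ler_norm_sum _ _ _) _.
apply: (@le_trans _ _ (\sum_i `|a i 0| * (e / A))).
  apply: ler_sum => i _; rewrite -mulrBr normrM; apply: ler_wpM2l => //.
  set K1 := \sum_j ker _ * _; set K2 := \sum_j kap N _ * _.
  set S := \sum_(k < N) _.
  have -> : mu * f (x i) - n%:R^-1 * K1 - (S - n%:R^-1 * K2) =
    (mu * f (x i) - S) + n%:R^-1 * (K2 - K1) by ring.
  rewrite /K1 /K2 -sumrB; apply: le_trans (ler_normD _ _) _.
  have -> : e / A = e / (2 * A) + e / (2 * A) by field; exact: lt0r_neq0.
  apply: lerD; first exact: hN1.
  have -> : e / (2 * A) = e / (2 * A * G) * G by field; rewrite !lt0r_neq0.
  rewrite normrM ger0_norm ?invr_ge0 // /G.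
  have hs : `|\sum_j (kap N (dotp (x i) (x j)) * f (x j) - ker (dotp (x i) (x j)) * f (x j))| <=
     e / (2 * A * G) * \sum_j `|f (x j)|.
    apply: le_trans (ler_norm_sum _ _ _) _; rewrite mulr_sumr; apply: ler_sum => j _.
    rewrite -mulrBl normrM; apply: ler_wpM2r => //; rewrite distrC; apply: hN2 => //.
    exact: sphere_dotp_le1.
  apply: le_trans (ler_wpM2l _ hs) _; first by rewrite invr_ge0.
  rewrite mulrCA; apply: ler_wpM2l; last by rewrite lerDl.
  by rewrite ltW // divr_gt0 // !mulr_gt0.
rewrite -mulr_suml mulrA ler_pdivrMr // mulrC ler_pM2l // /A lerDl //.
Qed.

Variables (l : nat) (u : word -> R).
Hypothesis u_sym : tsym u.
Hypothesis f_pol : forall y, dotp y y = 1 -> f y = pol l u y.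
Hypothesis d_gt0 : (0 < d)%N.
Hypothesis l_d : (l.*2 <= d)%N.

Lemma tnorm_le_Ef2 : tnorm l u <= (2 * d%:R) ^+ l * Ef2.
Proof.
have -> : Ef2 = mform (smom P Z) l l u u.
  rewrite -smom_mform; apply: eq_Ex => om; rewrite f_pol // expr2 //.
apply: mform_lower => //.
- exact: smom_nil.
- exact: smom_perm.
- exact: smom_ibp.
- exact: smom_pos.
Qed.

(** Separates out the vanishing components, for which the eigenvalue equation says nothing about
    [mu]. *)
Lemma Ef2_eq0 : Ef2 = 0 -> forall y, dotp y y = 1 -> f y = 0.
Proof.
move=> E0 y y1; rewrite f_pol //.
have := tnorm_le_Ef2; rewrite E0 mulr0 => h.
have h0 : \sum_(w <- words d l) u w ^+ 2 == 0 by rewrite eq_le h tnorm_ge0.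
move: h0; rewrite psumr_eq0; last by move=> w _; exact: sqr_ge0.
move=> /allP h0; rewrite /pol big_seq big1 // => w /h0; rewrite sqrf_eq0 => /eqP ->.
by rewrite mul0r.
Qed.

(** The degree-[l] term of [fmom_bound] is enough: [Ef2] is the pairing of [u] with [fmom], and
    [mform_lower] bounds the norm of [u] by [Ef2]. *)
Lemma eig_lower_bound : Ef2 != 0 -> kco R l / (2 * d%:R) ^+ l <= mu.
Proof.
move=> E0; have E1 : 0 < Ef2 by rewrite lt_def E0 Ef2_ge0.
have D : 0 < (2 * d%:R) ^+ l :> R by rewrite exprn_gt0 // mulr_gt0 // ltr0n.
have hE : Ef2 = tdot l u fmom.
  rewrite /Ef2 /tdot (eq_Ex P (g := fun om => \sum_(w <- words d l) u w * (monom w (Z om) * f (Z om)))).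
    by rewrite Ex_sum; [apply: eq_bigr => w _; rewrite ExZ|move=> w; apply: bmZ; exact: bmf].
  move=> om; rewrite expr2 {1}f_pol // /pol mulr_suml.
  by apply: eq_bigr => w _; rewrite mulrA.
have h1 : Ef2 ^+ 2 <= tnorm l u * tnorm l fmom by rewrite {1}hE; exact: sum_CS.
have h2 : Ef2 <= (2 * d%:R) ^+ l * tnorm l fmom.
  rewrite -(ler_pM2l E1) -expr2; apply: le_trans h1 _.
  rewrite [leRHS]mulrCA mulrA; apply: ler_wpM2r; first exact: tnorm_ge0.
  exact: tnorm_le_Ef2.
have h3 : kco R l * tnorm l fmom <= mu * Ef2.
  apply: le_trans (fmom_bound l.+1); rewrite big_ord_recr /= lerDr.
  by apply: sumr_ge0 => i _; rewrite mulr_ge0 ?tnorm_ge0 // ltW // kco_gt0.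
rewrite ler_pdivrMr // -(ler_pM2r E1).
apply: (@le_trans _ _ (kco R l * ((2 * d%:R) ^+ l * tnorm l fmom))).
  by apply: ler_wpM2l => //; rewrite ltW // kco_gt0.
by rewrite mulrCA [leRHS]mulrAC [leRHS]mulrC; apply: ler_wpM2l => //; exact: ltW.
Qed.

End Eigenfunction.

(** * The good event *)

Section IndependentExpectation.
Context (R : realType) (dO : measure_display) (Om : measurableType dO)
  (P : probability Om R).
Variables (G1 G2 : set (set Om)).
Hypotheses (G1_sub : G1 `<=` measurable) (G1_I : setI_closed G1) (G1_T : G1 setT).
Hypotheses (G2_sub : G2 `<=` measurable) (G2_I : setI_closed G2) (G2_T : G2 setT).
Hypothesis G12 : forall A B, G1 A -> G2 B -> P (A `&` B) = (P A * P B)%E.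

Lemma Ex_indep_ge0 (f g : Om -> R) :
  measurable_fun setT (f : g_sigma_algebraType G1 -> R) ->
  measurable_fun setT (g : g_sigma_algebraType G2 -> R) ->
  bm f -> bm g -> (forall om, 0 <= f om) -> (forall om, 0 <= g om) ->
  Ex P (fun om => f om * g om) = Ex P f * Ex P g.
Proof.
move=> mf mg bf bg f0 g0.
have := @indep_integral_id R dO Om P G1 G2 (fun om om' => (f om * g om')%:E)
  G1_sub G1_I G1_T G2_sub G2_I G2_T G12.
have -> : (\int[P]_om \int[P]_om' (f om * g om')%:E = (Ex P f * Ex P g)%:E)%E.
  have E om : (\int[P]_om' (f om * g om')%:E = (Ex P g * f om)%:E)%E.
    by rewrite Ex_EFin; [rewrite ExZ // mulrC|exact: bmZ].
  under eq_integral do rewrite E.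
  by rewrite Ex_EFin; [rewrite ExZ // mulrC|exact: bmZ].
rewrite Ex_EFin; last exact: bmM.
move=> h; apply: EFin_inj; apply: h; last by move=> x y; rewrite lee_fin mulr_ge0.
apply/measurable_EFinP/measurable_funM.
  by apply: (measurableT_comp mf); exact: measurable_fst.
by apply: (measurableT_comp mg); exact: measurable_snd.
Qed.

(** Adding the bounds [M] and [N] makes both factors nonnegative, and the extra terms cancel. *)
Lemma Ex_indep (f g : Om -> R) :
  measurable_fun setT (f : g_sigma_algebraType G1 -> R) ->
  measurable_fun setT (g : g_sigma_algebraType G2 -> R) ->
  bm f -> bm g -> Ex P (fun om => f om * g om) = Ex P f * Ex P g.
Proof.
move=> mf mg bf bg; have [_ [M hM]] := bf; have [_ [N hN]] := bg.
have bM := bm_cst Om M; have bN := bm_cst Om N.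
have bfM : bm (fun om => f om + M) by exact: bmD.
have bgN : bm (fun om => g om + N) by exact: bmD.
have := @Ex_indep_ge0 (fun om => f om + M) (fun om => g om + N).
have -> : Ex P (fun om => (f om + M) * (g om + N)) =
    Ex P (fun om => f om * g om) + N * Ex P f + M * Ex P g + M * N.
  rewrite (eq_Ex P (g := fun om => f om * g om + N * f om + M * g om + M * N)); last first.
    by move=> om; ring.
  have b1 : bm (fun om => f om * g om) by exact: bmM.
  have b2 : bm (fun om => N * f om) by exact: bmZ.
  have b3 : bm (fun om => M * g om) by exact: bmZ.
  have b4 : bm (fun om => f om * g om + N * f om) by exact: bmD.
  have b5 : bm (fun om => f om * g om + N * f om + M * g om) by exact: bmD.
  rewrite ExD //; last exact: bm_cst.
  by rewrite ExD // ExD // ExZ // ExZ // Ex_cst.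
rewrite (ExD _ bf bM) (ExD _ bg bN) !Ex_cst => h.
have : Ex P (fun om => f om * g om) + N * Ex P f + M * Ex P g + M * N =
    (Ex P f + M) * (Ex P g + N).
  apply: h => //.
  - by apply: measurable_funD => //; exact: measurable_cst.
  - by apply: measurable_funD => //; exact: measurable_cst.
  - by move=> om; have := hM om; rewrite ler_norml => /andP[h _]; rewrite -lerBlDr sub0r.
  - by move=> om; have := hN om; rewrite ler_norml => /andP[h _]; rewrite -lerBlDr sub0r.
lra.
Qed.

End IndependentExpectation.

Section FeatureConcentration.
Context (R : realType) (dO : measure_display) (Om : measurableType dO)
  (P : probability Om R) (n d : nat)
  (X : 'I_n -> Om -> 'rV[R]_d) (w : 'I_n -> Om -> R).
Hypothesis hX : forall i, uniform_sphere_rv P (X i).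
Hypothesis mw : forall i, measurable_fun setT (w i).
Hypothesis hind : indep_sample P X w.

Variables (T : eqType) (g : T -> 'rV[R]_d -> R) (m : T -> R).
Hypothesis g_meas : forall a d1 (T1 : measurableType d1) (Y : T1 -> 'rV[R]_d),
  (forall k, measurable_fun setT (fun z => Y z 0 k)) -> measurable_fun setT (fun z => g a (Y z)).
Hypothesis g_bd : forall a, exists M, forall x, on_sphere x -> `|g a x| <= M.
Hypothesis g_mean : forall a j, Ex P (fun om => g a (X j om)) = m a.

(** Extended by 0 from [n] on, since the summands of [psq_tail] are indexed by natural numbers. *)
Let xi (j : nat) a om := if insub j is Some i then g a (X i om) - m a else 0.

Let past (k : nat) : set (set Om) := piX X (fun i : 'I_n => (i < k)%N).

Lemma bm_feature a i : bm (fun om => g a (X i om)).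
Proof.
split; first by apply: g_meas; exact: (hX i).1.
by have [M hM] := g_bd a; exists M => om; apply: hM; exact: (hX i).2.1.
Qed.

Let xi_bm j a : bm (xi j a).
Proof.
rewrite /xi; case: insub => [i|]; last exact: bm_cst.
by apply: bmB; [exact: bm_feature | exact: bm_cst].
Qed.

Let xi_meas (I : pred 'I_n) (i : 'I_n) a : I i ->
  measurable_fun setT (xi i a : g_sigma_algebraType (piX X I) -> R).
Proof.
move=> Ii; rewrite /xi valK; apply: measurable_funB; last exact: measurable_cst.
by apply: (g_meas a) => k; exact: (piX_coord_measurable hX).
Qed.

Lemma feature_tail (r : seq T) B L : (0 < n)%N -> 0 < B ->
  (forall x, on_sphere x -> \sum_(a <- r) g a x ^+ 2 <= B ^+ 2) ->
  (P [set om | (64 * n%:R * B ^+ 2 * L <= \sum_(a <- r) (\sum_i (g a (X i om) - m a)) ^+ 2)%R]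
    <= (2 * expR (- L))%:E)%E.
Proof.
move=> n0 B0 hB.
(* The mean has norm at most [B] by Jensen, so the centred vectors are bounded by [2 B]; this turns
   16 into 64. *)
have hm : \sum_(a <- r) m a ^+ 2 <= B ^+ 2.
  pose i0 := Ordinal n0.
  apply: (@le_trans _ _ (Ex P (fun om => \sum_(a <- r) g a (X i0 om) ^+ 2))).
    rewrite Ex_sum; last by move=> a; apply: bmX; exact: bm_feature.
    apply: ler_sum => a _; have bg := bm_feature a i0.
    have := Ex_ge0 P (f := fun om => (g a (X i0 om) - m a) ^+ 2) (fun om => sqr_ge0 _).
    rewrite (eq_Ex P (g := fun om => g a (X i0 om) ^+ 2 + ((- 2 * m a) * g a (X i0 om) + m a ^+ 2))); last first.
      by move=> om; ring.
    have b1 : bm (fun om => (- 2 * m a) * g a (X i0 om)) by exact: bmZ.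
    have b2 := bm_cst Om (m a ^+ 2).
    rewrite ExD; [|exact: bmX|exact: bmD].
    rewrite ExD // ExZ // Ex_cst g_mean; lra.
  rewrite -[leRHS](Ex_cst P); apply: Ex_le; last by move=> om; apply: hB; exact: (hX i0).2.1.
    by apply: bm_sum => a; apply: bmX; exact: bm_feature.
  exact: bm_cst.
have := @psq_tail R dO Om P T r xi (2 * B) n past xi_bm _ _ _ L n0.
have -> : [set om | 16 * n%:R * (2 * B) ^+ 2 * L <= psq r xi n om] =
    [set om | 64 * n%:R * B ^+ 2 * L <= \sum_(a <- r) (\sum_i (g a (X i om) - m a)) ^+ 2].
  have E om : psq r xi n om = \sum_(a <- r) (\sum_i (g a (X i om) - m a)) ^+ 2.
    apply: eq_bigr => a _; rewrite /psum; congr (_ ^+ 2); apply: eq_bigr => i _.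
    by rewrite /xi valK.
  by apply/seteqP; split => om /=; rewrite E
    (_ : 16 * n%:R * (2 * B) ^+ 2 * L = 64 * n%:R * B ^+ 2 * L) //; ring.
apply.
- move=> j om; rewrite /xi; case: insub => [i|]; last first.
    by rewrite big1 ?sqr_ge0 // => a _; rewrite expr0n.
  apply: (@le_trans _ _ (\sum_(a <- r) (2 * g a (X i om) ^+ 2 + 2 * m a ^+ 2))).
    by apply: ler_sum => a _; have := sqr_ge0 (g a (X i om) + m a); lra.
  rewrite big_split -!mulr_sumr exprMn /=.
  by have := hB _ ((hX i).2.1 om); lra.
- move=> k j a jk kn; have jn := leq_trans jk kn.
  exact: (@xi_meas _ (Ordinal jn) a jk).
- move=> k a f kn af bf; pose i := Ordinal kn.
  have Xm : Ex P (xi k a) = 0.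
    rewrite /xi (insubT (fun j => (j < n)%N) kn) ExB; [|exact: bm_feature|exact: bm_cst].
    by rewrite g_mean Ex_cst subrr.
  rewrite (@Ex_indep _ _ _ P (past k) (piX X (pred1 i))) ?Xm ?mulr0 //.
  - exact: (piX_sub hX).
  - exact: piX_setI.
  - exact: (piX_setT hX).
  - exact: (piX_sub hX).
  - exact: piX_setI.
  - exact: (piX_setT hX).
  - move=> A A' hA hA'; apply: (piX_indep hX mw hind _ hA hA') => j /=.
    by apply/negP => /andP[jk /eqP ji]; move: jk; rewrite ji ltnn.
  exact: (@xi_meas (pred1 i) i a (eqxx i)).
- by rewrite mulr_gt0.
Qed.

End FeatureConcentration.

Section GoodEvent.
Context (R : realType) (dO : measure_display) (Om : measurableType dO)
  (P : probability Om R) (n d : nat)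
  (X : 'I_n -> Om -> 'rV[R]_d) (w : 'I_n -> Om -> R).
Hypothesis hX : forall i, uniform_sphere_rv P (X i).
Hypothesis mw : forall i, measurable_fun setT (w i).
Hypothesis hind : indep_sample P X w.
Local Notation word := (seq 'I_d).

Variables (i0 : 'I_n) (k0 : nat) (gamma0 : R) (u : nat -> word -> R) (mu : nat -> R).
Hypothesis d_gt1 : (1 < d)%N.
Hypothesis gamma0_gt0 : 0 < gamma0.
Hypothesis mu_gt0 : forall l, (l <= k0)%N -> 0 < mu l.
Hypothesis f_eig : forall l, (l <= k0)%N -> forall y, dotp y y = 1 ->
  Ex P (fun om => ker (dotp y (X i0 om)) * pol l (u l) (X i0 om)) = mu l * pol l (u l) y.
Hypothesis f_gam : \sum_(l < k0.+1) Ef2 P (X i0) (pol l (u l)) / mu l <= gamma0 ^+ 2.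

Let n_gt0 : (0 < n)%N. Proof. exact: leq_ltn_trans (ltn_ord i0). Qed.
Let n0 : 0 < n%:R :> R. Proof. by rewrite ltr0n. Qed.

Lemma Ef2_mu_le l : (l <= k0)%N -> Ef2 P (X i0) (pol l (u l)) / mu l <= gamma0 ^+ 2.
Proof.
move=> lk; apply: le_trans f_gam.
rewrite (bigD1 (Ordinal (lk : l < k0.+1)%N)) //= lerDl; apply: sumr_ge0 => k _.
by rewrite divr_ge0 ?Ef2_ge0 // ltW // mu_gt0 // -ltnS.
Qed.

Lemma eigfun_le l y : (l <= k0)%N -> dotp y y = 1 -> pol l (u l) y ^+ 2 <= gamma0 ^+ 2.
Proof.
move=> lk y1; apply: le_trans (Ef2_mu_le lk).
by apply: (eig_sup_bound (hX i0) _ (mu_gt0 lk) (f_eig lk) y1); exact: bm_pol.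
Qed.

(** [None] marks the plain moments, [Some l] those weighted by the [l]-th target component. The
    factor [sqrt (kco k) / gamma0] makes the squared norm over all degrees at most 1 for each [l],
    so one vector collects everything. *)
Definition feat (a : option nat * word) (x : 'rV[R]_d) : R :=
  if a.1 is Some l then Num.sqrt (kco R (size a.2)) / gamma0 * (monom a.2 x * pol l (u l) x)
  else monom a.2 x.

Definition feat_mean (a : option nat * word) : R :=
  if a.1 is Some l then Num.sqrt (kco R (size a.2)) / gamma0 * fmom P (X i0) (pol l (u l)) a.2
  else smom P (X i0) a.2.

Definition feats N : seq (option nat * word) :=
  [seq (None, v) | p <- iota 0 (4 * k0 + 7), v <- words d p] ++
  [seq (Some l, v) | l <- iota 0 k0.+1, v <- flatten [seq words d k | k <- iota 0 N]].

Lemma sum_feats N (F : option nat * word -> R) : \sum_(a <- feats N) F a =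
  \sum_(p < 4 * k0 + 7) \sum_(v <- words d p) F (None, v) +
  \sum_(l < k0.+1) \sum_(k < N) \sum_(v <- words d k) F (Some (l : nat), v).
Proof.
rewrite /feats big_cat !big_allpairs_dep /=; congr (_ + _).
  by rewrite -(big_mkord xpredT (fun p => \sum_(v <- words d p) F (None, v))) /index_iota subn0.
rewrite -(big_mkord xpredT (fun l => \sum_(k < N) \sum_(v <- words d k) F (Some l, v))) /index_iota subn0.
apply: eq_bigr => l _; rewrite big_flatten big_map.
by rewrite -(big_mkord xpredT (fun k => \sum_(v <- words d k) F (Some l, v))) /index_iota subn0.
Qed.

Lemma monom_comp_measurable d1 (T1 : measurableType d1) (Y : T1 -> 'rV[R]_d) v :
  (forall k, measurable_fun setT (fun z => Y z 0 k)) -> measurable_fun setT (fun z => monom v (Y z)).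
Proof.
move=> mY; elim: v => [|k v IH].
  by under eq_fun do rewrite /monom big_nil; exact: measurable_cst.
by under eq_fun do rewrite monom_cons; exact: measurable_funM.
Qed.

Lemma feat_measurable a d1 (T1 : measurableType d1) (Y : T1 -> 'rV[R]_d) :
  (forall k, measurable_fun setT (fun z => Y z 0 k)) -> measurable_fun setT (fun z => feat a (Y z)).
Proof.
move=> mY; case: a => [[l|] v]; rewrite /feat /=; last exact: monom_comp_measurable.
apply: measurable_funM; first exact: measurable_cst.
apply: measurable_funM; first exact: monom_comp_measurable.
apply: measurable_sum => v'; apply: measurable_funM; first exact: measurable_cst.
exact: monom_comp_measurable.
Qed.

Lemma feat_bound a : exists M, forall x, on_sphere x -> `|feat a x| <= M.
Proof.
case: a => [[l|] v]; rewrite /feat /=; last first.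
  by exists 1 => x; exact: monom_le1.
exists (`|Num.sqrt (kco R (size v)) / gamma0| * (1 * \sum_(v' <- words d l) `|u l v'|)) => x x1.
rewrite !normrM; apply: ler_wpM2l; first by rewrite mulr_ge0.
apply: ler_pM => //; first exact: monom_le1.
apply: le_trans (ler_norm_sum _ _ _) _; apply: ler_sum => v' _.
by rewrite normrM -[leRHS]mulr1; apply: ler_wpM2l => //; exact: monom_le1.
Qed.

Lemma fmom_pol j l v : fmom P (X j) (pol l (u l)) v = \sum_(v' <- words d l) u l v' * smom P (X j) (v ++ v').
Proof.
rewrite /fmom (eq_Ex P (g := fun om => \sum_(v' <- words d l) u l v' * monom (v ++ v') (X j om))).
  rewrite Ex_sum; last by move=> v'; apply: bmZ; exact: (bm_monom (hX j)).
  by apply: eq_bigr => v' _; rewrite ExZ //; exact: (bm_monom (hX j)).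
by move=> om; rewrite /pol mulr_sumr; apply: eq_bigr => v' _; rewrite monom_cat; ring.
Qed.

Lemma feat_Ex a j : Ex P (fun om => feat a (X j om)) = feat_mean a.
Proof.
case: a => [[l|] v]; rewrite /feat /feat_mean /=; last exact: smom_unique.
rewrite ExZ; last by apply: bmM; [exact: (bm_monom (hX j))|exact: bm_pol].
congr (_ * _); rewrite -[LHS]/(fmom P (X j) _ v) !fmom_pol; apply: eq_bigr => v' _.
by rewrite (smom_unique d_gt1 (hX j) (hX i0)).
Qed.

(** There are [4 k0 + 7] plain degrees and [k0 + 1] weighted blocks, each of squared norm at most
    1. *)
Let B2 : R := (5 * k0 + 8)%:R.
Let B2_gt0 : 0 < B2. Proof. by rewrite ltr0n addn_gt0 orbT. Qed.

Lemma feats_sq N x : on_sphere x -> \sum_(a <- feats N) feat a x ^+ 2 <= Num.sqrt B2 ^+ 2.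
Proof.
move=> x1; rewrite sqr_sqrtr; last exact: ltW.
rewrite sum_feats.
have M2 k : \sum_(v <- words d k) monom v x ^+ 2 = 1.
  by under eq_bigr do rewrite expr2; rewrite sum_monom2 x1 expr1n.
rewrite (eq_bigr (fun=> 1)) => [|p _]; last by rewrite /feat /= M2.
rewrite sumr_const card_ord.
have h : \sum_(l < k0.+1) \sum_(k < N) \sum_(v <- words d k) feat (Some (l : nat), v) x ^+ 2 <= k0.+1%:R.
  rewrite -[X in _ <= X%:R]card_ord -sumr_const; apply: ler_sum => l _.
  apply: (@le_trans _ _ (\sum_(k < N) kco R k * 1)).
    apply: ler_sum => k _; rewrite /feat /=.
    rewrite -(M2 k) mulr_sumr big_seq [leRHS]big_seq; apply: ler_sum => v.
    rewrite mem_words => /eqP ->.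
    have c0 := kco_gt0 R k; have lk : (l <= k0)%N by rewrite -ltnS.
    rewrite !exprMn sqr_sqrtr; last exact: ltW.
    set m := monom v x; set q := pol l _ x.
    have -> : kco R k * gamma0^-1 ^+ 2 * (m ^+ 2 * q ^+ 2) =
      kco R k * (m ^+ 2 * (q ^+ 2 * gamma0^-1 ^+ 2)) by ring.
    apply: ler_wpM2l; first exact: ltW.
    rewrite -[leRHS]mulr1; apply: ler_wpM2l; first exact: sqr_ge0.
    by rewrite exprVn ler_pdivrMr ?exprn_gt0 // mul1r; exact: eigfun_le.
  have := kap1_le1 R N; rewrite /kap; apply: le_trans.
  by apply: ler_sum => k _; rewrite expr1n.
have -> : B2 = 1 *+ (4 * k0 + 7) + k0.+1%:R.
  by rewrite -mulrnDr /B2; congr (_ *+ _); lia.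
by rewrite lerD2l.
Qed.

Definition dev N om : R := \sum_(a <- feats N) (\sum_i (feat a (X i om) - feat_mean a)) ^+ 2.
(** The events increase with [N], so the union over all truncations has the same probability bound
    as each of them. *)
Definition bad L : set Om := \bigcup_N [set om | 64 * n%:R * B2 * L <= dev N om].

Lemma dev_measurable N : measurable_fun setT (dev N).
Proof.
apply: measurable_sum => a; apply: measurable_funX; apply: measurable_sum => i.
by apply: measurable_funB; [apply: feat_measurable; exact: (hX i).1 | exact: measurable_cst].
Qed.

Lemma bad_level_measurable L N : measurable [set om | 64 * n%:R * B2 * L <= dev N om].
Proof.
have mN : measurable_fun setT (fun om => - dev N om) by apply: measurableT_comp => //; exact: dev_measurable.
have := le_set_measurable (- (64 * n%:R * B2 * L)) mN.
by congr measurable; apply/seteqP; split => om /=; rewrite lerN2.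
Qed.

Lemma bad_measurable L : measurable (bad L).
Proof. by apply: bigcupT_measurable => N; exact: bad_level_measurable. Qed.

Lemma P_bad L : (P (bad L) <= (2 * expR (- L))%:E)%E.
Proof.
have nd : nondecreasing_seq (fun N => [set om | 64 * n%:R * B2 * L <= dev N om]).
  move=> N N' NN; apply/subsetPset => om /= h; apply: le_trans h _.
  rewrite /dev !sum_feats lerD2l; apply: ler_sum => l _.
  rewrite (big_ord_widen N' (fun k => \sum_(v <- words d k)
    (\sum_i (feat (Some (l : nat), v) (X i om) - feat_mean (Some (l : nat), v))) ^+ 2) NN).
  rewrite big_mkcond /=; apply: ler_sum => k _; case: ifP => // _.
  by apply: sumr_ge0 => v _; exact: sqr_ge0.
have cv : P [set om | 64 * n%:R * B2 * L <= dev N om] @[N --> \oo] --> P (bad L).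
  exact: (nondecreasing_cvg_mu (bad_level_measurable L) (bad_measurable L) nd).
apply: (cvge_to_le cv); near=> N.
have := @feature_tail R dO Om P n d X w hX mw hind _ feat feat_mean
  feat_measurable feat_bound feat_Ex (feats N) (Num.sqrt B2) L n_gt0.
have s2 : Num.sqrt B2 ^+ 2 = B2 by rewrite sqr_sqrtr // ltW.
rewrite sqrtr_gt0 B2_gt0 s2; apply => // x x1.
by rewrite -s2; exact: feats_sq.
Unshelve. all: by end_near. Qed.

Section GoodOutcome.
Variables (L : R) (om : Om).
Hypothesis om_good : ~ bad L om.
Hypothesis L_ge0 : 0 <= L.
Let x i := X i om.
Definition esq : R := 64 * B2 * L / n%:R.

Lemma dev_lt N : dev N om <= n%:R ^+ 2 * esq.
Proof.
have -> : n%:R ^+ 2 * esq = 64 * n%:R * B2 * L by rewrite /esq; field; exact: lt0r_neq0.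
by rewrite leNgt; apply/negP => h; apply: om_good; exists N => //=; exact: ltW.
Qed.

Lemma esq_ge0 : 0 <= esq.
Proof. by rewrite divr_ge0 // !mulr_ge0 // ltW. Qed.

Lemma good_emp p : (p <= 4 * k0 + 6)%N ->
  \sum_(v <- words d p) (emp x v - smom P (X i0) v) ^+ 2 <= esq.
Proof.
move=> hp; have n2 : 0 < n%:R ^+ 2 :> R by rewrite exprn_gt0.
rewrite -(ler_pM2l n2); apply: le_trans (dev_lt 0); rewrite /dev sum_feats.
rewrite [X in _ <= _ + X]big1 ?addr0; last by move=> l _; rewrite big_ord0.
have pp : (p < 4 * k0 + 7)%N by rewrite addnS ltnS.
rewrite (bigD1 (Ordinal pp)) //= -[leLHS]addr0; apply: lerD; last first.
  by apply: sumr_ge0 => k _; apply: sumr_ge0 => v _; exact: sqr_ge0.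
rewrite mulr_sumr; apply: ler_sum => v _; rewrite /feat /feat_mean /= sumrB sumr_const card_ord.
apply: eq_ler; rewrite -exprMn; congr (_ ^+ 2).
by rewrite /emp mulrBr mulVKf ?lt0r_neq0 // mulr_natl.
Qed.

Lemma good_empf l N : (l <= k0)%N ->
  \sum_(k < N) kco R k * tnorm k (fun v => fmom P (X i0) (pol l (u l)) v - empf (pol l (u l)) x v)
    <= gamma0 ^+ 2 * esq.
Proof.
move=> lk; have n2 : 0 < n%:R ^+ 2 :> R by rewrite exprn_gt0.
have g2 : 0 < gamma0 ^+ 2 by rewrite exprn_gt0.
rewrite -ler_pdivrMl // -(ler_pM2l n2); apply: le_trans (dev_lt N); rewrite /dev sum_feats.
rewrite -[leLHS]add0r; apply: lerD.
  by apply: sumr_ge0 => k _; apply: sumr_ge0 => v _; exact: sqr_ge0.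
rewrite (bigD1 (Ordinal (lk : l < k0.+1)%N)) //= -[leLHS]addr0; apply: lerD; last first.
  by apply: sumr_ge0 => k _; apply: sumr_ge0 => k' _; apply: sumr_ge0 => v _; exact: sqr_ge0.
rewrite !mulr_sumr; apply: ler_sum => k _.
rewrite /tnorm !mulr_sumr big_seq [leRHS]big_seq; apply: ler_sum => v.
rewrite mem_words => /eqP sv; rewrite /feat /feat_mean /= sv.
under eq_bigr do rewrite -mulrBr.
rewrite -mulr_sumr sumrB sumr_const card_ord.
have c0 := kco_gt0 R k.
rewrite exprMn exprMn sqr_sqrtr; last exact: ltW.
rewrite exprVn.
rewrite /empf; set S := \sum_i _ * _; set m := fmom _ _ _ _.
apply: eq_ler; rewrite -(mulr_natl m).
have -> : S - n%:R * m = n%:R * (n%:R^-1 * S - m) by rewrite mulrBr mulVKf ?lt0r_neq0.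
rewrite exprMn.
have -> : (m - n%:R^-1 * S) ^+ 2 = (n%:R^-1 * S - m) ^+ 2 by ring.
ring.
Qed.

End GoodOutcome.
End GoodEvent.

(** * Eigenvalues of the Gram matrix of a good sample *)

Section GramSpectrum.
Variables (R : realType) (d n : nat) (x : 'I_n -> 'rV[R]_d) (U : 'M[R]_n) (lam : 'I_n -> R).
Hypothesis n_gt0 : (0 < n)%N.
Hypothesis x_sphere : forall i, dotp (x i) (x i) = 1.
Hypothesis hdec : sorted_eigdec (gram x) U lam.

Let hU : U *m U^T = 1%:M. Proof. by case: hdec. Qed.
Let hS : forall i j : 'I_n, (i <= j)%N -> lam j <= lam i. Proof. by case: hdec. Qed.
Let hA : gram x = spec_mx U lam. Proof. by case: hdec. Qed.

Lemma gram_eig_quad i : quad (gram x) (U *m delta_mx i 0) = lam i.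
Proof.
rewrite hA (quad_coef hU) (bigD1 i) //= big1 => [|j ji].
  by rewrite (coef_col hU) mxE !eqxx /= expr1n mulr1 addr0.
by rewrite (coef_col hU) mxE (negbTE ji) expr0n mulr0.
Qed.

Lemma gram_eig_ge0 i : 0 <= lam i.
Proof. by rewrite -gram_eig_quad quad_gram_ge0. Qed.

Lemma gram_eig_le1 i : lam i <= 1.
Proof.
rewrite -gram_eig_quad; apply: le_trans (quad_gram_le n_gt0 x_sphere _) _.
rewrite (sqn_coef hU) (bigD1 i) //= big1 => [|j ji].
  by rewrite (coef_col hU) mxE !eqxx /= expr1n addr0.
by rewrite (coef_col hU) mxE (negbTE ji) expr0n.
Qed.

Lemma gram_eig_sum : \sum_i lam i = 1.
Proof.
transitivity (\tr (gram x)).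
  rewrite hA /spec_mx -mulmxA mxtrace_mulC -mulmxA (orth_tr hU) mulmx1 mxtrace_diag.
  by apply: eq_bigr => i _; rewrite mxE.
rewrite /mxtrace (eq_bigr (fun=> n%:R^-1)).
  by rewrite sumr_const card_ord -(mulr_natl n%:R^-1) mulfV // pnatr_eq0 -lt0n.
by move=> i _; rewrite mxE Kker_ker x_sphere ker1 mul1r.
Qed.

Definition gram_filter N : 'M[R]_n := 1%:M - (1%:M - gram x) ^+ N.

(** From [f <= 1] and [f <= N lam] follows [f^2 <= N lam], and the eigenvalues sum to the trace,
    which is 1. *)
Lemma gram_filter_spec N : exists f, [/\ gram_filter N = spec_mx U f,
  forall i, 0 <= f i <= 1 & \sum_i f i ^+ 2 <= N%:R].
Proof.
exists (fun i => 1 - (1 - lam i) ^+ N); split.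
- by rewrite /gram_filter hA (spec_mxB1 hU) (spec_mx_exp hU) (spec_mxB1 hU).
- move=> i; have h : 0 <= (1 - lam i) ^+ N <= 1.
    have h0 := gram_eig_ge0 i; have h1 := gram_eig_le1 i.
    by rewrite exprn_ge0 ?subr_ge0 //= exprn_ile1 ?subr_ge0 // gerBl.
  by case/andP: h => *; apply/andP; split; lra.
rewrite -[leRHS]mulr1 -[X in _ <= _ * X]gram_eig_sum mulr_sumr; apply: ler_sum => i _.
have h0 := gram_eig_ge0 i; have h1 := gram_eig_le1 i.
have b : 1 - (1 - lam i) ^+ N <= N%:R * lam i.
  elim: N => [|N IH]; first by rewrite expr0 subrr mul0r.
  rewrite exprS -natr1 mulrDl mul1r; set p := (1 - lam i) ^+ N in IH *.
  have p0 : 0 <= p by rewrite exprn_ge0 // subr_ge0.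
  have : p <= 1 by rewrite exprn_ile1 ?subr_ge0 // gerBl.
  by move=> p1; nra.
apply: le_trans _ b; set f := 1 - _.
have f0 : 0 <= f by rewrite subr_ge0 exprn_ile1 ?subr_ge0 // gerBl.
have f1 : f <= 1 by rewrite /f gerBl exprn_ge0 // subr_ge0.
by rewrite expr2 -[leRHS]mulr1 ler_wpM2l.
Qed.

Section Bounds.
Variables (mom : seq 'I_d -> R) (e : R).
Hypothesis d_gt1 : (1 < d)%N.
Hypothesis mom_nil : mom [::] = 1.
Hypothesis mom_perm : tsym mom.
Hypothesis mom_ibp : forall a w,
  (d%:R + (size w)%:R - 1) * mom (a :: w) = (count_mem a w)%:R * mom (rem a w).
Hypothesis mom_pos : forall r : seq (seq 'I_d * R),
  0 <= \sum_(p <- r) \sum_(q <- r) p.2 * q.2 * mom (p.1 ++ q.1).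
Hypothesis e_ge0 : 0 <= e.
Variable k0 : nat.
Hypothesis k0_gt0 : (0 < k0)%N.
Hypothesis cl : forall p, (p <= 4 * k0 + 6)%N -> moment_close x mom e p.
Hypothesis k0_d : (k0.*2 <= d)%N.
Hypothesis e_small : 4 * e <= ((2 * d%:R) ^+ k0)^-1.

Let rE : size (basis_words d k0) = r0 d k0.
Proof. by apply: size_basis_words => //; exact: ltnW. Qed.

Lemma gram_eig_top c0 (i : 'I_n) : 0 <= c0 -> c0 <= kco R k0 -> c0 <= kco R k0.-1 ->
  (i < r0 d k0)%N -> c0 * (((2 * d%:R) ^+ k0)^-1 / 2) <= lam i.
Proof.
move=> c00 c01 c02; rewrite -rE; apply: (eig_lower hU hS (B := basis_mx x k0)).
  by move=> c; apply: (basis_mx_free n_gt0 d_gt1 mom_nil mom_perm mom_ibp mom_pos e_ge0 k0_gt0 cl).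
move=> c; rewrite -hA.
exact: (quad_gram_lower n_gt0 x_sphere d_gt1 mom_nil mom_perm mom_ibp mom_pos e_ge0 k0_gt0 cl).
Qed.

(** A vector killed by [basis_mx] has vanishing moments on sorted words; symmetry of [vmom] extends
    this to all words of the two degrees. *)
Lemma gram_eig_bottom (i : 'I_n) : (r0 d k0 <= i)%N -> lam i <= 2 * upb d e k0.
Proof.
rewrite -rE; apply: (eig_upper hU hS (B := basis_mx x k0)) => v Bv; rewrite -hA.
apply: (quad_gram_upper n_gt0 x_sphere d_gt1 mom_nil mom_perm mom_ibp mom_pos e_ge0 k0_gt0 cl).
have Z s : s \in basis_words d k0 -> vmom x (v ^~ 0) s = 0.
  move=> sb; have hi : (index s (basis_words d k0) < size (basis_words d k0))%N by rewrite index_mem.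
  have /colP/(_ (Ordinal hi)) := Bv; rewrite [LHS]mxE [RHS]mxE => h; rewrite -[RHS]h.
  by apply: eq_bigr => j _; rewrite mxE /= nth_index // mulrC.
move=> s /orP[/eqP sk|/eqP sk]; have [s' hs' ss'] := sort_word sk;
  rewrite -(@vmom_sym _ _ _ x _ _ _ ss') Z // mem_cat hs' ?orbT //.
Qed.

End Bounds.
End GramSpectrum.

(** * Error bound *)

Lemma sqr_sum_le (R : realType) m (a : 'I_m -> R) :
  (\sum_i a i) ^+ 2 <= m%:R * \sum_i a i ^+ 2.
Proof.
have := sum_CS (index_enum 'I_m) (fun=> 1) a.
under eq_bigr do rewrite mul1r.
by under [X in _ <= X * _]eq_bigr do rewrite expr1n; rewrite sumr_const card_ord.
Qed.

Section TargetBounds.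
Context (R : realType) (dO : measure_display) (Om : measurableType dO)
  (P : probability Om R) (n d : nat)
  (X : 'I_n -> Om -> 'rV[R]_d).
Hypothesis hX : forall i, uniform_sphere_rv P (X i).
Local Notation word := (seq 'I_d).
Variables (i0 : 'I_n) (k0 : nat) (gamma0 : R) (u : nat -> word -> R) (mu : nat -> R).
Hypothesis d_gt1 : (1 < d)%N.
Hypothesis gamma0_gt0 : 0 < gamma0.
Hypothesis u_sym : forall l, tsym (u l).
Hypothesis mu_gt0 : forall l, (l <= k0)%N -> 0 < mu l.
Hypothesis f_eig : forall l, (l <= k0)%N -> forall y, dotp y y = 1 ->
  Ex P (fun om => ker (dotp y (X i0 om)) * pol l (u l) (X i0 om)) = mu l * pol l (u l) y.
Hypothesis f_gam : \sum_(l < k0.+1) Ef2 P (X i0) (pol l (u l)) / mu l <= gamma0 ^+ 2.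

Variables (x : 'I_n -> 'rV[R]_d) (es c : R) (U : 'M[R]_n) (lam : 'I_n -> R).
Hypothesis x_sphere : forall i, dotp (x i) (x i) = 1.
Hypothesis hdec : sorted_eigdec (gram x) U lam.
Hypothesis es_ge0 : 0 <= es.
Hypothesis x_emp : forall p, (p <= 4 * k0 + 6)%N -> moment_close x (smom P (X i0)) es p.
Hypothesis x_empf : forall l N, (l <= k0)%N ->
  \sum_(k < N) kco R k * tnorm k (fun v => fmom P (X i0) (pol l (u l)) v - empf (pol l (u l)) x v)
    <= gamma0 ^+ 2 * es ^+ 2.
Hypothesis k0_gt0 : (0 < k0)%N.
Hypothesis k0_d : (k0.*2 <= d)%N.
Let th1 : R := ((2 * d%:R) ^+ k0)^-1.
Hypothesis es_small : 4 * es <= th1.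
Hypothesis c_gt0 : 0 < c.
Hypothesis c_kco : forall l, (l <= k0)%N -> c <= kco R l.
Hypothesis up_small : 2 * upb d es k0 <= c * th1 / 2.

Let n_gt0 : (0 < n)%N. Proof. exact: leq_ltn_trans (ltn_ord i0). Qed.
Let d_gt0 : (0 < d)%N. Proof. exact: ltnW. Qed.
Let n0 : 0 < n%:R :> R. Proof. by rewrite ltr0n. Qed.
Let d2 : 0 < 2 * d%:R :> R. Proof. by rewrite mulr_gt0 // ltr0n. Qed.
Let th1_gt0 : 0 < th1. Proof. by rewrite invr_gt0 exprn_gt0. Qed.
Let hU : U *m U^T = 1%:M. Proof. by case: hdec. Qed.
Let hS : forall i j : 'I_n, (i <= j)%N -> lam j <= lam i. Proof. by case: hdec. Qed.
Let hA : gram x = spec_mx U lam. Proof. by case: hdec. Qed.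

Let F l : 'cV[R]_n := \col_i pol l (u l) (x i).
Definition target : 'cV[R]_n := \col_i \sum_(l < k0.+1) pol l (u l) (x i).

Lemma targetE : target = \sum_(l < k0.+1) F l.
Proof. by apply/colP => i; rewrite summxE mxE; apply: eq_bigr => l _; rewrite mxE. Qed.

Lemma lam_top (i : 'I_n) : (i < r0 d k0)%N -> c * (th1 / 2) <= lam i.
Proof.
move=> ir.
exact: (gram_eig_top n_gt0 x_sphere hdec d_gt1 (smom_nil P (X i0)) (smom_perm P (X i0))
  (smom_ibp (hX i0)) (smom_pos (hX i0)) es_ge0 k0_gt0 x_emp k0_d es_small (ltW c_gt0)
  (c_kco (leqnn k0)) (c_kco (leq_pred k0)) ir).
Qed.

Lemma lam_bottom (i : 'I_n) : (r0 d k0 <= i)%N -> lam i <= c * th1 / 2.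
Proof.
move=> ri; apply: le_trans up_small.
exact: (gram_eig_bottom n_gt0 x_sphere hdec d_gt1 (smom_nil P (X i0)) (smom_perm P (X i0))
  (smom_ibp (hX i0)) (smom_pos (hX i0)) es_ge0 k0_gt0 x_emp ri).
Qed.

(** A nonvanishing component has [mu l >= c th1], so the eigenvalues from [r0] on, at most
    [c th1 / 2], are at most [mu l / 2] as [eig_tail] requires. *)
Lemma component_tail l : (l <= k0)%N ->
  \sum_(i : 'I_n | (r0 d k0 <= i)%N) coef U (F l) i ^+ 2 <=
    2 * (n%:R * (gamma0 ^+ 2 * es ^+ 2)) / (c * th1).
Proof.
move=> lk; have m0 := mu_gt0 lk; have bf := bm_pol (hX i0) l (u l).
have E0 : 0 <= n%:R * (gamma0 ^+ 2 * es ^+ 2).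
  by apply: mulr_ge0 => //; apply: mulr_ge0; exact: sqr_ge0.
have R0 : 0 <= 2 * (n%:R * (gamma0 ^+ 2 * es ^+ 2)) / (c * th1).
  by rewrite divr_ge0 ?mulr_ge0 // ?ltW // mulr_gt0.
have ld : (l.*2 <= d)%N by apply: leq_trans k0_d; rewrite leq_double.
have [Z|Z] := eqVneq (Ef2 P (X i0) (pol l (u l))) 0.
  have F0 : F l = 0.
    apply/colP => i; rewrite !mxE.
    exact: (Ef2_eq0 (hX i0) (u_sym l) (fun y _ => erefl) d_gt0 ld Z).
  rewrite F0 big1 // => i _; rewrite /coef mulmx0 mxE expr0n //.
have hm : c * th1 <= mu l.
  have := eig_lower_bound (hX i0) bf (f_eig lk) (u_sym l) (fun y _ => erefl) d_gt0 ld Z.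
  apply: le_trans; apply: ler_pM; [exact: ltW|exact: ltW|exact: c_kco|].
  rewrite /th1 lef_pV2 ?posrE ?exprn_gt0 // ler_weXn2l //.
  by have : 1 <= d%:R :> R by [rewrite ler1n]; lra.
apply: (@le_trans _ _ (2 * (n%:R * (gamma0 ^+ 2 * es ^+ 2)) / mu l)).
  apply: (eig_tail hU (lam := lam) (D := mu l *: F l - gram x *m F l)) => //.
  - by rewrite -hA opprB addrC subrK.
  - move=> i ri; apply: le_trans (lam_bottom ri) _.
    by rewrite ler_pM2r ?invr_gt0.
  move=> a; rewrite -hA.
  apply: (eig_residual_bound (hX i0) bf (f_eig lk)) => // N.
  exact: x_empf.
apply: ler_wpM2l; first by rewrite mulr_ge0.
by rewrite lef_pV2 ?posrE // mulr_gt0.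
Qed.

Lemma target_tail :
  \sum_(i : 'I_n | (r0 d k0 <= i)%N) coef U target i ^+ 2 <=
    k0.+1%:R ^+ 2 * (2 * (n%:R * (gamma0 ^+ 2 * es ^+ 2)) / (c * th1)).
Proof.
apply: (@le_trans _ _ (k0.+1%:R * \sum_(l < k0.+1) \sum_(i : 'I_n | (r0 d k0 <= i)%N) coef U (F l) i ^+ 2)).
  rewrite exchange_big mulr_sumr; apply: ler_sum => i _ /=.
  have -> : coef U target i = \sum_(l < k0.+1) coef U (F l) i.
    by rewrite targetE /coef mulmx_sumr summxE.
  exact: sqr_sum_le.
rewrite expr2 -mulrA; apply: ler_wpM2l => //.
rewrite mulr_natl -[X in _ *+ X]card_ord -sumr_const; apply: ler_sum => l _.
by apply: component_tail; rewrite -ltnS.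
Qed.

Lemma target_top a : dotv a target ^+ 2 <= n%:R * (k0.+1%:R * gamma0 ^+ 2) * quad (gram x) a.
Proof.
have q0 : 0 <= quad (gram x) a by exact: quad_gram_ge0.
have -> : dotv a target = \sum_(l < k0.+1) dotv a (F l).
  by rewrite targetE /dotv mulmx_sumr summxE.
apply: le_trans (sqr_sum_le _) _.
apply: (@le_trans _ _ (k0.+1%:R * \sum_(l < k0.+1) n%:R * quad (gram x) a *
    (Ef2 P (X i0) (pol l (u l)) / mu l))).
  apply: ler_wpM2l => //; apply: ler_sum => l _; have lk : (l <= k0)%N by rewrite -ltnS.
  have -> : dotv a (F l) = \sum_i a i 0 * pol l (u l) (x i).
    by rewrite dotvE; apply: eq_bigr => i _; rewrite mxE.
  by apply: (eig_eval_bound (hX i0) (bm_pol (hX i0) l (u l)) (mu_gt0 lk) (f_eig lk)).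
rewrite -mulr_sumr.
have -> : n%:R * (k0.+1%:R * gamma0 ^+ 2) * quad (gram x) a =
  k0.+1%:R * (n%:R * quad (gram x) a * gamma0 ^+ 2) by ring.
apply: ler_wpM2l => //; apply: ler_wpM2l => //.
by rewrite mulr_ge0.
Qed.

Lemma gd_sample_error (eta s tau : R) (Nf t : nat) (wS e2 : 'cV[R]_n) :
  let M := 1%:M - eta *: (gram x *m topproj (r0 d k0) U) in
  0 < eta < 1 -> (0 < t)%N -> 1 <= Nf%:R * (c * (th1 / 2)) ->
  sqn (gram_filter x Nf *m wS) <= s -> sqn e2 <= tau ->
  sqn ((wS - M ^+ t *m wS) + (- (M ^+ t *m target)) + e2) <=
    3 * (4 * s + (n%:R * (k0.+1%:R * gamma0 ^+ 2) / (2 * eta * t%:R) +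
      k0.+1%:R ^+ 2 * (2 * (n%:R * (gamma0 ^+ 2 * es ^+ 2)) / (c * th1))) + tau).
Proof.
move=> M heta t0 hN hs he; rewrite /M hA.
have th0 : 0 < c * (th1 / 2) by rewrite mulr_gt0 // divr_gt0.
apply: (gd_error_bound hU (gram_eig_le1 n_gt0 x_sphere hdec) th0 lam_top) => //.
- by apply: mulr_ge0 => //; apply: mulr_ge0 => //; exact: sqr_ge0.
- apply: le_trans (top_coef_filter hU (gram_eig_le1 n_gt0 x_sphere hdec) th0 lam_top wS hN) _.
  by rewrite -hA; apply: ler_wpM2l.
- by rewrite -hA; exact: target_top.
exact: target_tail.
Qed.

End TargetBounds.

Lemma size_words d k : size (words d k) = (d ^ k)%N.
Proof.
elim: k => [|k IH] //=; rewrite size_allpairs IH -cardE card_ord expnS //.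
Qed.

Lemma r0_le d k : (0 < d)%N -> (0 < k)%N -> (r0 d k <= 2 * d ^ k)%N.
Proof.
move=> d0 k0; rewrite -size_basis_words // size_cat mul2n -addnn.
have h l : (size (sorted_words d l) <= d ^ l)%N.
  by rewrite /sorted_words size_filter -size_words count_size.
apply: leq_add; first exact: h.
by apply: leq_trans (h _) _; rewrite leq_pexp2l // leq_pred.
Qed.

Section TargetPolynomials.
Context (R : realType) (dO : measure_display) (Om : measurableType dO)
  (P : probability Om R) (d : nat) (Z : Om -> 'rV[R]_d).
Hypothesis hZ : uniform_sphere_rv P Z.

Lemma target_cond_pol k0 gamma0 fstar : target_cond P Z k0 gamma0 fstar ->
  exists (u : nat -> seq 'I_d -> R) (mu : nat -> R),
  [/\ forall l, tsym (u l), forall l, (l <= k0)%N -> 0 < mu l,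
     forall l, (l <= k0)%N -> forall y, dotp y y = 1 ->
       Ex P (fun om => ker (dotp y (Z om)) * pol l (u l) (Z om)) = mu l * pol l (u l) y,
     \sum_(l < k0.+1) Ef2 P Z (pol l (u l)) / mu l <= gamma0 ^+ 2 &
     forall x, dotp x x = 1 -> fstar x = \sum_(l < k0.+1) pol l (u l) x].
Proof.
move=> [fl [mu [hl [hf hg]]]].
have /choice[u hu] : forall l, exists u : seq 'I_d -> R, tsym u /\
    ((l <= k0)%N -> forall x, dotp x x = 1 -> fl l x = pol l u x).
  move=> l; have [lk|lk] := leqP l k0; last first.
    by exists (fun=> 0); split => //.
  have [[c [_ hc]] _ _] := hl l lk; have [u su eu] := homog_poly_pol c.
  by exists u; split => // _ x x1; rewrite hc // eu.
have Z1 om : dotp (Z om) (Z om) = 1 by exact: hZ.2.1.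
have lt l : (l < k0.+1)%N -> (l <= k0)%N by rewrite ltnS.
exists u, mu; split.
- by move=> l; case: (hu l).
- by move=> l lk; case: (hl l lk).
- move=> l lk y y1; have [_ _ /(_ y y1) h] := hl l lk.
  have [_ /(_ lk) e] := hu l; apply: EFin_inj; rewrite -e // -h -Ex_EFin.
    by apply: eq_integral => om _; rewrite e.
  by apply: bmM; [exact: (bm_ker hZ y1) | exact: (bm_pol hZ)].
- rewrite -lee_fin; apply: le_trans hg; rewrite -sumEFin; apply: lee_sum => l _.
  have lk := lt _ (ltn_ord l); have [_ /(_ lk) e] := hu l.
  have b2 : bm (fun om => pol l (u l) (Z om) ^+ 2) by apply: bmX; exact: (bm_pol hZ).
  have -> : Ef2 P Z (pol l (u l)) / mu l = Ex P (fun om => (mu l)^-1 * pol l (u l) (Z om) ^+ 2).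
    by rewrite ExZ // mulrC.
  rewrite -Ex_EFin; last exact: bmZ.
  rewrite le_eqVlt; apply/orP; left; apply/eqP.
  by apply: eq_integral => om _; rewrite e // mulrC.
move=> x x1; rewrite hf //; apply: eq_bigr => l _.
by have [_ /(_ (lt _ (ltn_ord l))) ->] := hu l.
Qed.

End TargetPolynomials.

Section FilterMeasurability.
Context (R : realType) (dO : measure_display) (Om : measurableType dO)
  (P : probability Om R) (n d : nat) (X : 'I_n -> Om -> 'rV[R]_d).
Hypothesis hX : forall i, uniform_sphere_rv P (X i).

Lemma gram_filter_measurable N i j : measurable_fun setT
  ((fun om => gram_filter (fun i => X i om) N i j) : g_sigma_algebraType (piX X predT) -> R).
Proof.
pose T := g_sigma_algebraType (piX X predT).
have mX a k : measurable_fun setT ((fun om => X a om 0 k) : T -> R).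
  exact: (piX_coord_measurable hX).
have mG a b : measurable_fun setT ((fun om => (1%:M - gram (fun i => X i om)) a b) : T -> R).
  under eq_fun do rewrite !mxE.
  apply: measurable_funB; first exact: measurable_cst.
  apply: measurable_funM; last exact: measurable_cst.
  under eq_fun do rewrite Kker_ker.
  apply: ker_measurable; last by move=> om; apply: sphere_dotp_le1; [exact: (hX a).2.1|exact: (hX b).2.1].
  by apply: measurable_sum => k; apply: measurable_funM; exact: mX.
have mE a b : measurable_fun setT ((fun om => ((1%:M - gram (fun i => X i om)) ^+ N) a b) : T -> R).
  elim: N a b => [|N IH] a b.
    by under eq_fun do rewrite expr0; exact: measurable_cst.
  under eq_fun do rewrite exprS mxE.
  by apply: measurable_sum => k; apply: measurable_funM.
under eq_fun do rewrite /gram_filter mxE [X in _ + X]mxE.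
by apply: measurable_funB; [exact: measurable_cst | exact: mE].
Qed.

Lemma gram_filter_noise_measurable (w : 'I_n -> Om -> R) N :
  (forall i, measurable_fun setT (w i)) -> measurable_fun setT
  (fun om => sqn (gram_filter (fun i => X i om) N *m \col_i w i om)).
Proof.
move=> mw; have mF i j : measurable_fun setT (fun om => gram_filter (fun i => X i om) N i j).
  move=> _ A mA; have := gram_filter_measurable N i j measurableT mA.
  rewrite !setTI => hm; have := @sigma_sub_measurable _ _ _ (@piX_sub _ _ _ _ _ _ _ hX predT) => /(_ _ hm) hq.
  exact: hq.
apply: measurable_sum => i; apply: measurable_funX; under eq_fun do rewrite mxE.
apply: measurable_sum => j; apply: measurable_funM; first exact: mF.
by under eq_fun do rewrite mxE; exact: mw.
Qed.

End FilterMeasurability.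

(** * Choice of constants *)

Section Constants.
Variables (R : realType) (k0 : nat).

(** All factors lie in (0, 1], so the product is a lower bound of each. *)
Definition cmin : R := \prod_(k < k0.+1) kco R k.

Lemma kco_le1 k : kco R k <= 1.
Proof.
apply: le_trans (kap1_le1 R k.+1); rewrite /kap big_ord_recr /= expr1n mulr1 lerDr.
by apply: sumr_ge0 => i _; rewrite expr1n mulr1 ltW // kco_gt0.
Qed.

Lemma cmin_gt0 : 0 < cmin.
Proof. by apply: prodr_gt0 => k _; exact: kco_gt0. Qed.

Lemma cmin_le_kco l : (l <= k0)%N -> cmin <= kco R l.
Proof.
move=> lk; rewrite /cmin (bigD1 (Ordinal (lk : l < k0.+1)%N)) //= -[leRHS]mulr1.
apply: ler_wpM2l; first by rewrite ltW // kco_gt0.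
by apply: prodr_ile1 => k _; rewrite kco_le1 ltW // kco_gt0.
Qed.

Lemma cmin_le1 : cmin <= 1.
Proof. by apply: le_trans (cmin_le_kco (leqnn k0)) (kco_le1 _). Qed.

(** Chosen so that [cmin / (2 d)^k0 = 1 / (kappa d^k0)]. *)
Definition kappa : R := 2 ^+ k0 / cmin.

Lemma kappa_ge1 : 1 <= kappa.
Proof.
rewrite /kappa ler_pdivlMr ?cmin_gt0 // mul1r; apply: le_trans cmin_le1 _.
by rewrite exprn_ege1 // ler1n.
Qed.

Lemma sample_size_bounds (d n : nat) (L : R) (es : R) :
  (0 < d)%N -> 0 < L -> 0 <= es -> es ^+ 2 = 64 * (5 * k0 + 8)%:R * L / n%:R ->
  128 ^+ 2 * (5 * k0 + 8)%:R * kappa ^+ 2 * L * d%:R ^+ (2 * k0) <= n%:R -> (0 < n)%N ->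
  8 * Cup R k0 * kappa <= d%:R ->
  4 * es <= ((2 * d%:R) ^+ k0)^-1 /\ 2 * upb d es k0 <= cmin * ((2 * d%:R) ^+ k0)^-1 / 2.
Proof.
move=> d0 L0 es0 esE hn n0 hd; have k1 := kappa_ge1; have c0 := cmin_gt0; have c1 := cmin_le1.
have n0' : 0 < n%:R :> R by rewrite ltr0n.
have D0 : 0 < d%:R :> R by rewrite ltr0n.
set D := d%:R ^+ k0 : R; have Dp : 0 < D by rewrite exprn_gt0.
have kD : 0 < kappa * D by rewrite mulr_gt0 //; lra.
have thE : cmin * ((2 * d%:R) ^+ k0)^-1 = (kappa * D)^-1.
  by rewrite exprMn /kappa -/D; field; rewrite !lt0r_neq0 // exprn_gt0.
(* [128^2] in the sample size is 64, from [es^2], times the square of this 16. *)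
have e1 : es * (16 * (kappa * D)) <= 1.
  rewrite -(@expr_le1 _ 2) //; last by rewrite mulr_ge0 // mulr_ge0 // ltW.
  rewrite exprMn esE [leLHS]mulrAC ler_pdivrMr // mul1r; apply: le_trans hn.
  rewrite (mulnC 2 k0) exprM -/D; apply: eq_ler; ring.
have e2 : es <= (16 * (kappa * D))^-1.
  by rewrite -[leRHS]mul1r ler_pdivlMr // mulr_gt0.
have th : (kappa * D)^-1 <= ((2 * d%:R) ^+ k0)^-1.
  by rewrite -thE -[leRHS]mul1r; apply: ler_wpM2r.
have i0 : 0 < (kappa * D)^-1 by rewrite invr_gt0.
rewrite invfM in e2.
split; first by apply: le_trans th; lra.
rewrite thE /upb exprS -/D.
(* In units of [1 / (kappa D)] the lower bound on [d] gives 1/8 here; with 1/16 from [es], twice the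
   sum is 3/8, below the required 1/2. *)
have e3 : Cup R k0 / (d%:R * D) <= (kappa * D)^-1 / 8.
  rewrite ler_pdivrMr ?mulr_gt0 //.
  have -> : (kappa * D)^-1 / 8 * (d%:R * D) = d%:R / (8 * kappa).
    by field; rewrite !lt0r_neq0 //; lra.
  have kp0 : 0 < kappa by lra.
  have k8 : 0 < 8 * kappa by rewrite pmulr_rgt0.
  rewrite ler_pdivlMr //.
  by apply: le_trans hd; apply: eq_ler; ring.
lra.
Qed.

End Constants.

Lemma ln_ge_half (R : realType) (a : R) : 4 <= a -> 1 / 2 <= ln a.
Proof.
move=> a4; have a0 : 0 < a by lra.
rewrite -ler_expR lnK ?posrE //; have := @expR_le_quadratic R (1 / 2); lra.
Qed.

(** The noise and [e2] terms carry no logarithm: [L >= 1/2] lets each absorb a factor [2 L], and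
    dividing them by [g] inside the constant allows the common factor [g] in front. *)
Lemma error_arithmetic (R : realType) (n D L k g s2 kp N eta t es : R) :
  0 < n -> 1 <= D -> 1 / 2 <= L -> 1 <= kp -> 0 < g -> 0 < eta -> 0 < t ->
  0 <= s2 -> N <= 2 * kp * D + 1 -> n * es = 64 * k * L -> 0 <= k ->
  forall q : R,
  n^-1 * (3 * (4 * (4 * s2 * N) + (n * (q * g) / (2 * eta * t) +
     q ^+ 2 * (2 * (n * (g * es)) / (kp * D)^-1)) + D)) <=
  (3 / 2 * q) * g / (eta * t) + g * L *
    (3 * (32 * s2 * (2 * kp + 1) / g + q ^+ 2 * 128 * k * kp + 2 / g) * D / n).
Proof.
move=> n0 D1 L1 k1 g0 eta0 t0 s0 hN hes kk q.
have D0 : 0 < D by lra.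
have L0 : 0 < L by lra.
have h1 : 16 * s2 * N <= 32 * s2 * (2 * kp + 1) * L * D.
  apply: (@le_trans _ _ (16 * s2 * ((2 * kp + 1) * D))).
    apply: ler_wpM2l; first by rewrite mulr_ge0.
    by apply: le_trans hN _; lra.
  have -> : 32 * s2 * (2 * kp + 1) * L * D = 16 * s2 * ((2 * kp + 1) * D) * (2 * L) by ring.
  rewrite -[leLHS]mulr1; apply: ler_wpM2l; last by lra.
  by apply: mulr_ge0; [rewrite mulr_ge0 | apply: mulr_ge0; lra].
have h2 : D <= 2 * L * D.
  have h20 : 0 <= (2 * L - 1) * D by apply: mulr_ge0; lra.
  lra.
rewrite -(ler_pM2l n0) mulVKf ?lt0r_neq0 // invrK.
have -> : q ^+ 2 * (2 * (n * (g * es)) * (kp * D)) = q ^+ 2 * 128 * k * kp * g * L * D.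
  have -> : q ^+ 2 * (2 * (n * (g * es)) * (kp * D)) = q ^+ 2 * (2 * (g * (n * es)) * (kp * D)) by ring.
  by rewrite hes; ring.
have -> : n * (3 / 2 * q * g / (eta * t) + g * L *
    (3 * (32 * s2 * (2 * kp + 1) / g + q ^+ 2 * 128 * k * kp + 2 / g) * D / n)) =
    3 * (32 * s2 * (2 * kp + 1) * L * D + (n * (q * g) / (2 * eta * t) + q ^+ 2 * 128 * k * kp * g * L * D) + 2 * L * D).
  by field; rewrite !lt0r_neq0.
apply: ler_wpM2l => //; apply: lerD => //; apply: lerD => //.
by have -> : 4 * (4 * s2 * N) = 16 * s2 * N by ring.
Qed.

Theorem mainTheorem5 (R : realType) (k0 : nat) (gamma0 sigma0 : R) :
  (1 <= k0)%N -> 0 < gamma0 -> 0 < sigma0 ->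
  exists (C c1 c2 c3 : R) (dmin : nat),
  [/\ 0 < C, 0 < c1, 0 < c2, 0 < c3 &
  forall (d n t : nat) (delta eta tau : R),
    (dmin <= d)%N -> 0 < delta < 1 / 2 -> 0 < eta < 1 -> (1 <= t)%N ->
    0 < tau <= Num.sqrt (d%:R ^+ k0 / n%:R) ->
    C * ln (2 / delta) * d%:R ^+ (2 * k0) <= n%:R ->
  forall (dO : measure_display) (Om : measurableType dO) (P : probability Om R)
    (X : 'I_n -> Om -> 'rV[R]_d) (w : 'I_n -> Om -> R),
    (forall i, uniform_sphere_rv P (X i)) ->
    (forall om (i j : 'I_n), i != j -> X i om != X j om) ->
    noise_model P w sigma0 ->
    indep_sample P X w ->
  forall fstar : 'rV[R]_d -> R,
    (forall i, target_cond P (X i) k0 gamma0 fstar) ->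
  forall (F : Om -> 'rV[R]_d -> R) (U : Om -> 'M[R]_n) (lam : Om -> 'I_n -> R),
    (forall om, sorted_eigdec (gram (fun i => X i om)) (U om) (lam om)) ->
  exists G : set Om,
    [/\ measurable G,
        (P G >= (1 - 2 * delta - expR (- c3 * (r0 d k0)%:R))%:E)%E &
        forall om, G om ->
          let S := fun i => X i om in
          let wS : 'cV[R]_n := \col_i w i om in
          let y := evalS fstar S + wS in
          let M := 1%:M - eta *: (gram S *m topproj (r0 d k0) (U om)) in
          (exists v e1 e2 : 'cV[R]_n,
              [/\ evalS (F om) S - y = v + (e1 + e2),
                  v = - (M ^+ t *m evalS fstar S),
                  e1 = - (M ^+ t *m wS) &
                  vnorm e2 <= Num.sqrt n%:R * tau]) ->
          n%:R^-1 * \sum_(i < n) (F om (S i) - fstar (S i)) ^+ 2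
            <= c1 * gamma0 ^+ 2 / (eta * t%:R)
               + gamma0 ^+ 2 * ln (2 / delta) * (c2 * d%:R ^+ k0 / n%:R)]].
Proof.
move=> k0_gt0 gam0 sig0.
pose kp := kappa R k0; pose B2 : R := (5 * k0 + 8)%:R; pose q : R := k0.+1%:R.
have kp1 : 1 <= kp := kappa_ge1 R k0.
have B20 : 0 < B2 by rewrite ltr0n addn_gt0 orbT.
have q0 : 0 < q by rewrite ltr0n.
have g2 : 0 < gamma0 ^+ 2 by rewrite exprn_gt0.
(* The first constant is that of [sample_size_bounds], the next two are read off [error_arithmetic];
   the threshold for [d] yields [2 k0 <= d], [1 < d] and [8 Cup kp <= d]. *)
exists (128 ^+ 2 * B2 * kp ^+ 2), (3 / 2 * q),
  (3 * (32 * sigma0 ^+ 2 * (2 * kp + 1) / gamma0 ^+ 2 + q ^+ 2 * 128 * B2 * kp + 2 / gamma0 ^+ 2)),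
  (1 / 2), (maxn (2 * k0 + 2) (Num.truncn (8 * Cup R k0 * kp)).+1).
have kp0 : 0 < kp by lra.
split.
- by apply: mulr_gt0; [apply: mulr_gt0 => //; exact: exprn_gt0 | exact: exprn_gt0].
- by apply: mulr_gt0 => //; lra.
- apply: mulr_gt0 => //; apply: addr_gt0; last exact: divr_gt0.
  apply: addr_gt0; last first.
    apply: mulr_gt0 => //; apply: mulr_gt0 => //; apply: mulr_gt0 => //; exact: exprn_gt0.
  apply: divr_gt0 => //; apply: mulr_gt0; last by lra.
  by apply: mulr_gt0 => //; exact: exprn_gt0.
- by lra.
move=> d n t delta eta tau; rewrite geq_max => /andP[d1 d2] /andP[del0 del1] heta t1.
move=> /andP[tau0 tau1] hn dO Om P X w hX _ hw hind fstar hf F U lam hdec.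
pose L := ln (2 / delta).
have L12 : 1 / 2 <= L by apply: ln_ge_half; rewrite ler_pdivlMr //; lra.
have L0 : 0 < L by lra.
have d_gt1 : (1 < d)%N by apply: leq_trans d1; rewrite addn2.
have d_gt0 : (0 < d)%N by exact: ltnW.
have D0 : 0 < d%:R :> R by rewrite ltr0n.
pose D := d%:R ^+ k0 : R; have D1 : 1 <= D by rewrite exprn_ege1 // ler1n.
have Dp : 0 < D by lra.
have n_gt0 : (0 < n)%N.
  rewrite -(ltr0n R); apply: lt_le_trans hn.
  apply: mulr_gt0; last exact: exprn_gt0.
  apply: mulr_gt0 => //; apply: mulr_gt0; last exact: exprn_gt0.
  by apply: mulr_gt0 => //; exact: exprn_gt0.
have n0 : 0 < n%:R :> R by rewrite ltr0n.
have hd : 8 * Cup R k0 * kp <= d%:R.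
  by apply: le_trans (ltW (truncnS_gt _)) _; rewrite ler_nat.
pose i0 := Ordinal n_gt0.
have [u [mu [u_sym mu_gt0 f_eig f_gam f_pol]]] := target_cond_pol (hX i0) (hf i0).
have mw : forall i, measurable_fun setT (w i) := hw.1.
pose bad1 := bad P X i0 k0 gamma0 u L.
(* The top eigenvalues are at least [1 / (2 kp D)], so this [N] meets the condition of
   [top_coef_filter]; it is also at least [r0]. *)
pose N := (Num.truncn (2 * kp * D)).+1.
pose H om := gram_filter (fun i => X i om) N.
pose wv om : 'cV[R]_n := \col_i w i om.
pose bad2 := [set om | 4 * sigma0 ^+ 2 * N%:R <= sqn (H om *m wv om)].
have mb1 : measurable bad1 by exact: (bad_measurable hX).
have mb2 : measurable bad2.
  have ms : measurable_fun setT (fun om => - sqn (H om *m wv om)).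
    by apply: measurableT_comp => //; exact: (gram_filter_noise_measurable hX).
  have := le_set_measurable (- (4 * sigma0 ^+ 2 * N%:R)) ms.
  by congr measurable; apply/seteqP; split => om /=; rewrite lerN2.
have sph om i : dotp (X i om) (X i om) = 1 by exact: (hX i).2.1.
(* Here [2 exp (- L) = delta], so the features spend half of the allowance [2 delta]. *)
have Pb1 : (P bad1 <= delta%:E)%E.
  apply: le_trans (P_bad hX mw hind d_gt1 gam0 mu_gt0 f_eig f_gam L) _.
  rewrite lee_fin /L expRN lnK ?posrE ?divr_gt0 //.
  by rewrite invf_div mulrC divfK.
(* With [T = y = N] the exponent is [- N / 2], and [r0 <= 2 D <= N]. *)
have Pb2 : (P bad2 <= (expR (- (1 / 2) * (r0 d k0)%:R))%:E)%E.
  apply: le_trans (noise_quad_tail hX hw hind (H := H) (T := N%:R) N%:R _ sig0 _) _.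
  - by move=> i j; exact: gram_filter_measurable.
  - move=> om; have [f [h1 h2 h3]] := gram_filter_spec n_gt0 (sph om) (hdec om) N.
    by exists (U om), f; split => //; case: (hdec om).
  rewrite lee_fin ler_expR.
  have h1 : (r0 d k0)%:R <= 2 * D.
    by rewrite /D -natrX -natrM ler_nat; exact: r0_le.
  have h2 : 2 * kp * D <= N%:R by exact: ltW (truncnS_gt _).
  have h3 : 2 * D <= 2 * kp * D by rewrite -mulrA ler_pM2l // ler_peMl // ltW.
  lra.
exists (~` (bad1 `|` bad2)); split.
- by apply: measurableC; exact: measurableU.
- have mU : measurable (bad1 `|` bad2) by exact: measurableU.
  have hPU : (P (bad1 `|` bad2) <= (delta + expR (- (1 / 2) * (r0 d k0)%:R))%:E)%E.
    have hU := @measureU2 _ _ _ P _ _ mb1 mb2.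
    by apply: le_trans hU _; rewrite EFinD; exact: leeD.
  rewrite probability_setC //; apply: (@le_trans _ _ (1 - (delta + expR (- (1 / 2) * (r0 d k0)%:R))%:E)%E).
    by rewrite -EFinB lee_fin; lra.
  exact: leeB.
move=> om hG S wS y M [v [e1 [e2 [E vE e1E e2n]]]].
have nb1 : ~ bad1 om by move=> h; apply: hG; left.
have nb2 : ~ bad2 om by move=> h; apply: hG; right.
pose es := Num.sqrt (esq n k0 L).
have esq0 : 0 <= esq n k0 L by apply: esq_ge0 => //; exact: ltW.
have es0 : 0 <= es by exact: sqrtr_ge0.
have es2 : es ^+ 2 = esq n k0 L by rewrite sqr_sqrtr.
have [es_small up_small] := sample_size_bounds d_gt0 L0 es0 es2 hn n_gt0 hd.
have x_emp p : (p <= 4 * k0 + 6)%N -> moment_close S (smom P (X i0)) es p.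
  move=> hp; rewrite /moment_close es2; exact: (good_emp nb1).
have x_empf l N' : (l <= k0)%N ->
  \sum_(k < N') kco R k * tnorm k (fun v => fmom P (X i0) (pol l (u l)) v - empf (pol l (u l)) S v)
    <= gamma0 ^+ 2 * es ^+ 2.
  by move=> lk; rewrite es2; exact: (good_empf gam0 nb1).
have fE : evalS fstar S = target k0 u S.
  by apply/colP => i; rewrite !mxE; apply: f_pol; exact: sph.
have errE : \col_i (F om (S i) - fstar (S i)) =
    (wS - M ^+ t *m wS) + (- (M ^+ t *m target k0 u S)) + e2.
  rewrite -fE -vE; have -> : \col_i (F om (S i) - fstar (S i)) = evalS (F om) S - y + wS.
    by apply/colP => i; rewrite !mxE; ring.
  rewrite E e1E; apply/colP => i; rewrite !mxE; ring.
have -> : \sum_(i < n) (F om (S i) - fstar (S i)) ^+ 2 =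
    sqn ((wS - M ^+ t *m wS) + (- (M ^+ t *m target k0 u S)) + e2).
  by rewrite -errE; apply: eq_bigr => i _; rewrite mxE.
have k0d : (k0.*2 <= d)%N by apply: leq_trans d1; rewrite -muln2 mulnC leq_addr.
have thE : cmin R k0 * ((2 * d%:R) ^+ k0)^-1 = (kp * D)^-1.
  rewrite exprMn /kp /kappa -/D; field.
  by rewrite !lt0r_neq0 // ?exprn_gt0 // cmin_gt0.
have hN : 1 <= N%:R * (cmin R k0 * (((2 * d%:R) ^+ k0)^-1 / 2)).
  rewrite (mulrA (cmin R k0)) thE.
  have -> : N%:R * ((kp * D)^-1 / 2) = N%:R / (2 * kp * D) by field; rewrite !lt0r_neq0.
  have kD : 0 < 2 * kp * D by apply: mulr_gt0 => //; exact: mulr_gt0.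
  by rewrite ler_pdivlMr // mul1r; exact: ltW (truncnS_gt _).
have he2 : sqn e2 <= D.
  have s0 : 0 <= sqn e2 by exact: sqn_ge0.
  rewrite -[sqn e2]sqr_sqrtr //.
  have h1 : Num.sqrt (sqn e2) <= Num.sqrt n%:R * Num.sqrt (D / n%:R).
    apply: le_trans e2n _; apply: ler_wpM2l; first exact: sqrtr_ge0.
    exact: tau1.
  apply: (@le_trans _ _ ((Num.sqrt n%:R * Num.sqrt (D / n%:R)) ^+ 2)).
    by apply: lerXn2r; rewrite ?nnegrE ?sqrtr_ge0 // mulr_ge0 ?sqrtr_ge0.
  rewrite exprMn !sqr_sqrtr //; last by rewrite divr_ge0 // ltW.
  by rewrite mulrC divfK // lt0r_neq0.
apply: (@le_trans _ _ (n%:R^-1 * (3 * (4 * (4 * sigma0 ^+ 2 * N%:R) +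
   (n%:R * (q * gamma0 ^+ 2) / (2 * eta * t%:R) +
    q ^+ 2 * (2 * (n%:R * (gamma0 ^+ 2 * es ^+ 2)) / (kp * D)^-1)) + D)))).
  apply: ler_wpM2l; first by rewrite invr_ge0.
  rewrite -thE; apply: (gd_sample_error hX d_gt1 gam0 u_sym mu_gt0 f_eig f_gam (sph om)
    (hdec om) es0 x_emp x_empf k0_gt0 k0d es_small (cmin_gt0 R k0) (@cmin_le_kco R k0)
    up_small heta t1 hN) => //.
  by rewrite leNgt; apply/negP => h'; apply: nb2; exact: ltW.
have [eta0 _] := andP heta.
apply: error_arithmetic => //.
- by rewrite ltr0n.
- exact: sqr_ge0.
- have h2 : 0 <= 2 * kp * D by apply: mulr_ge0; [apply: mulr_ge0 => //|]; exact: ltW.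
  by rewrite /N -natr1 lerD2r truncn_le.
- by rewrite es2 /esq mulrC divfK // lt0r_neq0.
Qed.
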